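(* The promise problem $\textsc{Nim}_2(\mathrm{Succinct},\mathrm{PO})$ is $\mathrm{co}\mathbf{C_{=}P}$-hard under polynomial-time many-one reductions.
   Context: Poset game on a finite poset $P$: players alternate; a move chooses a point $x$ of the current poset $Q$ and replaces $Q$ by $\{y\in Q: x\not\le y\}$; the first player unable to move loses; $P$ is an $\exists$-game if the first player has a winning strategy. $\textsc{Nim}_2(\mathrm{Succinct},\mathrm{PO})$ is the promise problem: Input: a Boolean circuit $C$ with one output bit and two $n$-bit inputs. Promise: the relation $\{(y,z)\in\{0,1\}^n\times\{0,1\}^n: C(y,z)=1\}$ is a partial order on $\{0,1\}^n$, and this poset is a parallel (disjoint, mutually incomparable) union of at most $2$ chains. Question: is this poset an $\exists$-game? $\mathbf{C_{=}P}$ is the class of languages $L$ for which there are a #P function $f$ and a polynomial-time computable function $h$ with $x\in L\iff f(x)=h(x)$; $\mathrm{co}\mathbf{C_{=}P}$ is the class of complements of such languages. *)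

(* Defs.v *)
From Stdlib Require Import List Arith Bool.
Import ListNotations.

Inductive sym := S0 | S1 | SB.
Inductive move := ML | MR | MN.

Record TM := {
  tm_n : nat;
  tm_start : nat;
  tm_halt : nat -> bool;
  tm_delta : nat -> sym -> nat * sym * move;
  tm_start_ok : tm_start < tm_n;
  tm_delta_ok : forall q s, q < tm_n -> fst (fst (tm_delta q s)) < tm_n
}.

(* configuration: state, left part of tape (reversed), scanned symbol, right part *)
Definition config : Type := (nat * list sym * sym * list sym)%type.

Definition sym_of_bool (b : bool) : sym := if b then S1 else S0.

Definition tm_init (M : TM) (x : list bool) : config :=
  match x with
  | [] => (tm_start M, [], SB, [])
  | b :: x' => (tm_start M, [], sym_of_bool b, map sym_of_bool x')
  end.

Definition tm_step (M : TM) (c : config) : config :=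
  let '(q, l, a, r) := c in
  if tm_halt M q then c else
  let '(q', w, m) := tm_delta M q a in
  match m with
  | MN => (q', l, w, r)
  | ML => match l with
          | [] => (q', [], SB, w :: r)
          | a' :: l' => (q', l', a', w :: r)
          end
  | MR => match r with
          | [] => (q', w :: l, SB, [])
          | a' :: r' => (q', w :: l, a', r')
          end
  end.

Fixpoint tm_run (M : TM) (t : nat) (c : config) : config :=
  match t with
  | 0 => c
  | S t' => tm_run M t' (tm_step M c)
  end.

Fixpoint read_bits (s : list sym) : list bool :=
  match s with
  | S0 :: s' => false :: read_bits s'
  | S1 :: s' => true :: read_bits s'
  | _ => []
  end.

Definition tm_output (c : config) : list bool :=
  let '(_, _, a, r) := c in read_bits (a :: r).

(* M, started on x, is in a halting state after t steps (halting states are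
   absorbing, so this means "halts within t steps") with output y *)
Definition halts_with (M : TM) (x : list bool) (t : nat) (y : list bool) : Prop :=
  let c := tm_run M t (tm_init M x) in
  let '(q, _, _, _) := c in
  tm_halt M q = true /\ tm_output c = y.

Definition PolyTimeFun (f : list bool -> list bool) : Prop :=
  exists (M : TM) (c k : nat),
    forall x, halts_with M x (c * length x ^ k + c) (f x).

Definition PolyTimeDec (R : list bool -> bool) : Prop :=
  PolyTimeFun (fun x => [R x]).

Fixpoint bin_val (s : list bool) : nat :=
  match s with
  | [] => 0
  | b :: s' => (if b then 1 else 0) + 2 * bin_val s'
  end.

Definition PolyTimeNat (h : list bool -> nat) : Prop :=
  exists g, PolyTimeFun g /\ forall x, h x = bin_val (g x).

Fixpoint all_strings (n : nat) : list (list bool) :=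
  match n with
  | 0 => [[]]
  | S m => map (cons false) (all_strings m) ++ map (cons true) (all_strings m)
  end.

Definition pair_enc (x y : list bool) : list bool :=
  flat_map (fun b => [b; b]) x ++ [false; true] ++ y.

Definition SharpP (f : list bool -> nat) : Prop :=
  exists (R : list bool -> bool) (c k : nat),
    PolyTimeDec R /\
    forall x, f x = length (filter (fun y => R (pair_enc x y))
                                   (all_strings (c * length x ^ k + c))).

Definition CeqP (L : list bool -> Prop) : Prop :=
  exists f h, SharpP f /\ PolyTimeNat h /\ forall x, L x <-> f x = h x.

Definition coCeqP (L : list bool -> Prop) : Prop :=
  exists L', CeqP L' /\ forall x, L x <-> ~ L' x.

(* Boolean circuits: straight-line programs over {NOT, AND, OR};      *)
(* a gate refers to input bits or to previously computed gates.        *)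
(* The input is y ++ z with y, z in {0,1}^n; the output is the last gate. *)
Inductive gate :=
| GIn (i : nat)
| GNot (j : nat)
| GAnd (j k : nat)
| GOr (j k : nat).

Record circuit := { c_n : nat; c_gates : list gate }.

Definition gate_val (inp vals : list bool) (g : gate) : bool :=
  match g with
  | GIn i => nth i inp false
  | GNot j => negb (nth j vals false)
  | GAnd j k => nth j vals false && nth k vals false
  | GOr j k => nth j vals false || nth k vals false
  end.

Definition circuit_eval (C : circuit) (inp : list bool) : bool :=
  last (fold_left (fun vals g => vals ++ [gate_val inp vals g]) (c_gates C) [])
       false.

Fixpoint unary (n : nat) : list bool :=
  match n with 0 => [false] | S m => true :: unary m end.

Definition encode_gate (g : gate) : list bool :=
  match g with
  | GIn i => [false; false] ++ unary i
  | GNot j => [false; true] ++ unary j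
  | GAnd j k => [true; false] ++ unary j ++ unary k
  | GOr j k => [true; true] ++ unary j ++ unary k
  end.

Definition encode_circuit (C : circuit) : list bool :=
  unary (c_n C) ++ flat_map encode_gate (c_gates C).

Definition cle (C : circuit) (y z : list bool) : bool := circuit_eval C (y ++ z).

(* Promise: the relation is a partial order on {0,1}^n which is a parallel
   (disjoint, mutually incomparable) union of at most two chains *)
Definition PromisePO (C : circuit) : Prop :=
  let n := c_n C in
  (forall y, length y = n -> cle C y y = true) /\
  (forall y z, length y = n -> length z = n ->
      cle C y z = true -> cle C z y = true -> y = z) /\
  (forall y z w, length y = n -> length z = n -> length w = n ->
      cle C y z = true -> cle C z w = true -> cle C y w = true) /\
  (exists side : list bool -> bool,
      forall y z, length y = n -> length z = n ->
        (side y = side z -> cle C y z = true \/ cle C z y = true) /\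
        (side y <> side z -> cle C y z = false)).

(* Poset games.  win le k Q = true iff the player to move wins on the  *)
(* position Q (a list of points) when fuel k >= length Q.  A move picks *)
(* x in Q and replaces Q by {y in Q | ~ x <= y}; no move = loss.        *)
(* For a reflexive relation each move removes x, so fuel length Q       *)
(* suffices.                                                            *)
Fixpoint win {T : Type} (le : T -> T -> bool) (fuel : nat) (Q : list T) : bool :=
  match fuel with
  | 0 => false
  | S k => existsb (fun x => negb (win le k (filter (fun y => negb (le x y)) Q))) Q
  end.

Definition ExistsGame (C : circuit) : Prop :=
  let S := all_strings (c_n C) in
  win (cle C) (length S) S = true.

(* Main.v *)
Require Import Defs.
From Stdlib Require Import List Arith Bool ZArith Lia.
Import ListNotations.

(** Let [L] be the complement of [{x | f x = h x}], where [f x] counts the [w] of length [p] with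
    [R (pair_enc x w)].  For [m] large enough, colour the strings of length [m + 1]: [0w] is red when
    [R] accepts [pair_enc x (firstn p w)] and [w] vanishes beyond [p], and [1w] is red when the number
    [w] is at least [h x].  There are [f x + 2 ^ m - h x] red strings among [2 ^ (m + 1)].  Ordering
    strings of the same colour numerically gives two chains, the game is Nim with two heaps, and the
    first player wins iff the heaps differ, that is iff [f x <> h x].

    The colour of a string is computed by a circuit simulating the machines for [R] and [h], so the
    reduction only has to print a very regular circuit.  The simulation keeps the head at the centre of
    the row: the whole tape is shifted at each step, and every cell is the same function of three old
    cells, the old state and the old scanned symbol.  The printing is described by loop programs over
    registers holding numbers; they run in polynomial time as soon as no loop increments a register
    that bounds it.  On the tape of the printing machine the registers are interleaved unary tracks on the left of a
    blank home cell, and the output grows on its right. *)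

(** * Structured programs for Turing machines *)

(** The obstacle is that the reduction must be an explicit one-tape machine with an explicit
    polynomial time bound, so the circuit is designed around what unary counters can print.
    Registers only grow: the index of a wide gate is always a register plus a constant, and
    multiplying by one block size turns it into the index of a binary gate. This is why all wide
    gates get the same arity and blocks of equal length, and why pointers sweep the rows in one
    direction only. Centring the head removes its position from the data, so which gates a cell
    refers to depends only on its place in the row; the price is a margin at both ends of a row,
    into which errors creep one cell per step. The size of [m] is dictated by the comparison with
    [h x]: the output of its machine has at most as many bits as its input and running time allow,
    and with [m] beyond that number [h x < 2 ^ m], so subtracting it from [2 ^ m] makes sense. The
    heaps are equal when half of the strings are red, that is when [f x + 2 ^ m - h x = 2 ^ m]. *)

Definition tape := Z -> sym.
Definition upd (T : tape) (h : Z) (s : sym) : tape := fun z => if Z.eqb z h then s else T z.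
Definition dir (m : move) : Z := match m with ML => -1 | MR => 1 | MN => 0 end%Z.

Lemma upd_same T h s : upd T h s h = s.
Proof. unfold upd. now rewrite Z.eqb_refl. Qed.

Lemma upd_other T h s z : z <> h -> upd T h s z = T z.
Proof. intros H. unfold upd. destruct (Z.eqb_spec z h); congruence. Qed.

(** The two lists are read with default [SB], so trailing blanks do not matter and the tape becomes
    a total function on [Z]; running off the end of a list is then an ordinary move. *)
Definition crep (c : config) (q : nat) (T : tape) (h : Z) : Prop :=
  let '(q', l, a, r) := c in
  q' = q /\ a = T h /\
  (forall i, nth i l SB = T (h - 1 - Z.of_nat i)%Z) /\
  (forall i, nth i r SB = T (h + 1 + Z.of_nat i)%Z).

Lemma crep_ext c q T T' h : (forall z, T z = T' z) -> crep c q T h -> crep c q T' h.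
Proof.
  destruct c as [[[q' l] a] r]; cbn. intros E (-> & -> & Hl & Hr).
  repeat split; intros; rewrite ?Hl, ?Hr; apply E.
Qed.

Ltac upd_tac :=
  unfold upd;
  repeat match goal with |- context [Z.eqb ?a ?b] => destruct (Z.eqb_spec a b); try lia end;
  try reflexivity; try (f_equal; lia).

Lemma crep_step M c q T h q' w m :
  crep c q T h -> tm_halt M q = false -> tm_delta M q (T h) = (q', w, m) ->
  crep (tm_step M c) q' (upd T h w) (h + dir m).
Proof.
  destruct c as [[[q0 l] a] r]. intros (-> & -> & Hl & Hr) Hh Hd.
  cbn [tm_step]. rewrite Hh, Hd.
  destruct m; cbn [dir].
  - destruct l as [|a l]; cbn; repeat split.
    + specialize (Hl 0); cbn in Hl. rewrite Hl. upd_tac.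
    + intros i. specialize (Hl (S i)); cbn in Hl. destruct i; rewrite Hl; upd_tac.
    + intros [|i]; [upd_tac|]. rewrite Hr. upd_tac.
    + specialize (Hl 0); cbn in Hl. rewrite Hl. upd_tac.
    + intros i. specialize (Hl (S i)); cbn [nth] in Hl. rewrite Hl; upd_tac.
    + intros [|i]; [upd_tac|]. rewrite Hr. upd_tac.
  - destruct r as [|a r]; cbn; repeat split.
    + specialize (Hr 0); cbn in Hr. rewrite Hr. upd_tac.
    + intros [|i]; [upd_tac|]. rewrite Hl. upd_tac.
    + intros i. specialize (Hr (S i)); cbn in Hr. destruct i; rewrite Hr; upd_tac.
    + specialize (Hr 0); cbn in Hr. rewrite Hr. upd_tac.
    + intros [|i]; [upd_tac|]. rewrite Hl. upd_tac.
    + intros i. specialize (Hr (S i)); cbn [nth] in Hr. rewrite Hr; upd_tac.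
  - cbn; repeat split.
    + upd_tac.
    + intros i. rewrite Hl. upd_tac.
    + intros i. rewrite Hr. upd_tac.
Qed.

Lemma tm_run_add M a b c : tm_run M (a + b) c = tm_run M b (tm_run M a c).
Proof. revert c; induction a; intros; cbn; auto. Qed.

Lemma tm_run_halted M t q l a r :
  tm_halt M q = true -> tm_run M t (q, l, a, r) = (q, l, a, r).
Proof. intros H. induction t; cbn; auto. rewrite H. auto. Qed.

Lemma halts_with_mono M x t t' y : t <= t' -> halts_with M x t y -> halts_with M x t' y.
Proof.
  unfold halts_with. intros Hle H. replace t' with (t + (t' - t)) by lia.
  rewrite tm_run_add. destruct (tm_run M t (tm_init M x)) as [[[q l] a] r].
  rewrite tm_run_halted; tauto.
Qed.

Inductive prog :=
| PSkip
| PMove (m : move)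
| PWrite (s : sym)
| PSeq (p1 p2 : prog)
| PIf (b : sym -> bool) (p1 p2 : prog)
| PWhile (b : sym -> bool) (p : prog).

(* [exec p T h t T' h']: the index [t] is the exact number of steps of the compiled machine, jumps included. *)
Inductive exec : prog -> tape -> Z -> nat -> tape -> Z -> Prop :=
| ESkip T h : exec PSkip T h 0 T h
| EMove m T h : exec (PMove m) T h 1 T (h + dir m)
| EWrite s T h : exec (PWrite s) T h 1 (upd T h s) h
| ESeq p1 p2 T h t1 T1 h1 t2 T2 h2 :
    exec p1 T h t1 T1 h1 -> exec p2 T1 h1 t2 T2 h2 ->
    exec (PSeq p1 p2) T h (t1 + t2) T2 h2
| EIfT b p1 p2 T h t T1 h1 :
    b (T h) = true -> exec p1 T h t T1 h1 -> exec (PIf b p1 p2) T h (1 + t + 1) T1 h1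
| EIfF b p1 p2 T h t T1 h1 :
    b (T h) = false -> exec p2 T h t T1 h1 -> exec (PIf b p1 p2) T h (1 + t) T1 h1
| EWhileF b p T h : b (T h) = false -> exec (PWhile b p) T h 1 T h
| EWhileT b p T h t1 T1 h1 t2 T2 h2 :
    b (T h) = true -> exec p T h t1 T1 h1 -> exec (PWhile b p) T1 h1 t2 T2 h2 ->
    exec (PWhile b p) T h (1 + t1 + 1 + t2) T2 h2.

Inductive instr :=
| IMove (m : move)
| IWrite (s : sym)
| IBr (b : sym -> bool) (i j : nat).

(** Branch targets are absolute, hence the argument [base]. Each block is entered at its first
    instruction and left by falling off its end, so sequencing is concatenation. *)
Fixpoint compile (base : nat) (p : prog) : list instr :=
  match p with
  | PSkip => []
  | PMove m => [IMove m]
  | PWrite s => [IWrite s]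
  | PSeq p1 p2 => let c1 := compile base p1 in c1 ++ compile (base + length c1) p2
  | PIf b p1 p2 =>
      let c1 := compile (S base) p1 in
      let e1 := S base + length c1 in
      let c2 := compile (S e1) p2 in
      IBr b (S base) (S e1) :: c1 ++ IBr (fun _ => true) (S e1 + length c2) 0 :: c2
  | PWhile b p =>
      let c := compile (S base) p in
      IBr b (S base) (S (S base + length c)) :: c ++ [IBr (fun _ => true) base 0]
  end.

(* Branch targets are clamped so that [tm_delta_ok] holds for arbitrary code. *)
Definition code_delta (code : list instr) (q : nat) (s : sym) : nat * sym * move :=
  let clamp i := Nat.min i (length code) in
  match nth_error code q with
  | Some (IMove m) => (clamp (S q), s, m)
  | Some (IWrite w) => (clamp (S q), w, MN)
  | Some (IBr b i j) => (clamp (if b s then i else j), s, MN)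
  | None => (0, s, MN)
  end.

Program Definition tm_of_code (code : list instr) : TM :=
  {| tm_n := S (length code);
     tm_start := 0;
     tm_halt := fun q => length code <=? q;
     tm_delta := code_delta code |}.
Next Obligation. lia. Qed.
Next Obligation.
  unfold code_delta. destruct (nth_error code q) as [[]|]; cbn [fst snd]; lia.
Qed.

Definition code_at (code : list instr) (base : nat) (c : list instr) : Prop :=
  exists pre post, code = pre ++ c ++ post /\ length pre = base.

Lemma code_at_app code base c1 c2 :
  code_at code base (c1 ++ c2) -> code_at code base c1 /\ code_at code (base + length c1) c2.
Proof.
  intros (pre & post & -> & <-). split.
  - exists pre, (c2 ++ post). now rewrite <- app_assoc.
  - exists (pre ++ c1), post. rewrite length_app. now rewrite !app_assoc.
Qed.

Lemma code_at_cons code base i c :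
  code_at code base (i :: c) ->
  nth_error code base = Some i /\ base < length code /\ code_at code (S base) c.
Proof.
  intros (pre & post & -> & <-). repeat split.
  - rewrite nth_error_app2, Nat.sub_diag by lia. reflexivity.
  - rewrite !length_app. cbn. lia.
  - exists (pre ++ [i]), post. rewrite length_app, <- app_assoc. cbn. split; auto; lia.
Qed.

Lemma code_at_len code base c : code_at code base c -> base + length c <= length code.
Proof. intros (pre & post & -> & <-). rewrite !length_app. lia. Qed.

(** Quantifying over all configurations that represent the tape avoids naming the lists, which the
    tape does not determine. *)
Definition reaches (code : list instr) (q : nat) (T : tape) (h : Z) (t : nat)
    (q' : nat) (T' : tape) (h' : Z) : Prop :=
  forall c, crep c q T h -> crep (tm_run (tm_of_code code) t c) q' T' h'.

Lemma reaches_trans code q T h t q1 T1 h1 t' q2 T2 h2 :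
  reaches code q T h t q1 T1 h1 -> reaches code q1 T1 h1 t' q2 T2 h2 ->
  reaches code q T h (t + t') q2 T2 h2.
Proof. intros H1 H2 c Hc. rewrite tm_run_add. auto. Qed.

Lemma reaches_move code q T h m :
  nth_error code q = Some (IMove m) -> q < length code ->
  reaches code q T h 1 (S q) T (h + dir m).
Proof.
  intros Hn Hq c Hc. cbn [tm_run].
  apply crep_ext with (T := upd T h (T h)).
  { intros z. unfold upd. destruct (Z.eqb_spec z h); congruence. }
  apply crep_step with (q := q); auto.
  - cbn. apply Nat.leb_gt. lia.
  - cbn. unfold code_delta. rewrite Hn. repeat f_equal. lia.
Qed.

Lemma reaches_write code q T h s :
  nth_error code q = Some (IWrite s) -> q < length code ->
  reaches code q T h 1 (S q) (upd T h s) h.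
Proof.
  intros Hn Hq c Hc. cbn [tm_run].
  eapply eq_rect with (P := crep _ _ _); [|apply (Z.add_0_r h)].
  apply (crep_step (tm_of_code code)) with (m := MN) (q := q); auto.
  - cbn. apply Nat.leb_gt. lia.
  - cbn. unfold code_delta. rewrite Hn. repeat f_equal. lia.
Qed.

Lemma reaches_br code q T h b i j q' :
  nth_error code q = Some (IBr b i j) -> q < length code ->
  q' = (if b (T h) then i else j) -> q' <= length code ->
  reaches code q T h 1 q' T h.
Proof.
  intros Hn Hq -> Hle c Hc. cbn [tm_run].
  apply crep_ext with (T := upd T h (T h)).
  { intros z. unfold upd. destruct (Z.eqb_spec z h); congruence. }
  eapply eq_rect with (P := crep _ _ _); [|apply (Z.add_0_r h)].
  apply (crep_step (tm_of_code code)) with (m := MN) (q := q); auto.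
  - cbn. apply Nat.leb_gt. lia.
  - cbn. unfold code_delta. rewrite Hn. repeat f_equal. lia.
Qed.

(** Induction on the execution rather than on the program, since a loop recurs with the same
    code. *)
Lemma compile_correct code p T h t T' h' :
  exec p T h t T' h' ->
  forall base, code_at code base (compile base p) ->
  reaches code base T h t (base + length (compile base p)) T' h'.
Proof.
  induction 1; intros base Hc; pose proof (code_at_len _ _ _ Hc) as Hlen; cbn in *.
  - intros c Hcr. cbn. now rewrite Nat.add_0_r.
  - rewrite Nat.add_1_r. apply code_at_cons in Hc as (? & ? & _). now apply reaches_move.
  - rewrite Nat.add_1_r. apply code_at_cons in Hc as (? & ? & _). now apply reaches_write.
  - apply code_at_app in Hc as [Hc1 Hc2]. rewrite length_app, Nat.add_assoc.
    eapply reaches_trans; eauto.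
  - apply code_at_cons in Hc as (Hn & Hb & Hc).
    apply code_at_app in Hc as [Hc1 Hc2].
    apply code_at_cons in Hc2 as (Hn2 & Hb2 & Hc2).
    rewrite length_app in *. cbn [length] in *.
    change (S (t + 1)) with (1 + (t + 1)). eapply reaches_trans.
    { eapply reaches_br; [exact Hn| lia | rewrite H; reflexivity | lia]. }
    eapply reaches_trans; [apply IHexec; auto|].
    eapply reaches_br; [exact Hn2 | lia | cbn; lia | lia].
  - apply code_at_cons in Hc as (Hn & Hb & Hc).
    apply code_at_app in Hc as [Hc1 Hc2].
    apply code_at_cons in Hc2 as (Hn2 & Hb2 & Hc2).
    rewrite length_app in *. cbn [length] in *.
    change (S t) with (1 + t). eapply reaches_trans.
    { eapply reaches_br; [exact Hn| lia | rewrite H; reflexivity | lia]. }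
    replace (base + S (length (compile (S base) p1) +
      S (length (compile (S (S (base + length (compile (S base) p1)))) p2))))
      with (S (S (base + length (compile (S base) p1))) +
        length (compile (S (S (base + length (compile (S base) p1)))) p2)) by lia.
    apply IHexec. auto.
  - apply code_at_cons in Hc as (Hn & Hb & Hc).
    rewrite length_app in *. cbn [length] in *.
    eapply reaches_br; [exact Hn| lia | rewrite H; lia | lia].
  (* The code of the whole loop is kept: the remaining iterations enter it again at [base]. *)
  - pose proof Hc as Hc0.
    apply code_at_cons in Hc as (Hn & Hb & Hc).
    apply code_at_app in Hc as [Hc1 Hc2].
    apply code_at_cons in Hc2 as (Hn2 & Hb2 & Hc2).
    change (S (t1 + 1 + t2)) with (1 + (t1 + 1 + t2)).
    rewrite <- Nat.add_assoc.
    eapply reaches_trans.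
    { eapply reaches_br; [exact Hn| lia | rewrite H; reflexivity | lia]. }
    eapply reaches_trans; [apply IHexec1; auto|].
    eapply reaches_trans.
    { eapply reaches_br; [exact Hn2 | lia | cbn; reflexivity | lia]. }
    apply IHexec2. exact Hc0.
Qed.

(** The input starts at cell 1, which leaves cell 0 free to be the blank home cell. *)
Definition tape_of_input (x : list bool) : tape :=
  fun z => if (z <? 1)%Z then SB else nth (Z.to_nat (z - 1)) (map sym_of_bool x) SB.

Lemma nth_nil_default {X} i (d : X) : nth i [] d = d.
Proof. now destruct i. Qed.

Lemma tm_init_crep M x : crep (tm_init M x) (tm_start M) (tape_of_input x) 1.
Proof.
  unfold tape_of_input.
  destruct x as [|b x]; cbn -[Z.of_nat nth Z.add Z.sub]; repeat split; intros;
    rewrite ?nth_nil_default; try reflexivity;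
    match goal with |- context [Z.ltb ?a 1] => destruct (Z.ltb_spec a 1) end;
    try lia; auto.
  match goal with |- context [Z.to_nat ?a] => replace (Z.to_nat a) with (S i) by lia end.
  reflexivity.
Qed.

Definition bit_sym (s : sym) : bool := match s with S1 => true | _ => false end.
Definition nonblank (s : sym) : bool := match s with SB => false | _ => true end.

Lemma read_bits_spec l y :
  (forall i, i < length y -> nth i l SB = sym_of_bool (nth i y false)) ->
  nth (length y) l SB = SB -> read_bits l = y.
Proof.
  revert y; induction l as [|s l IH]; intros y H1 H2.
  - destruct y as [|b y]; auto. specialize (H1 0). cbn in H1. destruct b; cbn in H1; discriminate H1; lia.
  - destruct y as [|b y].
    + cbn in H2. subst s. reflexivity.
    + specialize (IH y). cbn in H2. pose proof (H1 0 ltac:(cbn; lia)) as E. cbn in E. subst s.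
      assert (read_bits l = y) as <-.
      { apply IH; auto. intros i Hi. apply (H1 (S i)). cbn; lia. }
      destruct b; reflexivity.
Qed.

Lemma exec_halts_with p x y t T' h' :
  exec p (tape_of_input x) 1 t T' h' ->
  (forall i, i < length y -> T' (h' + Z.of_nat i)%Z = sym_of_bool (nth i y false)) ->
  T' (h' + Z.of_nat (length y))%Z = SB ->
  halts_with (tm_of_code (compile 0 p)) x t y.
Proof.
  intros He H1 H2.
  pose proof (compile_correct (compile 0 p) _ _ _ _ _ _ He 0) as Hr.
  specialize (Hr ltac:(exists [], []; now rewrite app_nil_r)).
  specialize (Hr _ (tm_init_crep (tm_of_code (compile 0 p)) x)). cbn [Nat.add] in Hr.
  unfold halts_with. destruct (tm_run _ _ _) as [[[q l] a] r].
  destruct Hr as (-> & -> & Hl & Hr). split.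
  - cbn. now rewrite Nat.leb_refl.
  - cbn [tm_output]. apply read_bits_spec.
    + intros i Hi. rewrite <- H1 by auto. destruct i; cbn [nth]; [f_equal; lia|].
      rewrite Hr. f_equal; lia.
    + rewrite <- H2 at 2. destruct (length y); cbn [nth]; [f_equal; lia|].
      rewrite Hr. f_equal; lia.
Qed.

(** * Unary counters on the tape *)

Fixpoint rep (k : nat) (p : prog) : prog :=
  match k with 0 => PSkip | S k' => PSeq p (rep k' p) end.

Lemma exec_eq p T h t T' h' t' h'' :
  exec p T h t' T' h'' -> t' = t -> h'' = h' -> exec p T h t T' h'.
Proof. intros H -> ->. exact H. Qed.

Lemma exec_rep_move k m T h : exec (rep k (PMove m)) T h k T (h + Z.of_nat k * dir m)%Z.
Proof.
  revert h; induction k; intros h; cbn [rep].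
  - eapply exec_eq; [constructor | lia | lia].
  - eapply exec_eq; [eapply ESeq; [constructor | apply IHk] | lia | lia].
Qed.

Lemma exec_while_move b m k T h :
  (forall i, i < k -> b (T (h + Z.of_nat i * dir m)%Z) = true) ->
  b (T (h + Z.of_nat k * dir m)%Z) = false ->
  exec (PWhile b (PMove m)) T h (3 * k + 1) T (h + Z.of_nat k * dir m)%Z.
Proof.
  revert h; induction k; intros h H1 H2.
  - rewrite Z.mul_0_l, Z.add_0_r in *. apply EWhileF. auto.
  - eapply exec_eq; [eapply EWhileT; [|constructor|apply IHk]|lia|lia].
    + specialize (H1 0 ltac:(lia)). now rewrite Z.mul_0_l, Z.add_0_r in H1.
    + intros i Hi. specialize (H1 (S i) ltac:(lia)). rewrite <- H1. do 2 f_equal. lia.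
    + rewrite <- H2. do 2 f_equal. lia.
Qed.

(* Cell [o] of the [j]-th block of width [w]; blocks grow to the left of the home cell 0. *)
Definition pos (w j o : nat) : Z := (- Z.of_nat (1 + (w * j + o)))%Z.

Lemma pos_inj w j o j' o' : o < w -> o' < w -> pos w j o = pos w j' o' -> j = j' /\ o = o'.
Proof.
  unfold pos. intros H1 H2 H. apply (Nat.div_mod_unique w); lia.
Qed.

(* Track 0 marks the block next to home, track 1 holds the input, the others hold unary counters. *)
Definition track (x : list bool) (k : nat -> nat) (o j : nat) : bool :=
  match o with
  | 0 => j =? 0
  | 1 => nth j x false
  | S (S i) => j <? k i
  end.

(** On the tracks [false] is a blank, unlike in [sym_of_bool]: fresh tape then already represents
    zero counters and an empty input, arbitrarily far to the left. *)
Definition sym1 (b : bool) : sym := if b then S1 else SB.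

Lemma bit_sym1 b : bit_sym (sym1 b) = b.
Proof. now destruct b. Qed.

Definition RepL (w : nat) (x : list bool) (k : nat -> nat) (T : tape) : Prop :=
  forall o j, o < w -> T (pos w j o) = sym1 (track x k o j).

Definition RepR (y : list bool) (T : tape) : Prop :=
  T 0%Z = SB /\ forall i, T (1 + Z.of_nat i)%Z = nth i (map sym_of_bool y) SB.

Definition kset (k : nat -> nat) (i v : nat) : nat -> nat := fun j => if j =? i then v else k j.

Lemma RepL_ext w x k k' T : (forall i, 2 + i < w -> k i = k' i) -> RepL w x k T -> RepL w x k' T.
Proof.
  intros E H o j Ho. rewrite H by auto. destruct o as [|[|o]]; cbn; auto.
  rewrite E by lia. reflexivity.
Qed.

Lemma RepL_upd_right w x k T h s : (0 <= h)%Z -> RepL w x k T -> RepL w x k (upd T h s).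
Proof.
  intros Hh H o j Ho. rewrite upd_other; [now apply H|]. unfold pos. lia.
Qed.

Lemma RepR_upd_left y T h s : (h < 0)%Z -> RepR y T -> RepR y (upd T h s).
Proof.
  intros Hh [H1 H2]. split; [|intros i]; rewrite upd_other by lia; auto.
Qed.

Definition walk (w o : nat) : prog :=
  PSeq (rep (1 + o) (PMove ML)) (PWhile bit_sym (rep w (PMove ML))).

Lemma exec_walk_from w o T j v :
  (forall i, i < v -> bit_sym (T (pos w (j + i) o)) = true) ->
  bit_sym (T (pos w (j + v) o)) = false ->
  exec (PWhile bit_sym (rep w (PMove ML))) T (pos w j o) (v * (w + 2) + 1) T (pos w (j + v) o).
Proof.
  revert j; induction v; intros j H1 H2.
  - rewrite Nat.add_0_r in *. apply EWhileF. auto.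
  - eapply exec_eq; [eapply EWhileT; [|apply exec_rep_move|]| |].
    + specialize (H1 0 ltac:(lia)). now rewrite Nat.add_0_r in H1.
    + replace (pos w j o + Z.of_nat w * dir ML)%Z with (pos w (S j) o)
        by (unfold pos; cbn [dir]; lia).
      apply IHv.
      * intros i Hi. specialize (H1 (S i) ltac:(lia)). rewrite <- H1. do 3 f_equal. lia.
      * rewrite <- H2. do 3 f_equal. lia.
    + lia.
    + f_equal; lia.
Qed.

Lemma exec_walk w x k T i :
  RepL w x k T -> 2 + i < w ->
  exec (walk w (2 + i)) T 0 ((1 + (2 + i)) + (k i * (w + 2) + 1)) T (pos w (k i) (2 + i)).
Proof.
  intros H Hi. eapply ESeq; [apply exec_rep_move|].
  replace (0 + Z.of_nat (1 + (2 + i)) * dir ML)%Z with (pos w 0 (2 + i))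
    by (unfold pos; cbn [dir]; lia).
  apply exec_walk_from with (j := 0); intros; rewrite H, bit_sym1 by lia; cbn.
  - apply Nat.ltb_lt. lia.
  - apply Nat.ltb_irrefl.
Qed.

(** Track 0 is marked only in block 0, so home is found from any block without knowing its
    number. *)
Definition ret (w o : nat) : prog :=
  PSeq (rep o (PMove MR))
    (PSeq (PWhile (fun s => negb (bit_sym s)) (rep w (PMove MR))) (PMove MR)).

Lemma exec_ret_loop w x k T j :
  RepL w x k T -> 0 < w ->
  exec (PWhile (fun s => negb (bit_sym s)) (rep w (PMove MR))) T (pos w j 0)
    (j * (w + 2) + 1) T (pos w 0 0).
Proof.
  intros H Hw. induction j.
  - apply EWhileF. rewrite H by auto. reflexivity.
  - eapply exec_eq; [eapply EWhileT; [|apply exec_rep_move|]| |reflexivity].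
    + rewrite H by auto. reflexivity.
    + replace (pos w (S j) 0 + Z.of_nat w * dir MR)%Z with (pos w j 0)
        by (unfold pos; cbn [dir]; lia).
      exact IHj.
    + lia.
Qed.

Lemma exec_ret w x k T j o :
  RepL w x k T -> 0 < w ->
  exec (ret w o) T (pos w j o) (o + (j * (w + 2) + 1 + 1)) T 0.
Proof.
  intros H Hw. eapply ESeq; [apply exec_rep_move|].
  replace (pos w j o + Z.of_nat o * dir MR)%Z with (pos w j 0) by (unfold pos; cbn [dir]; lia).
  eapply exec_eq; [eapply ESeq; [eapply exec_ret_loop; eauto | constructor] | reflexivity |].
  unfold pos. cbn [dir]. lia.
Qed.

Definition shift (o o' : nat) : prog :=
  if o <=? o' then rep (o' - o) (PMove ML) else rep (o - o') (PMove MR).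

Lemma exec_shift w T j o o' :
  exec (shift o o') T (pos w j o) ((o' - o) + (o - o')) T (pos w j o').
Proof.
  unfold shift. destruct (Nat.leb_spec o o');
    (eapply exec_eq; [apply exec_rep_move | lia | unfold pos; cbn [dir]; lia]).
Qed.

Definition inc (w i : nat) : prog :=
  PSeq (walk w (2 + i)) (PSeq (PWrite S1) (ret w (2 + i))).

Lemma RepL_inc w x k T i :
  RepL w x k T -> 2 + i < w ->
  RepL w x (kset k i (S (k i))) (upd T (pos w (k i) (2 + i)) S1).
Proof.
  intros H Hi o j Ho. unfold upd.
  destruct (Z.eqb_spec (pos w j o) (pos w (k i) (2 + i))) as [E|E].
  - apply pos_inj in E as [-> ->]; auto. cbn [track Nat.add]. unfold kset. rewrite Nat.eqb_refl.
    now rewrite (proj2 (Nat.ltb_lt (k i) (S (k i)))) by lia.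
  - rewrite H by auto. destruct o as [|[|o]]; auto. cbn [track]. unfold kset.
    destruct (Nat.eqb_spec o i) as [->|]; auto. f_equal.
    assert (j <> k i) by (intros ->; now apply E).
    destruct (Nat.ltb_spec j (k i)), (Nat.ltb_spec j (S (k i))); auto; lia.
Qed.

Lemma exec_inc_upd w x k T i :
  RepL w x k T -> 2 + i < w ->
  exists t, exec (inc w i) T 0 t (upd T (pos w (k i) (2 + i)) S1) 0 /\
    t <= 2 * ((k i + 1) * (w + 3)).
Proof.
  intros H Hi.
  pose proof (RepL_inc _ _ _ _ _ H Hi) as H'.
  eexists. split.
  - eapply ESeq; [eapply exec_walk; eauto|]. eapply ESeq; [constructor|].
    eapply exec_ret; [exact H' | lia].
  - nia.
Qed.

Lemma exec_inc w x k y T i :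
  RepL w x k T -> RepR y T -> 2 + i < w ->
  exists t T', exec (inc w i) T 0 t T' 0 /\ RepL w x (kset k i (S (k i))) T' /\ RepR y T' /\
    t <= 2 * ((k i + 1) * (w + 3)).
Proof.
  intros H Hr Hi. destruct (exec_inc_upd _ _ _ _ _ H Hi) as (t & He & Ht).
  do 2 eexists. split; [exact He|]. split; [now apply RepL_inc|]. split; [|exact Ht].
  apply RepR_upd_left; auto. unfold pos; lia.
Qed.

(** While the input is being loaded, counter [i] holds the number of bits read, so the first free
    cell of its track lies in the block where the next bit belongs. *)
Definition set_input (w i : nat) : prog :=
  PSeq (walk w (2 + i)) (PSeq (shift (2 + i) 1) (PSeq (PWrite S1) (ret w 1))).

Lemma nth_snoc (x : list bool) b j :
  nth j (x ++ [b]) false = if j =? length x then b else nth j x false.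
Proof.
  destruct (Nat.eqb_spec j (length x)) as [->|].
  - apply nth_middle.
  - destruct (Nat.lt_ge_cases j (length x)).
    + now rewrite app_nth1.
    + rewrite !nth_overflow; auto. rewrite length_app; cbn; lia.
Qed.

Lemma RepL_set_input w x k T :
  RepL w x k T -> 1 < w -> RepL w (x ++ [true]) k (upd T (pos w (length x) 1) S1).
Proof.
  intros H Hw o j Ho. unfold upd.
  destruct (Z.eqb_spec (pos w j o) (pos w (length x) 1)) as [E|E].
  - apply pos_inj in E as [-> ->]; auto. cbn. now rewrite nth_snoc, Nat.eqb_refl.
  - rewrite H by auto. destruct o as [|[|o]]; auto. cbn. rewrite nth_snoc.
    destruct (Nat.eqb_spec j (length x)) as [->|]; congruence.
Qed.

(** Cells beyond the bits read so far are blank and hence already read as [false]: a zero bit needs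
    no write. *)
Lemma RepL_snoc_false w x k T : RepL w x k T -> RepL w (x ++ [false]) k T.
Proof.
  intros H o j Ho. rewrite H by auto. destruct o as [|[|o]]; auto. cbn. rewrite nth_snoc.
  destruct (Nat.eqb_spec j (length x)) as [->|]; auto. now rewrite nth_overflow.
Qed.

Lemma exec_set_input w x k T i :
  RepL w x k T -> 2 + i < w -> k i = length x ->
  exists t, exec (set_input w i) T 0 t (upd T (pos w (length x) 1) S1) 0 /\
    RepL w (x ++ [true]) k (upd T (pos w (length x) 1) S1) /\
    t <= 3 * ((k i + 1) * (w + 3)).
Proof.
  intros H Hi Hk.
  assert (H' := RepL_set_input _ _ _ _ H ltac:(lia)).
  eexists. repeat split.
  - eapply ESeq; [eapply exec_walk; eauto|]. rewrite Hk.
    eapply ESeq; [eapply exec_shift|]. eapply ESeq; [constructor|].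
    eapply exec_ret; [exact H' | lia].
  - exact H'.
  - rewrite Hk. nia.
Qed.

Definition clear (w i : nat) : prog :=
  PSeq (rep (1 + (2 + i)) (PMove ML))
    (PSeq (PWhile bit_sym (PSeq (PWrite SB) (rep w (PMove ML)))) (ret w (2 + i))).

(* The state of the clearing loop of [clear]: the cells of counter [i] below [j] are already blank. *)
Definition RepL_from (w : nat) (x : list bool) (k : nat -> nat) (i j0 : nat) (T : tape) : Prop :=
  forall o j, o < w ->
    T (pos w j o) = sym1 (track x k o j && negb ((o =? 2 + i) && (j <? j0))).

Lemma exec_clear_loop w x k y i n j T :
  2 + i < w -> j + n = k i -> RepL_from w x k i j T -> RepR y T ->
  exists T', exec (PWhile bit_sym (PSeq (PWrite SB) (rep w (PMove ML)))) T (pos w j (2 + i))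
      (n * (w + 3) + 1) T' (pos w (k i) (2 + i)) /\
    RepL_from w x k i (k i) T' /\ RepR y T'.
Proof.
  intros Hi. revert j T; induction n; intros j T Hj H Hr.
  - rewrite Nat.add_0_r in Hj. subst j. exists T. split; auto. apply EWhileF.
    rewrite H, bit_sym1 by auto. cbn [track Nat.add]. now rewrite Nat.ltb_irrefl.
  - destruct (IHn (S j) (upd T (pos w j (2 + i)) SB)) as (T' & He & HT); try lia.
    + intros o j' Ho. unfold upd. destruct (Z.eqb_spec (pos w j' o) (pos w j (2 + i))) as [E|E].
      * apply pos_inj in E as [-> ->]; auto. rewrite Nat.eqb_refl.
        rewrite (proj2 (Nat.ltb_lt j (S j))) by lia. now rewrite andb_false_r.
      * rewrite H by auto. f_equal. f_equal. f_equal.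
        destruct (Nat.eqb_spec o (2 + i)) as [->|]; auto.
        assert (j' <> j) by (intros ->; now apply E).
        destruct (Nat.ltb_spec j' j), (Nat.ltb_spec j' (S j)); auto; lia.
    + apply RepR_upd_left; auto. unfold pos; lia.
    + exists T'. split; auto. eapply exec_eq; [eapply EWhileT|..].
      * rewrite H, bit_sym1 by auto. cbn [track Nat.add].
        rewrite (proj2 (Nat.ltb_lt j (k i))) by lia. rewrite Nat.ltb_irrefl.
        now rewrite andb_false_r.
      * eapply ESeq; [constructor | apply exec_rep_move].
      * replace (pos w j (2 + i) + Z.of_nat w * dir ML)%Z with (pos w (S j) (2 + i))
          by (unfold pos; cbn [dir]; lia). exact He.
      * lia.
      * reflexivity.
Qed.

Lemma exec_clear w x k y T i :
  RepL w x k T -> RepR y T -> 2 + i < w ->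
  exists t T', exec (clear w i) T 0 t T' 0 /\ RepL w x (kset k i 0) T' /\ RepR y T' /\
    t <= 3 * ((k i + 1) * (w + 3)).
Proof.
  intros H Hr Hi.
  destruct (exec_clear_loop w x k y i (k i) 0 T) as (T' & He & HT & HR); auto.
  { intros o j Ho. rewrite H by auto.
    now rewrite (proj2 (Nat.ltb_ge j 0)), andb_false_r, andb_true_r by lia. }
  assert (HL : RepL w x (kset k i 0) T').
  { intros o j Ho. rewrite HT by auto. f_equal.
    destruct o as [|[|o]]; try apply andb_true_r.
    cbn [track Nat.add Nat.eqb]. unfold kset.
    destruct (Nat.eqb_spec o i) as [->|]; [|apply andb_true_r].
    rewrite (proj2 (Nat.ltb_ge j 0)) by lia. destruct (j <? k i); auto. }
  do 2 eexists. repeat split.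
  - eapply ESeq; [apply exec_rep_move|].
    replace (0 + Z.of_nat (1 + (2 + i)) * dir ML)%Z with (pos w 0 (2 + i))
      by (unfold pos; cbn [dir]; lia).
    eapply ESeq; [exact He|]. eapply exec_ret; [exact HL | lia].
  - exact HL.
  - apply HR.
  - apply HR.
  - nia.
Qed.

Definition push (b : bool) : prog :=
  PSeq (PMove MR) (PSeq (PWhile nonblank (PMove MR))
    (PSeq (PWrite (sym_of_bool b)) (PWhile nonblank (PMove ML)))).

Lemma nonblank_sym_of_bool b : nonblank (sym_of_bool b) = true.
Proof. now destruct b. Qed.

Lemma nth_syms_lt y i : i < length y -> nonblank (nth i (map sym_of_bool y) SB) = true.
Proof.
  intros H. rewrite nth_indep with (d' := sym_of_bool false) by now rewrite length_map.
  rewrite map_nth. apply nonblank_sym_of_bool.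
Qed.

Lemma nth_syms_ge y i : length y <= i -> nth i (map sym_of_bool y) SB = SB.
Proof. intros H. apply nth_overflow. now rewrite length_map. Qed.

Lemma exec_push w x k y T b :
  RepL w x k T -> RepR y T ->
  exists t T', exec (push b) T 0 t T' 0 /\ RepL w x k T' /\ RepR (y ++ [b]) T' /\
    t <= 10 * (length y + 1).
Proof.
  intros H [Hr0 Hr].
  set (h := (1 + Z.of_nat (length y))%Z).
  set (T' := upd T h (sym_of_bool b)).
  assert (HR : RepR (y ++ [b]) T').
  { split.
    - unfold T'. rewrite upd_other; auto. unfold h; lia.
    - intros i. unfold T', upd. rewrite map_app. destruct (Z.eqb_spec (1 + Z.of_nat i) h) as [E|E].
      + assert (i = length y) as -> by (unfold h in E; lia).
        rewrite <- (length_map sym_of_bool y). cbn [map]. now rewrite nth_middle.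
      + rewrite Hr. destruct (Nat.lt_ge_cases i (length y)).
        * rewrite app_nth1; auto. now rewrite length_map.
        * rewrite !nth_overflow; auto; rewrite ?length_app, !length_map; cbn; unfold h in E; lia. }
  do 2 eexists. split; [|split; [|split; [exact HR|]]].
  - eapply ESeq; [constructor|]. eapply ESeq.
    { apply exec_while_move with (k := length y).
      - intros i Hi. cbn [dir]. replace (0 + 1 + Z.of_nat i * 1)%Z with (1 + Z.of_nat i)%Z by lia.
        rewrite Hr. now apply nth_syms_lt.
      - cbn [dir].
        replace (0 + 1 + Z.of_nat (length y) * 1)%Z with (1 + Z.of_nat (length y))%Z by lia.
        rewrite Hr, nth_syms_ge; auto. }
    replace (0 + dir MR + Z.of_nat (length y) * dir MR)%Z with h by (unfold h; cbn [dir]; lia).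
    eapply ESeq; [constructor|]. fold T'. eapply exec_eq.
    { apply exec_while_move with (k := S (length y)).
      - intros i Hi. cbn [dir].
        replace (h + Z.of_nat i * -1)%Z with (1 + Z.of_nat (length y - i))%Z by (unfold h; lia).
        rewrite (proj2 HR). apply nth_syms_lt. rewrite length_app; cbn; lia.
      - cbn [dir]. replace (h + Z.of_nat (S (length y)) * -1)%Z with 0%Z by (unfold h; lia).
        now rewrite (proj1 HR). }
    { reflexivity. }
    { unfold h; cbn [dir]; lia. }
  - apply RepL_upd_right; auto. unfold h; lia.
  - lia.
Qed.

(** * Register programs *)

Definition goto (w i o : nat) : prog := PSeq (walk w (2 + i)) (shift (2 + i) o).

Lemma exec_goto w x k T i o :
  RepL w x k T -> 2 + i < w -> o < w ->
  exists t, exec (goto w i o) T 0 t T (pos w (k i) o) /\ t <= 2 * ((k i + 1) * (w + 3)).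
Proof.
  intros H Hi Ho. eexists. split.
  - eapply ESeq; [eapply exec_walk; eauto | apply exec_shift].
  - nia.
Qed.

(* Counter [i] runs from 0 up to the value of track [o]; [body] starts on cell [o] of block [i] and ends at home. *)
Definition loop (w i o : nat) (body : prog) : prog :=
  PSeq (goto w i o)
    (PSeq (PWhile bit_sym (PSeq body (PSeq (inc w i) (goto w i o))))
      (PSeq (ret w o) (clear w i))).

Lemma kset_same k i v : kset k i v i = v.
Proof. unfold kset. now rewrite Nat.eqb_refl. Qed.

Lemma kset_other k i v j : j <> i -> kset k i v j = k j.
Proof. intros H. unfold kset. destruct (Nat.eqb_spec j i); congruence. Qed.

Lemma RepL_kset_kset w x k i u v T : RepL w x (kset (kset k i u) i v) T -> RepL w x (kset k i v) T.
Proof.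
  apply RepL_ext. intros j _. unfold kset. destruct (j =? i); auto.
Qed.

Section Loop.
Variables (w : nat) (x : list bool) (i b N tb : nat) (body : prog).
(** [kf j] and [yf j] are the counters and the output after [j] iterations, where the value of the
    loop counter [i] itself is overridden by [kset]. [HN] keeps the bound constant during the
    loop. *)
Variables (kf : nat -> nat -> nat) (yf : nat -> list bool).
Hypothesis Hi : 2 + i < w.
Hypothesis Hb : 2 + b < w.
Hypothesis Hib : b <> i.
Hypothesis HN : forall j, j <= N -> kf j b = N.
Hypothesis Hbody : forall j T, j < N -> RepL w x (kset (kf j) i j) T -> RepR (yf j) T ->
  exists t T', exec body T (pos w j (2 + b)) t T' 0 /\ t <= tb /\
    RepL w x (kset (kf (S j)) i j) T' /\ RepR (yf (S j)) T'.

Lemma exec_loop_iter n j T :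
  j + n = N -> RepL w x (kset (kf j) i j) T -> RepR (yf j) T ->
  exists t T',
    exec (PWhile bit_sym (PSeq body (PSeq (inc w i) (goto w i (2 + b)))))
      T (pos w j (2 + b)) t T' (pos w N (2 + b)) /\
    t <= n * (tb + 6 * ((N + 1) * (w + 3))) + 1 /\
    RepL w x (kset (kf N) i N) T' /\ RepR (yf N) T'.
Proof.
  revert j T; induction n; intros j T Hj H Hr.
  - rewrite Nat.add_0_r in Hj. subst j. exists 1, T. repeat split; auto; try apply Hr; try lia.
    apply EWhileF. rewrite H, bit_sym1 by auto. cbn [track Nat.add].
    rewrite kset_other, HN by auto. apply Nat.ltb_irrefl.
  - destruct (Hbody j T) as (t1 & T1 & He1 & Ht1 & H1 & Hr1); auto; try lia.
    destruct (exec_inc _ _ _ _ _ _ H1 Hr1 Hi) as (t2 & T2 & He2 & H2 & Hr2 & Ht2).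
    rewrite kset_same in *. apply RepL_kset_kset in H2.
    destruct (exec_goto _ _ _ _ i (2 + b) H2) as (t3 & He3 & Ht3); auto.
    rewrite kset_same in *.
    destruct (IHn (S j) T2) as (t4 & T4 & He4 & Ht4 & H4 & Hr4); auto; try lia.
    do 2 eexists. repeat split; [|clear He1 He2 He3 He4|exact H4|apply Hr4|apply Hr4].
    + eapply EWhileT; [|eapply ESeq; [exact He1|eapply ESeq; [exact He2 | exact He3]]|exact He4].
      rewrite H, bit_sym1 by auto. cbn [track Nat.add].
      rewrite kset_other, HN by (auto; lia). apply Nat.ltb_lt. lia.
    + assert ((S j + 1) * (w + 3) <= (N + 1) * (w + 3)) by (apply Nat.mul_le_mono_r; lia).
      assert ((j + 1) * (w + 3) <= (N + 1) * (w + 3)) by (apply Nat.mul_le_mono_r; lia).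
      nia.
Qed.

Lemma exec_loop T :
  RepL w x (kset (kf 0) i 0) T -> RepR (yf 0) T ->
  exists t T', exec (loop w i (2 + b) body) T 0 t T' 0 /\
    t <= (N + 1) * (tb + 10 * ((N + 1) * (w + 3))) /\
    RepL w x (kset (kf N) i 0) T' /\ RepR (yf N) T'.
Proof.
  intros H Hr.
  destruct (exec_goto _ _ _ _ i (2 + b) H) as (t1 & He1 & Ht1); auto.
  rewrite kset_same in *.
  destruct (exec_loop_iter N 0 T) as (t2 & T2 & He2 & Ht2 & H2 & Hr2); auto.
  pose proof (exec_ret w x _ T2 N (2 + b) H2 ltac:(lia)) as He3.
  destruct (exec_clear _ _ _ _ _ i H2 Hr2) as (t4 & T4 & He4 & H4 & Hr4 & Ht4); auto.
  rewrite kset_same in *. apply RepL_kset_kset in H4.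
  do 2 eexists. repeat split; [| |exact H4|apply Hr4|apply Hr4].
  - eapply ESeq; [exact He1|]. eapply ESeq; [exact He2|]. eapply ESeq; [exact He3|exact He4].
  - clear He1 He2 He3 He4. nia.
Qed.
End Loop.

(** * A language of counting loops *)

Inductive cmd :=
| Skip
| Inc (r : nat)
| Push (b : bool)
| Seq (c1 c2 : cmd)
| For (r : nat) (c : cmd)
| ForIn (c0 c1 : cmd).

Record st := mk_st { regs : nat -> nat; out : list bool }.

(* Register 0 holds the length of the input [x]; [ForIn] runs through the bits of [x]. *)
Fixpoint sem (x : list bool) (c : cmd) (s : st) : st :=
  match c with
  | Skip => s
  | Inc r => mk_st (kset (regs s) r (S (regs s r))) (out s)
  | Push b => mk_st (regs s) (out s ++ [b])
  | Seq c1 c2 => sem x c2 (sem x c1 s)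
  | For r c => Nat.iter (regs s r) (sem x c) s
  | ForIn c0 c1 => fold_left (fun s (b : bool) => if b then sem x c1 s else sem x c0 s) x s
  end.

Definition init_st (x : list bool) : st :=
  mk_st (kset (fun _ => 0) 0 (length x)) [].

Fixpoint incs (c : cmd) : list nat :=
  match c with
  | Skip | Push _ => []
  | Inc r => [r]
  | Seq c1 c2 | ForIn c1 c2 => incs c1 ++ incs c2
  | For _ c => incs c
  end.

(* Loops that increment no register cannot make registers grow, so their bounds do not matter. *)
Fixpoint bounds (c : cmd) : list nat :=
  match c with
  | Skip | Push _ | Inc _ => []
  | Seq c1 c2 | ForIn c1 c2 => bounds c1 ++ bounds c2
  | For r c => match incs c with [] => [] | _ => r :: bounds c end
  end.

Definition stable (c : cmd) : Prop := forall r, In r (bounds c) -> ~ In r (incs c).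

(* No register bounding a loop is incremented inside that loop; such programs run in polynomial time. *)
Fixpoint ok (c : cmd) : Prop :=
  match c with
  | Skip | Push _ => True
  | Inc r => r <> 0
  | Seq c1 c2 => ok c1 /\ ok c2
  | For r c => ok c /\ stable (For r c)
  | ForIn c0 c1 => ok c0 /\ ok c1 /\ stable (ForIn c0 c1)
  end.

Lemma sem_frame x c s r : ~ In r (incs c) -> regs (sem x c s) r = regs s r.
Proof.
  revert s. induction c; intros s H; cbn in *; auto.
  - apply kset_other. intuition.
  - rewrite in_app_iff in H. rewrite IHc2, IHc1; tauto.
  - generalize (regs s r0) as n. induction n; cbn; auto. now rewrite IHc.
  - rewrite in_app_iff in H.
    assert (G : forall l s, regs (fold_left
      (fun s (b : bool) => if b then sem x c2 s else sem x c1 s) l s) r = regs s r).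
    { induction l as [|[] l IHl]; intros s'; cbn; auto; rewrite IHl; [rewrite IHc2|rewrite IHc1]; tauto. }
    apply G.
Qed.

Lemma ok_incs0 c : ok c -> ~ In 0 (incs c).
Proof.
  induction c; cbn; rewrite ?in_app_iff; tauto.
Qed.

Lemma stable_For r c : stable (For r c) -> ~ In r (incs c).
Proof.
  unfold stable. cbn. destruct (incs c) as [|q l]; auto. intros H. apply H. now left.
Qed.

Definition st_le (s s' : st) : Prop :=
  (forall r, regs s r <= regs s' r) /\ length (out s) <= length (out s').

Lemma st_le_refl s : st_le s s.
Proof. split; auto. Qed.

Lemma st_le_trans s1 s2 s3 : st_le s1 s2 -> st_le s2 s3 -> st_le s1 s3.
Proof. intros [H1 H2] [H3 H4]. split; [intros r; specialize (H1 r); specialize (H3 r)|]; lia. Qed.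

Lemma iter_st_le (f : st -> st) m n s :
  (forall s, st_le s (f s)) -> m <= n -> st_le (Nat.iter m f s) (Nat.iter n f s).
Proof.
  intros Hf. induction 1; [apply st_le_refl|]. eapply st_le_trans; [eassumption|apply Hf].
Qed.

Lemma fold_st_le {A} (f : st -> A -> st) l s :
  (forall s a, st_le s (f s a)) -> st_le s (fold_left f l s).
Proof.
  intros Hf. revert s; induction l; intros s; cbn; [apply st_le_refl|].
  eapply st_le_trans; [apply Hf | apply IHl].
Qed.

Lemma sem_le x c s : st_le s (sem x c s).
Proof.
  revert s; induction c; intros s; cbn.
  - apply st_le_refl.
  - split; cbn; auto. intros r'. unfold kset. destruct (Nat.eqb_spec r' r); subst; lia.
  - split; cbn; auto. rewrite length_app. lia.
  - eapply st_le_trans; eauto.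
  - apply (iter_st_le _ 0); auto; lia.
  - apply fold_st_le. intros ? []; auto.
Qed.

(** * Compiling counting loops to tape programs *)

Fixpoint depth (c : cmd) : nat :=
  match c with
  | Skip | Inc _ | Push _ => 0
  | Seq c1 c2 => Nat.max (depth c1) (depth c2)
  | For _ c => S (depth c)
  | ForIn c1 c2 => S (Nat.max (depth c1) (depth c2))
  end.

Fixpoint regs_below (d : nat) (c : cmd) : Prop :=
  match c with
  | Skip | Push _ => True
  | Inc r => r < d
  | Seq c1 c2 | ForIn c1 c2 => regs_below d c1 /\ regs_below d c2
  | For r c => r < d /\ regs_below d c
  end.

(* [D] loop counters (one per nesting level) come before the registers. *)
Fixpoint tm_cmd (w D l : nat) (c : cmd) : prog :=
  match c with
  | Skip => PSkip
  | Inc r => inc w (D + r)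
  | Push b => push b
  | Seq c1 c2 => PSeq (tm_cmd w D l c1) (tm_cmd w D l c2)
  | For r c => loop w l (2 + (D + r)) (PSeq (ret w (2 + (D + r))) (tm_cmd w D (S l) c))
  (* The length register bounds the loop, since the input track cannot tell a final zero from the
     end of the input; the current bit is read on track 1 of the same block. *)
  | ForIn c0 c1 => loop w l (2 + (D + 0))
      (PSeq (shift (2 + (D + 0)) 1)
         (PIf bit_sym (PSeq (ret w 1) (tm_cmd w D (S l) c1))
                      (PSeq (ret w 1) (tm_cmd w D (S l) c0))))
  end.

Definition counters (D : nat) (lv rg : nat -> nat) : nat -> nat :=
  fun i => if i <? D then lv i else rg (i - D).

Lemma counters_reg D lv rg r : counters D lv rg (D + r) = rg r.
Proof.
  unfold counters. rewrite (proj2 (Nat.ltb_ge _ _)) by lia. f_equal. lia.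
Qed.

Lemma counters_inc D lv rg r v i : kset (counters D lv rg) (D + r) v i = counters D lv (kset rg r v) i.
Proof.
  unfold counters, kset. destruct (Nat.ltb_spec i D), (Nat.eqb_spec i (D + r)),
    (Nat.eqb_spec (i - D) r); auto; lia.
Qed.

Lemma counters_lv D lv rg l v i : l < D ->
  kset (counters D lv rg) l v i = counters D (kset lv l v) rg i.
Proof.
  intros H. unfold counters, kset. destruct (Nat.ltb_spec i D), (Nat.eqb_spec i l); auto; lia.
Qed.

Fixpoint tm_time (w : nat) (c : cmd) (B : nat) : nat :=
  let U := (B + 1) * (w + 3) in
  match c with
  | Skip => 0
  | Inc _ | Push _ => 10 * U
  | Seq c1 c2 => tm_time w c1 B + tm_time w c2 B
  | For _ c => (B + 1) * (tm_time w c B + 12 * U)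
  | ForIn c1 c2 => (B + 1) * (tm_time w c1 B + tm_time w c2 B + 20 * U)
  end.

(** It is imposed on the final state only: registers and output never shrink ([sem_le]), so it
    bounds all intermediate states and thereby all loop counts. *)
Definition bounded_by (d B : nat) (s : st) : Prop :=
  (forall r, r < d -> regs s r <= B) /\ length (out s) <= B.

Lemma bounded_by_le d B s s' : st_le s s' -> bounded_by d B s' -> bounded_by d B s.
Proof.
  intros [H1 H2] [H3 H4]. split; [|lia]. intros r Hr. specialize (H1 r). specialize (H3 r Hr). lia.
Qed.

Lemma kset_same_value k l v i : k l = v -> kset k l v i = k i.
Proof. intros H. unfold kset. destruct (Nat.eqb_spec i l); congruence. Qed.

Section CmdCorrect.
Variables (D d : nat) (x : list bool).
Hypothesis Hd : 0 < d.
Let w := 2 + D + d.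

(** [lv] holds the counters of the enclosing loops. Those of level [l] and deeper have to be zero on
    entry; every loop restores this by clearing its own counter. *)
Let correct (c : cmd) : Prop := forall l lv s T B,
  depth c + l <= D -> regs_below d c -> ok c -> regs s 0 = length x ->
  (forall i, l <= i -> lv i = 0) ->
  bounded_by d B (sem x c s) ->
  RepL w x (counters D lv (regs s)) T -> RepR (out s) T ->
  exists t T', exec (tm_cmd w D l c) T 0 t T' 0 /\ t <= tm_time w c B /\
    RepL w x (counters D lv (regs (sem x c s))) T' /\ RepR (out (sem x c s)) T'.

Lemma correct_body c l lv s T B j :
  correct c -> depth c + S l <= D -> regs_below d c -> ok c -> regs s 0 = length x ->
  (forall i, l <= i -> lv i = 0) ->
  bounded_by d B (sem x c s) ->
  RepL w x (kset (counters D lv (regs s)) l j) T -> RepR (out s) T ->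
  exists t T', exec (tm_cmd w D (S l) c) T 0 t T' 0 /\ t <= tm_time w c B /\
    RepL w x (kset (counters D lv (regs (sem x c s))) l j) T' /\ RepR (out (sem x c s)) T'.
Proof.
  intros Hc Hdep Hreg Hok H0 Hlv HB HL HR.
  destruct (Hc (S l) (kset lv l j) s T B) as (t & T' & He & Ht & HL' & HR'); auto.
  - intros i Hi. rewrite kset_other by lia. apply Hlv. lia.
  - eapply RepL_ext; [|exact HL]. intros i _. apply counters_lv. lia.
  - exists t, T'. repeat split; auto; try apply HR'.
    eapply RepL_ext; [|exact HL']. intros i _. symmetry. apply counters_lv. lia.
Qed.

Lemma RepL_kset_lv l lv rg T : l < D -> lv l = 0 ->
  RepL w x (kset (counters D lv rg) l 0) T <-> RepL w x (counters D lv rg) T.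
Proof.
  intros Hl H0.
  assert (E : forall i, kset (counters D lv rg) l 0 i = counters D lv rg i).
  { intros i. apply kset_same_value. unfold counters. now rewrite (proj2 (Nat.ltb_lt _ _)). }
  split; apply RepL_ext; intros; auto.
Qed.

Lemma correct_Inc r : correct (Inc r).
Proof.
  intros l lv s T B Hdep Hreg Hok H0 Hlv HB HL HR. cbn in Hreg.
  destruct (exec_inc _ _ _ _ _ (D + r) HL HR) as (t & T' & He & H1 & H2 & Ht); [lia|].
  exists t, T'. repeat split; auto; try apply H2.
  - rewrite counters_reg in Ht. destruct HB as [HB _]. specialize (HB r Hreg). cbn in HB.
    rewrite kset_same in HB. cbn.
    assert ((regs s r + 1) * (w + 3) <= (B + 1) * (w + 3)) by (apply Nat.mul_le_mono_r; lia). lia.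
  - rewrite counters_reg in H1. eapply RepL_ext; [|exact H1]. intros i _. apply counters_inc.
Qed.

Lemma correct_Push b : correct (Push b).
Proof.
  intros l lv s T B Hdep Hreg Hok H0 Hlv HB HL HR.
  destruct (exec_push _ _ _ _ _ b HL HR) as (t & T' & He & H1 & H2 & Ht).
  exists t, T'. repeat split; auto; try apply H2.
  destruct HB as [_ HB]. cbn in *. rewrite length_app in HB. cbn in HB. nia.
Qed.

Lemma correct_Seq c1 c2 : correct c1 -> correct c2 -> correct (Seq c1 c2).
Proof.
  intros IHc1 IHc2 l lv s T B Hdep Hreg Hok H0 Hlv HB HL HR. cbn in *.
  destruct Hreg, Hok.
  destruct (IHc1 l lv s T B) as (t1 & T1 & He1 & Ht1 & HL1 & HR1); auto; try lia.
  { eapply bounded_by_le; [apply sem_le | exact HB]. }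
  destruct (IHc2 l lv (sem x c1 s) T1 B) as (t2 & T2 & He2 & Ht2 & HL2 & HR2); auto; try lia.
  { rewrite sem_frame; auto. now apply ok_incs0. }
  exists (t1 + t2), T2. repeat split; auto; try apply HR2; [|lia]. eapply ESeq; eauto.
Qed.

Lemma correct_For r c : correct c -> correct (For r c).
Proof.
  intros IHc l lv s T B Hdep Hreg Hok H0 Hlv HB HL HR.
  cbn [depth regs_below ok sem tm_cmd tm_time] in *. destruct Hreg as [Hr Hreg], Hok as [Hok Hst].
  set (N := regs s r) in *.
  assert (HN : N <= B).
  { apply (bounded_by_le d B s) in HB; [now apply HB|]. apply (iter_st_le _ 0); [apply sem_le|lia]. }
  assert (Hfr : forall q, ~ In q (incs c) -> forall j, regs (Nat.iter j (sem x c) s) q = regs s q).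
  { intros q Hq. induction j; cbn; auto. now rewrite sem_frame. }
  destruct (exec_loop w x l (D + r) N (tm_time w c B + 2 * ((B + 1) * (w + 3)))
    (PSeq (ret w (2 + (D + r))) (tm_cmd w D (S l) c))
    (fun j => counters D lv (regs (Nat.iter j (sem x c) s)))
    (fun j => out (Nat.iter j (sem x c) s))) with (T := T)
    as (t & T' & He & Ht & HL' & HR'); auto; try lia.
  - intros j Hj. rewrite counters_reg. apply Hfr. now apply stable_For.
  - intros j T1 Hj HL1 HR1.
    destruct (correct_body c l lv (Nat.iter j (sem x c) s) T1 B j)
      as (t2 & T2 & He2 & Ht2 & HL2 & HR2); auto; try lia.
    + rewrite Hfr; auto. now apply ok_incs0.
    + eapply bounded_by_le; [|exact HB]. apply (iter_st_le _ (S j)); [apply sem_le | lia].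
    + do 2 eexists. repeat split; [| |exact HL2|apply HR2|apply HR2].
      * eapply ESeq; [eapply exec_ret; [exact HL1|lia]|exact He2].
      * assert (j * (w + 2) <= B * (w + 3)) by (apply Nat.mul_le_mono; lia). lia.
  - apply RepL_kset_lv; auto. lia.
  - exists t, T'. repeat split; auto; try apply HR'.
    + eapply Nat.le_trans; [exact Ht|].
      assert ((N + 1) * (w + 3) <= (B + 1) * (w + 3)) by (apply Nat.mul_le_mono_r; lia).
      apply Nat.mul_le_mono; lia.
    + apply RepL_kset_lv in HL'; auto. lia.
Qed.

Lemma correct_ForIn c0 c1 : correct c0 -> correct c1 -> correct (ForIn c0 c1).
Proof.
  intros IH0 IH1 l lv s T B Hdep Hreg Hok H0 Hlv HB HL HR.
  cbn [depth regs_below ok sem tm_cmd tm_time] in *.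
  destruct Hreg as [Hr0 Hr1], Hok as (Hok0 & Hok1 & Hst).
  set (f := fun s (b : bool) => if b then sem x c1 s else sem x c0 s) in *.
  assert (Hf : forall s b, st_le s (f s b)) by (intros ? []; apply sem_le).
  set (sj := fun j => fold_left f (firstn j x) s).
  assert (HS : forall j, j < length x -> sj (S j) = f (sj j) (nth j x false)).
  { intros j Hj. unfold sj. clear - Hj. revert s j Hj. clearbody f.
    induction x as [|a x' IH]; intros s j Hj; cbn in Hj; [lia|].
    destruct j; [reflexivity|]. cbn [firstn fold_left nth]. rewrite <- IH by lia. reflexivity. }
  assert (HE : sj (length x) = fold_left f x s) by (unfold sj; now rewrite firstn_all).
  assert (Hmono : forall j, st_le (sj j) (fold_left f x s)).
  { intros j. unfold sj. rewrite <- (firstn_skipn j x) at 2. rewrite fold_left_app.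
    now apply fold_st_le. }
  assert (HN : length x <= B).
  { rewrite <- H0. apply (bounded_by_le d B s) in HB; [now apply HB|]. now apply fold_st_le. }
  assert (Hfr : forall j, j <= length x -> regs (sj j) 0 = length x).
  { induction j; intros Hj; [exact H0|]. rewrite HS by lia. unfold f.
    destruct (nth j x false); rewrite sem_frame; auto using ok_incs0; apply IHj; lia. }
  destruct (exec_loop w x l (D + 0) (length x)
    (tm_time w c0 B + tm_time w c1 B + 10 * ((B + 1) * (w + 3)))
    (PSeq (shift (2 + (D + 0)) 1)
       (PIf bit_sym (PSeq (ret w 1) (tm_cmd w D (S l) c1))
                    (PSeq (ret w 1) (tm_cmd w D (S l) c0))))
    (fun j => counters D lv (regs (sj j)))
    (fun j => out (sj j))) with (T := T)
    as (t & T' & He & Ht & HL' & HR'); auto; try lia.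
  - intros j Hj. rewrite counters_reg. auto.
  - intros j T1 Hj HL1 HR1.
    assert (Hbit : bit_sym (T1 (pos w j 1)) = nth j x false).
    { rewrite HL1, bit_sym1 by lia. reflexivity. }
    assert (HBj : bounded_by d B (f (sj j) (nth j x false))).
    { rewrite <- HS by auto. eapply bounded_by_le; [|exact HB]. apply Hmono. }
    rewrite HS by auto.
    assert (Hret : 1 + (j * (w + 2) + 1 + 1) <= 4 * ((B + 1) * (w + 3))).
    { assert (j * (w + 2) <= B * (w + 3)) by (apply Nat.mul_le_mono; lia). lia. }
    assert (Hsh : 2 + (D + 0) <= (B + 1) * (w + 3)) by nia.
    unfold f in *. destruct (nth j x false).
    + destruct (correct_body c1 l lv (sj j) T1 B j) as (t2 & T2 & He2 & Ht2 & HL2 & HR2);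
        auto; try lia.
      { apply Hfr. lia. }
      do 2 eexists. repeat split; [| |exact HL2|apply HR2|apply HR2].
      * eapply ESeq; [apply exec_shift|]. eapply EIfT; [exact Hbit|].
        eapply ESeq; [eapply exec_ret; [exact HL1|lia]|exact He2].
      * lia.
    + destruct (correct_body c0 l lv (sj j) T1 B j) as (t2 & T2 & He2 & Ht2 & HL2 & HR2);
        auto; try lia.
      { apply Hfr. lia. }
      do 2 eexists. repeat split; [| |exact HL2|apply HR2|apply HR2].
      * eapply ESeq; [apply exec_shift|]. eapply EIfF; [exact Hbit|].
        eapply ESeq; [eapply exec_ret; [exact HL1|lia]|exact He2].
      * lia.
  - apply RepL_kset_lv; auto. lia.
  - exists t, T'. rewrite HE in *. repeat split; auto; try apply HR'.
    + eapply Nat.le_trans; [exact Ht|].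
      assert ((length x + 1) * (w + 3) <= (B + 1) * (w + 3)) by (apply Nat.mul_le_mono_r; lia).
      apply Nat.mul_le_mono; lia.
    + apply RepL_kset_lv in HL'; auto. lia.
Qed.

Theorem tm_cmd_correct c : correct c.
Proof.
  induction c.
  - intros l lv s T B _ _ _ _ _ _ HL HR. exists 0, T. repeat split; auto; try apply HR.
    constructor.
  - apply correct_Inc.
  - apply correct_Push.
  - now apply correct_Seq.
  - now apply correct_For.
  - now apply correct_ForIn.
Qed.
End CmdCorrect.

(** * Register programs run in polynomial time *)

Definition blank (s : sym) : bool := negb (nonblank s).

Definition home : prog := PSeq (PWhile blank (PMove ML)) (PMove MR).
(** Stops one cell beyond the first remaining symbol. That cell is blank exactly when the symbol
    found is the sentinel, which is what the loading loop tests. *)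
Definition find : prog := PSeq (PMove MR) (PSeq (PWhile blank (PMove MR)) (PMove MR)).

Definition load_loop (w i : nat) : prog :=
  PWhile nonblank
    (PSeq (PMove ML)
      (PSeq (PIf bit_sym
               (PSeq (PWrite SB) (PSeq home (PSeq (set_input w i) (inc w i))))
               (PSeq (PWrite SB) (PSeq home (inc w i))))
        find)).

(* A sentinel written behind the input makes it possible to consume the input from the left and still detect its end. *)
Definition load (w i : nat) : prog :=
  PSeq (PWhile nonblank (PMove MR)) (PSeq (PWrite S1) (PSeq (PWhile nonblank (PMove ML))
    (PSeq (PMove ML) (PSeq (PWrite S1) (PSeq (PMove MR)
      (PSeq find (PSeq (load_loop w i) (PSeq (PMove ML) (PSeq (PWrite SB) home))))))))).

Record loading (w i : nat) (x : list bool) (v : nat) (T : tape) : Prop := {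
  ld_left : RepL w (firstn v x) (kset (fun _ => 0) i v) T;
  ld_blank : forall z, (0 <= z <= Z.of_nat v)%Z -> T z = SB;
  ld_bits : forall j, v <= j -> j < length x -> T (1 + Z.of_nat j)%Z = sym_of_bool (nth j x false);
  ld_end : T (1 + Z.of_nat (length x))%Z = S1;
  ld_beyond : forall z, (1 + Z.of_nat (length x) < z)%Z -> T z = SB }.

Lemma loading_nonblank w i x v T j :
  loading w i x v T -> v <= j <= length x -> nonblank (T (1 + Z.of_nat j)%Z) = true.
Proof.
  intros [_ _ Hb He _] Hj. destruct (Nat.eq_dec j (length x)) as [->|].
  - now rewrite He.
  - rewrite Hb by lia. apply nonblank_sym_of_bool.
Qed.

Lemma exec_find w i x v T :
  loading w i x v T -> v <= length x -> exec find T 0 (3 * v + 3) T (2 + Z.of_nat v)%Z.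
Proof.
  intros H Hv. eapply exec_eq.
  { eapply ESeq; [constructor|]. eapply ESeq; [|constructor].
    apply exec_while_move with (k := v).
    - intros j Hj. unfold blank. rewrite (ld_blank _ _ _ _ _ H); auto. cbn [dir]. lia.
    - cbn [dir]. unfold blank.
      replace (0 + 1 + Z.of_nat v * 1)%Z with (1 + Z.of_nat v)%Z by lia.
      rewrite (loading_nonblank _ _ _ _ _ v H); auto. }
  - lia.
  - cbn [dir]. lia.
Qed.

Lemma exec_home w x k T v :
  RepL w x k T -> 0 < w -> (forall z, (0 <= z <= Z.of_nat v)%Z -> T z = SB) ->
  exec home T (Z.of_nat v) (3 * v + 5) T 0.
Proof.
  intros H Hw Hb. eapply exec_eq.
  { eapply ESeq; [|constructor]. apply exec_while_move with (k := S v).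
    - intros j Hj. unfold blank. rewrite Hb; auto. cbn [dir]. lia.
    - replace (Z.of_nat v + Z.of_nat (S v) * dir ML)%Z with (pos w 0 0) by (unfold pos; cbn [dir]; lia).
      unfold blank. rewrite H by auto. reflexivity. }
  - lia.
  - cbn [dir]. lia.
Qed.

Lemma firstn_S_nth (x : list bool) v : v < length x -> firstn (S v) x = firstn v x ++ [nth v x false].
Proof.
  revert v; induction x as [|b x IH]; intros v Hv; cbn in Hv; [lia|].
  destruct v; [reflexivity|]. cbn [firstn nth app]. now rewrite <- IH by lia.
Qed.

Lemma exec_load_loop w i x n v T :
  2 + i < w -> v + n = length x -> loading w i x v T ->
  exists t T', exec (load_loop w i) T (2 + Z.of_nat v)%Z t T' (2 + Z.of_nat (length x))%Z /\
    loading w i x (length x) T' /\ t <= n * (20 * ((length x + 1) * (w + 3))) + 1.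
Proof.
  intros Hi. revert v T; induction n; intros v T Hv H.
  - rewrite Nat.add_0_r in Hv. subst v. exists 1, T. repeat split; auto; try apply H.
    apply EWhileF. rewrite (ld_beyond _ _ _ _ _ H) by lia. reflexivity.
  - set (T1 := upd T (1 + Z.of_nat v) SB).
    assert (H1 : RepL w (firstn v x) (kset (fun _ => 0) i v) T1).
    { apply RepL_upd_right; [lia|apply H]. }
    assert (Hb1 : forall z, (0 <= z <= Z.of_nat (S v))%Z -> T1 z = SB).
    { intros z Hz. unfold T1, upd. destruct (Z.eqb_spec z (1 + Z.of_nat v)); auto.
      apply H. lia. }
    assert (Hlen : length (firstn v x) = v) by (rewrite length_firstn; lia).
    assert (Hhome := exec_home _ _ _ _ _ H1 ltac:(lia) Hb1).
    assert (Hstep : exists t T2,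
      exec (PIf bit_sym
               (PSeq (PWrite SB) (PSeq home (PSeq (set_input w i) (inc w i))))
               (PSeq (PWrite SB) (PSeq home (inc w i)))) T (1 + Z.of_nat v) t T2 0 /\
      t <= 10 * ((length x + 1) * (w + 3)) /\ loading w i x (S v) T2).
    { assert (Hle : (v + 1) * (w + 3) <= (length x + 1) * (w + 3)) by (apply Nat.mul_le_mono_r; lia).
      assert (Hle2 : 3 * (v + 1) <= (v + 1) * (w + 3)) by (rewrite (Nat.mul_comm (v + 1)); apply Nat.mul_le_mono_r; lia).
      assert (Hload : forall T2, RepL w (firstn (S v) x) (kset (fun _ => 0) i (S v)) T2 ->
        (forall z, (0 <= z)%Z -> T2 z = T1 z) -> loading w i x (S v) T2).
      { intros T2 HL E. split; auto.
        - intros z Hz. rewrite E; auto; lia.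
        - intros j Hj Hj'. rewrite E by lia. unfold T1. rewrite upd_other by lia. apply H; lia.
        - rewrite E by lia. unfold T1. rewrite upd_other by lia. apply H.
        - intros z Hz. rewrite E by lia. unfold T1. rewrite upd_other by lia. now apply (ld_beyond _ _ _ _ _ H). }
      assert (Hbit : bit_sym (T (1 + Z.of_nat v)%Z) = nth v x false).
      { rewrite (ld_bits _ _ _ _ _ H) by lia. now destruct (nth v x false). }
      rewrite firstn_S_nth in Hload by lia.
      replace (Z.of_nat (S v)) with (1 + Z.of_nat v)%Z in Hhome by lia.
      destruct (nth v x false).
      - destruct (exec_set_input _ _ _ _ i H1) as (t2 & He2 & H2 & Ht2); auto.
        { now rewrite kset_same, Hlen. }
        destruct (exec_inc_upd _ _ _ _ _ H2 Hi) as (t3 & He3 & Ht3).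
        pose proof (RepL_inc _ _ _ _ _ H2 Hi) as H3.
        rewrite kset_same in *. apply RepL_kset_kset in H3.
        do 2 eexists. split; [|split].
        + eapply EIfT; [exact Hbit|]. eapply ESeq; [constructor|].
          eapply ESeq; [exact Hhome|]. eapply ESeq; [exact He2 | exact He3].
        + lia.
        + apply Hload; auto. intros z Hz. rewrite !upd_other; auto; unfold pos; lia.
      - apply RepL_snoc_false in H1.
        destruct (exec_inc_upd _ _ _ _ _ H1 Hi) as (t3 & He3 & Ht3).
        pose proof (RepL_inc _ _ _ _ _ H1 Hi) as H3.
        rewrite kset_same in *. apply RepL_kset_kset in H3.
        do 2 eexists. split; [|split].
        + eapply EIfF; [exact Hbit|]. eapply ESeq; [constructor|].
          eapply ESeq; [exact Hhome | exact He3].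
        + lia.
        + apply Hload; auto. intros z Hz. rewrite !upd_other; auto; unfold pos; lia. }
    destruct Hstep as (t2 & T2 & He2 & Ht2 & H2).
    destruct (IHn (S v) T2) as (t3 & T3 & He3 & H3 & Ht3); auto; try lia.
    exists (1 + (1 + (t2 + (3 * S v + 3))) + 1 + t3), T3. split; [|split; auto].
    + eapply EWhileT; [|eapply ESeq; [constructor|eapply ESeq]|exact He3].
      * replace (2 + Z.of_nat v)%Z with (1 + Z.of_nat (S v))%Z by lia.
        apply (loading_nonblank _ _ _ _ _ _ H). lia.
      * replace (2 + Z.of_nat v + dir ML)%Z with (1 + Z.of_nat v)%Z by (cbn [dir]; lia). exact He2.
      * eapply exec_find; [exact H2 | lia].
    + assert (3 * (length x + 1) <= (length x + 1) * (w + 3))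
        by (rewrite (Nat.mul_comm (length x + 1)); apply Nat.mul_le_mono_r; lia).
      lia.
Qed.

Lemma exec_load w i x :
  2 + i < w ->
  exists t T', exec (load w i) (tape_of_input x) 1 t T' 0 /\
    RepL w x (kset (fun _ => 0) i (length x)) T' /\ RepR [] T' /\
    t <= 100 * ((length x + 1) * (length x + 1) * (w + 3)).
Proof.
  intros Hi. set (n := length x). set (T0 := tape_of_input x).
  set (T1 := upd T0 (1 + Z.of_nat n) S1). set (T2 := upd T1 (-1) S1).
  assert (HT0 : forall j, j < n -> T0 (1 + Z.of_nat j)%Z = sym_of_bool (nth j x false)).
  { intros j Hj. unfold T0, tape_of_input. destruct (Z.ltb_spec (1 + Z.of_nat j) 1); try lia.
    replace (Z.to_nat (1 + Z.of_nat j - 1)) with j by lia.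
    rewrite nth_indep with (d' := sym_of_bool false) by now rewrite length_map. apply map_nth. }
  assert (HT0r : forall z, (1 + Z.of_nat n <= z)%Z -> T0 z = SB).
  { intros z Hz. unfold T0, tape_of_input. destruct (Z.ltb_spec z 1); auto.
    apply nth_syms_ge. fold n. lia. }
  assert (HT0l : forall z, (z < 1)%Z -> T0 z = SB).
  { intros z Hz. unfold T0, tape_of_input. destruct (Z.ltb_spec z 1); auto. lia. }
  assert (H : loading w i x 0 T2).
  { split.
    - intros o j Ho. unfold T2, upd at 1. destruct (Z.eqb_spec (pos w j o) (-1)) as [E|E].
      + replace (-1)%Z with (pos w 0 0) in E by (unfold pos; lia).
        apply pos_inj in E as [-> ->]; auto; lia.
      + unfold T1. rewrite upd_other by (unfold pos; lia). rewrite HT0l by (unfold pos; lia).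
        destruct o as [|[|o]]; cbn [track].
        * destruct j; auto. exfalso. apply E. unfold pos. lia.
        * now destruct j.
        * rewrite kset_same_value by auto. reflexivity.
    - intros z Hz. unfold T2, T1. rewrite !upd_other by lia. apply HT0l. lia.
    - intros j Hj Hj'. unfold T2, T1. fold n in Hj'. rewrite !upd_other by lia. now apply HT0.
    - fold n. unfold T2, T1. rewrite upd_other by lia. apply upd_same.
    - intros z Hz. fold n in Hz. unfold T2, T1. rewrite !upd_other by lia. apply HT0r. lia. }
  destruct (exec_load_loop w i x n 0 T2 Hi eq_refl H) as (t3 & T3 & He3 & H3 & Ht3).
  fold n in He3, H3, Ht3.
  set (T4 := upd T3 (1 + Z.of_nat n) SB).
  assert (HL4 : RepL w x (kset (fun _ => 0) i n) T4).
  { apply RepL_upd_right; [lia|]. pose proof (ld_left _ _ _ _ _ H3) as HL.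
    unfold n in HL at 1. now rewrite firstn_all in HL. }
  assert (HT4 : forall z, (0 <= z)%Z -> T4 z = SB).
  { intros z Hz. unfold T4, upd. destruct (Z.eqb_spec z (1 + Z.of_nat n)); auto.
    destruct (Z.le_gt_cases z (Z.of_nat n)).
    - apply (ld_blank _ _ _ _ _ H3). lia.
    - apply (ld_beyond _ _ _ _ _ H3). fold n. lia. }
  exists ((3 * n + 1) + (1 + ((3 * (n + 1) + 1) + (1 + (1 + (1 + ((3 * 0 + 3) + (t3 + (1 + (1 + (3 * (n + 1) + 5))))))))))), T4.
  split; [|split; [exact HL4|split]].
  - unfold load. eapply ESeq.
    { apply exec_while_move.
      - intros j Hj. cbn [dir]. rewrite Z.mul_1_r. rewrite HT0 by auto. apply nonblank_sym_of_bool.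
      - cbn [dir]. rewrite Z.mul_1_r. rewrite HT0r; auto. lia. }
    cbn [dir]. rewrite Z.mul_1_r.
    eapply ESeq; [constructor|]. fold T1.
    eapply ESeq.
    { apply exec_while_move with (k := n + 1).
      - intros j Hj. cbn [dir]. unfold T1, upd. destruct (Z.eqb_spec (1 + Z.of_nat n + Z.of_nat j * -1) (1 + Z.of_nat n)); auto.
        replace (1 + Z.of_nat n + Z.of_nat j * -1)%Z with (1 + Z.of_nat (n - j))%Z by lia.
        rewrite HT0 by lia. apply nonblank_sym_of_bool.
      - cbn [dir]. replace (1 + Z.of_nat n + Z.of_nat (n + 1) * -1)%Z with 0%Z by lia.
        unfold T1. rewrite upd_other by lia. rewrite HT0l; auto. lia. }
    cbn [dir]. replace (1 + Z.of_nat n + Z.of_nat (n + 1) * -1)%Z with 0%Z by lia.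
    eapply ESeq; [constructor|]. cbn [dir]. change (0 + -1)%Z with (-1)%Z.
    eapply ESeq; [constructor|]. fold T2.
    eapply ESeq; [constructor|]. cbn [dir]. change (-1 + 1)%Z with 0%Z.
    eapply ESeq; [eapply exec_find; [exact H|lia]|].
    eapply ESeq; [exact He3|].
    eapply ESeq; [constructor|]. cbn [dir].
    replace (2 + Z.of_nat n + -1)%Z with (1 + Z.of_nat n)%Z by lia.
    eapply ESeq; [constructor|]. fold T4.
    replace (1 + Z.of_nat n)%Z with (Z.of_nat (n + 1)) by lia.
    eapply exec_home; [exact HL4 | lia|]. intros z Hz. apply HT4. lia.
  - split; [apply HT4; lia|]. intros j. rewrite HT4 by lia. now destruct j.
  - clear - Ht3 Hi. nia.
Qed.

(** * Polynomial bounds on time, registers and output *)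

Definition poly_bounded (f : nat -> nat) : Prop := exists C e, forall B, f B <= C * (B + 1) ^ e.

Lemma pow_pos_succ B e : 1 <= (B + 1) ^ e.
Proof. induction e; cbn; nia. Qed.

Lemma pb_const c : poly_bounded (fun _ => c).
Proof. exists c, 0. intros B. cbn. lia. Qed.

Lemma pb_id : poly_bounded (fun B => B).
Proof. exists 1, 1. intros B. cbn. lia. Qed.

Lemma pb_add f g : poly_bounded f -> poly_bounded g -> poly_bounded (fun B => f B + g B).
Proof.
  intros (C1 & e1 & H1) (C2 & e2 & H2). exists (C1 + C2), (e1 + e2). intros B.
  specialize (H1 B). specialize (H2 B). rewrite Nat.pow_add_r.
  pose proof (pow_pos_succ B e1). pose proof (pow_pos_succ B e2). nia.
Qed.

Lemma pb_mul f g : poly_bounded f -> poly_bounded g -> poly_bounded (fun B => f B * g B).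
Proof.
  intros (C1 & e1 & H1) (C2 & e2 & H2). exists (C1 * C2), (e1 + e2). intros B.
  specialize (H1 B). specialize (H2 B). rewrite Nat.pow_add_r.
  replace (C1 * C2 * ((B + 1) ^ e1 * (B + 1) ^ e2))
    with ((C1 * (B + 1) ^ e1) * (C2 * (B + 1) ^ e2)) by ring.
  now apply Nat.mul_le_mono.
Qed.

Lemma pb_comp f g : poly_bounded f -> poly_bounded g -> poly_bounded (fun B => f (g B)).
Proof.
  intros (C1 & e1 & H1) (C2 & e2 & H2). exists (C1 * (C2 + 1) ^ e1), (e2 * e1). intros B.
  specialize (H1 (g B)). specialize (H2 B). pose proof (pow_pos_succ B e2).
  eapply Nat.le_trans; [exact H1|]. rewrite <- Nat.mul_assoc. apply Nat.mul_le_mono_l.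
  rewrite Nat.pow_mul_r, <- Nat.pow_mul_l. apply Nat.pow_le_mono_l. nia.
Qed.

(** Powers of [B + 1] are at least 1, which makes sums and products easy to bound; only here is the
    form required by [PolyTimeFun] recovered, the argument 0 being absorbed by the additive
    constant. *)
Lemma pb_pow_form f : poly_bounded f -> exists c k, forall n, f n <= c * n ^ k + c.
Proof.
  intros (C & e & H). exists (C * 2 ^ e), e. intros n. eapply Nat.le_trans; [apply H|].
  destruct n as [|n].
  - rewrite Nat.add_0_l, Nat.pow_1_l. pose proof (Nat.pow_nonzero 2 e). nia.
  - enough ((S n + 1) ^ e <= 2 ^ e * S n ^ e) by nia.
    rewrite <- Nat.pow_mul_l. apply Nat.pow_le_mono_l. lia.
Qed.

Lemma pb_tm_time w c : poly_bounded (tm_time w c).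
Proof.
  induction c; cbn [tm_time];
    repeat first [apply pb_const | apply pb_id | apply pb_add | apply pb_mul | assumption].
Qed.

Fixpoint cost (c : cmd) (B : nat) : nat :=
  match c with
  | Skip => 0
  | Inc _ | Push _ => 1
  | Seq c1 c2 => cost c1 B + cost c2 B
  | For _ c => B * cost c B
  | ForIn c1 c2 => B * (cost c1 B + cost c2 B)
  end.

Lemma pb_cost c : poly_bounded (cost c).
Proof.
  induction c; cbn [cost];
    repeat first [apply pb_const | apply pb_id | apply pb_add | apply pb_mul | assumption].
Qed.

Definition grows (k : nat) (s s' : st) : Prop := forall r, regs s' r <= regs s r + k.

Lemma grows_trans k1 k2 s1 s2 s3 : grows k1 s1 s2 -> grows k2 s2 s3 -> grows (k1 + k2) s1 s3.
Proof. intros H1 H2 r. specialize (H1 r). specialize (H2 r). lia. Qed.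

Lemma grows_le k k' s s' : k <= k' -> grows k s s' -> grows k' s s'.
Proof. intros Hk H r. specialize (H r). lia. Qed.

Lemma grows_refl k s : grows k s s.
Proof. intros r. lia. Qed.

(** [F] is a set of frozen registers containing all bounds of loops that increment something. Their
    values never leave the range up to [B], so each such loop runs at most [B] times and the growth
    is additive, however large the other registers are. *)
Lemma sem_grows x c B (F : nat -> Prop) s :
  length x <= B -> (forall r, F r -> ~ In r (incs c)) -> (forall r, In r (bounds c) -> F r) ->
  (forall r, F r -> regs s r <= B) -> grows (cost c B) s (sem x c s).
Proof.
  intros Hx. revert s; induction c; intros s Hi Hb HB.
  - apply grows_refl.
  - intros r'. cbn. unfold kset. destruct (Nat.eqb_spec r' r); subst; lia.
  - intros r'. cbn. lia.
  - cbn [incs bounds cost sem] in *. eapply grows_trans; [apply IHc1 | apply IHc2]; auto.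
    + intros r Hr Hin. eapply Hi; eauto. apply in_app_iff. auto.
    + intros r Hr. apply Hb, in_app_iff. auto.
    + intros r Hr Hin. eapply Hi; eauto. apply in_app_iff. auto.
    + intros r Hr. apply Hb, in_app_iff. auto.
    + intros r Hr. rewrite sem_frame; auto. intros Hin. eapply Hi; eauto. apply in_app_iff. auto.
  (* If nothing is incremented, the bound [r] may lie outside [F] and be large, but the registers do
     not change. *)
  - destruct (incs c) as [|q l] eqn:Eincs.
    { intros r'. rewrite sem_frame; [lia|]. cbn. now rewrite Eincs. }
    cbn [incs bounds cost sem] in *. rewrite Eincs in *.
    assert (G : forall n, grows (n * cost c B) s (Nat.iter n (sem x c) s) /\
      forall r, F r -> regs (Nat.iter n (sem x c) s) r <= B).
    { induction n as [|n [IH1 IH2]]; cbn [Nat.iter nat_rect]; [split; auto; apply grows_refl|].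
      split.
      - eapply grows_le; [|eapply grows_trans; [exact IH1|apply IHc; auto]]; [lia|].
        intros r' Hr'. apply Hb. now right.
      - intros r' Hr'. cbn. rewrite sem_frame; auto. rewrite Eincs. auto. }
    eapply grows_le; [|apply G]. apply Nat.mul_le_mono_r. apply HB, Hb. now left.
  - cbn [incs bounds cost sem] in *.
    assert (G : forall l s, (forall r, F r -> regs s r <= B) ->
      grows (length l * (cost c1 B + cost c2 B)) s
        (fold_left (fun s (b : bool) => if b then sem x c2 s else sem x c1 s) l s)).
    { induction l as [|b l IHl]; intros s' Hs'; [apply grows_refl|]. cbn [fold_left length].
      assert (Hi1 : forall r, F r -> ~ In r (incs c1)).
      { intros r Hr Hin. eapply Hi; eauto. apply in_app_iff. auto. }
      assert (Hi2 : forall r, F r -> ~ In r (incs c2)).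
      { intros r Hr Hin. eapply Hi; eauto. apply in_app_iff. auto. }
      eapply grows_le; [|eapply grows_trans; [|apply IHl]].
      - rewrite Nat.mul_succ_l, Nat.add_comm. reflexivity.
      - destruct b; [eapply grows_le; [|apply IHc2]|eapply grows_le; [|apply IHc1]]; auto; try lia;
          intros r Hr; apply Hb, in_app_iff; auto.
      - intros r Hr. destruct b; rewrite sem_frame; auto. }
    eapply grows_le; [|apply G; auto]. apply Nat.mul_le_mono_r. exact Hx.
Qed.

(** Bounds are composed only along top-level sequencing, a fixed number of times; a loop is
    estimated at once by [cost], because its bounds are frozen. This keeps the result polynomial. *)
Fixpoint growth (c : cmd) (B : nat) : nat :=
  match c with
  | Seq c1 c2 => growth c2 (growth c1 B)
  | _ => B + cost c B
  end.

Lemma pb_growth c : poly_bounded (growth c).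
Proof.
  induction c; cbn [growth];
    repeat first [apply pb_cost | apply pb_id | apply pb_add].
  now apply (pb_comp (growth c2) (growth c1)).
Qed.

Lemma growth_ge c B : B <= growth c B.
Proof.
  revert B; induction c; intros B; cbn [growth]; try lia.
  eapply Nat.le_trans; [apply IHc1 | apply IHc2].
Qed.

Lemma growth_correct x c s B :
  ok c -> length x <= B -> (forall r, regs s r <= B) ->
  forall r, regs (sem x c s) r <= growth c B.
Proof.
  assert (G : forall c s B, stable c -> length x <= B -> (forall r, regs s r <= B) ->
    forall r, regs (sem x c s) r <= B + cost c B).
  { intros c' s' B' Hst Hx Hr r.
    pose proof (sem_grows x c' B' (fun r => In r (bounds c')) s') as H.
    eapply Nat.le_trans; [apply H; auto|]. specialize (Hr r). lia. }
  revert s B; induction c; intros s B Hok Hx Hr; cbn [growth].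
  - apply G; auto. intros r [].
  - apply G; auto. intros r' [].
  - apply G; auto. intros r [].
  - destruct Hok. apply IHc2; auto.
    eapply Nat.le_trans; [exact Hx | apply growth_ge].
  - apply G; auto. apply Hok.
  - apply G; auto. apply Hok.
Qed.

(** Here [B] bounds the registers after the run; as they only grow, it bounds every loop count on
    the way. *)
Lemma out_growth x c s B :
  length x <= B -> (forall r, regs (sem x c s) r <= B) ->
  length (out (sem x c s)) <= length (out s) + cost c B.
Proof.
  intros Hx. revert s; induction c; intros s HB; cbn [sem cost] in *.
  - lia.
  - cbn. lia.
  - cbn. rewrite length_app. cbn. lia.
  - assert (length (out (sem x c1 s)) <= length (out s) + cost c1 B).
    { apply IHc1. intros r. destruct (sem_le x c2 (sem x c1 s)) as [H _].
      specialize (H r). specialize (HB r). lia. }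
    specialize (IHc2 _ HB). lia.
  - assert (Hn : regs s r <= B).
    { destruct (iter_st_le (sem x c) 0 (regs s r) s) as [H _]; [apply sem_le|lia|].
      specialize (H r). specialize (HB r). cbn in H. lia. }
    enough (G : forall n, (forall q, regs (Nat.iter n (sem x c) s) q <= B) ->
      length (out (Nat.iter n (sem x c) s)) <= length (out s) + n * cost c B).
    { eapply Nat.le_trans; [now apply G|]. apply Nat.add_le_mono_l, Nat.mul_le_mono_r, Hn. }
    induction n as [|n IHn]; intros Hq; [cbn; lia|]. cbn [Nat.iter nat_rect] in *.
    specialize (IHc _ Hq). cbn in IHc. eapply Nat.le_trans; [exact IHc|].
    enough (length (out (Nat.iter n (sem x c) s)) <= length (out s) + n * cost c B)
      by (unfold Nat.iter in *; cbn in *; lia).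
    apply IHn. intros q. destruct (sem_le x c (Nat.iter n (sem x c) s)) as [H _].
    specialize (H q). specialize (Hq q). unfold Nat.iter in *. lia.
  - enough (G : forall l s,
      (forall r, regs (fold_left (fun s (b : bool) => if b then sem x c2 s else sem x c1 s) l s) r <= B) ->
      length (out (fold_left (fun s (b : bool) => if b then sem x c2 s else sem x c1 s) l s))
        <= length (out s) + length l * (cost c1 B + cost c2 B)).
    { eapply Nat.le_trans; [now apply G|]. apply Nat.add_le_mono_l, Nat.mul_le_mono_r, Hx. }
    induction l as [|b l IHl]; intros s' Hs'; cbn [fold_left length] in *; [lia|].
    specialize (IHl _ Hs').
    assert (Hle : forall r, regs (if b then sem x c2 s' else sem x c1 s') r <= B).
    { intros r. eapply Nat.le_trans; [|apply (Hs' r)].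
      apply (fold_st_le (fun s (b : bool) => if b then sem x c2 s else sem x c1 s)).
      intros ? []; apply sem_le. }
    destruct b; [specialize (IHc2 _ Hle)|specialize (IHc1 _ Hle)]; lia.
Qed.

Fixpoint max_reg (c : cmd) : nat :=
  match c with
  | Skip | Push _ => 0
  | Inc r => r
  | Seq c1 c2 | ForIn c1 c2 => Nat.max (max_reg c1) (max_reg c2)
  | For r c => Nat.max r (max_reg c)
  end.

Lemma regs_below_max c d : max_reg c < d -> regs_below d c.
Proof.
  induction c; cbn; intros H; auto; repeat split; try apply IHc1; try apply IHc2; try apply IHc; lia.
Qed.

Theorem polytime_cmd c : ok c -> PolyTimeFun (fun x => out (sem x c (init_st x))).
Proof.
  intros Hok.
  set (d := S (max_reg c)). set (D := depth c). set (w := 2 + D + d).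
  (* The last move puts the head on cell 1, where the output starts; the blank behind it ends the
     reading. *)
  set (p := PSeq (load w (D + 0)) (PSeq (tm_cmd w D 0 c) (PMove MR))).
  set (time := fun n => 100 * ((n + 1) * (n + 1) * (w + 3)) + (tm_time w c (growth c n + cost c (growth c n)) + 1)).
  assert (Hpb : poly_bounded time).
  { unfold time. repeat first [apply pb_const | apply pb_id | apply pb_add | apply pb_mul].
    apply (pb_comp (tm_time w c) (fun n => growth c n + cost c (growth c n))); [apply pb_tm_time|].
    apply pb_add; [|apply (pb_comp (cost c) (growth c)); [apply pb_cost|]]; apply pb_growth. }
  apply pb_pow_form in Hpb as (C & k & HC).
  exists (tm_of_code (compile 0 p)), C, k. intros x.
  destruct (exec_load w (D + 0) x) as (t1 & T1 & He1 & HL1 & HR1 & Ht1); [lia|].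
  assert (Hg1 : forall r, regs (sem x c (init_st x)) r <= growth c (length x)).
  { apply growth_correct; auto. intros r. cbn. unfold kset. destruct (r =? 0); lia. }
  pose proof (out_growth x c (init_st x) (growth c (length x)) (growth_ge _ _) Hg1) as Hg2.
  cbn [out init_st length] in Hg2.
  destruct (tm_cmd_correct D d x ltac:(lia) c 0 (fun _ => 0) (init_st x) T1
    (growth c (length x) + cost c (growth c (length x))))
    as (t2 & T2 & He2 & Ht2 & HL2 & HR2); auto.
  - lia.
  - apply regs_below_max. lia.
  - split; [|lia]. intros r _. specialize (Hg1 r). lia.
  - eapply RepL_ext; [|exact HL1]. intros i _. cbn [regs init_st].
    unfold counters, kset. destruct (Nat.ltb_spec i D), (Nat.eqb_spec i (D + 0)), (Nat.eqb_spec (i - D) 0); auto; lia.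
  - eapply halts_with_mono; [|eapply exec_halts_with; [eapply ESeq; [exact He1|eapply ESeq; [exact He2|constructor]]| |]].
    + specialize (HC (length x)). unfold time in HC. unfold w in *. lia.
    + intros i Hi. cbn [dir]. rewrite Z.add_0_l. rewrite (proj2 HR2).
      rewrite nth_indep with (d' := sym_of_bool false) by now rewrite length_map. apply map_nth.
    + cbn [dir]. rewrite Z.add_0_l, (proj2 HR2). now apply nth_syms_ge.
Qed.

(** * Circuits made of wide gates *)

Definition run (inp vals : list bool) (gs : list gate) : list bool :=
  fold_left (fun vals g => vals ++ [gate_val inp vals g]) gs vals.

Lemma run_app inp vals g1 g2 : run inp vals (g1 ++ g2) = run inp (run inp vals g1) g2.
Proof. apply fold_left_app. Qed.

Lemma run_length inp vals gs : length (run inp vals gs) = length vals + length gs.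
Proof.
  revert vals; induction gs as [|g gs IH]; intros vals; [cbn; lia|].
  change (run inp vals (g :: gs)) with (run inp (vals ++ [gate_val inp vals g]) gs).
  rewrite IH, length_app. cbn. lia.
Qed.

Lemma run_nth_old inp vals gs i : i < length vals -> nth i (run inp vals gs) false = nth i vals false.
Proof.
  revert vals; induction gs as [|g gs IH]; intros vals Hi; auto.
  change (run inp vals (g :: gs)) with (run inp (vals ++ [gate_val inp vals g]) gs).
  rewrite IH by (rewrite length_app; lia). now apply app_nth1.
Qed.

Inductive agate (A : Type) :=
| ANot (a : A)
| AAnd (a b : A)
| AOr (a b : A).
Arguments ANot {A}. Arguments AAnd {A}. Arguments AOr {A}.

Definition amap {A B} (f : A -> B) (g : agate A) : agate B :=
  match g with ANot a => ANot (f a) | AAnd a b => AAnd (f a) (f b) | AOr a b => AOr (f a) (f b) end.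

Definition to_gate (g : agate nat) : gate :=
  match g with ANot a => GNot a | AAnd a b => GAnd a b | AOr a b => GOr a b end.

Fixpoint synth_size (k : nat) : nat :=
  match k with 0 => 2 | S k => 2 * synth_size k + 4 end.

(* Shannon expansion of [phi]: gates computing [phi] at the bits referenced by [es]; [loc o] refers to the [o]-th gate
   of the block and [z] to an arbitrary earlier gate, from which the constants are built. *)
Fixpoint synth {A} (loc : nat -> A) (z : A) (phi : list bool -> bool) (es : list A) (o : nat)
    : list (agate A) :=
  match es with
  (* Whatever [z] is, its disjunction with its negation is true and its conjunction with it is
     false. *)
  | [] => [ANot z; if phi [] then AOr z (loc o) else AAnd z (loc o)]
  | e :: es' =>
      let m := synth_size (length es') in
      let q := o + m + m in
      synth loc z (fun l => phi (false :: l)) es' o ++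
      synth loc z (fun l => phi (true :: l)) es' (o + m) ++
      (* A multiplexer on [e]: the values of the two recursive blocks are carried by their last
         gates, number [o + m - 1] and [q - 1]. *)
      [ANot e; AAnd (loc q) (loc (o + m - 1)); AAnd e (loc (q - 1)); AOr (loc (q + 1)) (loc (q + 2))]
  end.

Lemma synth_size_pos k : 2 <= synth_size k.
Proof. induction k; cbn; lia. Qed.

Lemma synth_length {A} (loc : nat -> A) z phi es o : length (synth loc z phi es o) = synth_size (length es).
Proof.
  revert phi o; induction es as [|e es IH]; intros phi o; cbn; auto.
  rewrite !length_app, !IH. cbn. lia.
Qed.

(** The printing program builds a block with symbolic addresses and the circuit builds it with
    numbers; this identifies the two. *)
Lemma synth_map {A B} (f : A -> B) loc z phi es o :
  map (amap f) (synth loc z phi es o) = synth (fun o => f (loc o)) (f z) phi (map f es) o.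
Proof.
  revert phi o; induction es as [|e es IH]; intros phi o; cbn.
  - now destruct (phi []).
  - rewrite !map_app, !IH, length_map. reflexivity.
Qed.

Lemma run_nth_new inp vals g : nth (length vals) (run inp vals [g]) false = gate_val inp vals g.
Proof. cbn. apply nth_middle. Qed.

Lemma run_cons inp vals g gs : run inp vals (g :: gs) = run inp (run inp vals [g]) gs.
Proof. reflexivity. Qed.

(* A reference beyond the last gate but one of the block reads the default [false] throughout the block. *)
Lemma synth_correct inp b phi js o vals :
  0 < length vals -> length vals = b + o ->
  (forall j, In j js -> j < length vals \/ length vals + synth_size (length js) - 1 <= j) ->
  nth (length vals + synth_size (length js) - 1)
    (run inp vals (map to_gate (synth (fun o => b + o) 0 phi js o))) false =
  phi (map (fun j => nth j vals false) js).
Proof.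
  revert phi o vals; induction js as [|j js IH]; intros phi o vals Hpos Hlen Hj.
  - cbn [synth map length synth_size]. rewrite run_cons.
    replace (length vals + 2 - 1) with (length (run inp vals [to_gate (ANot 0)]))
      by (rewrite run_length; cbn; lia).
    rewrite run_nth_new.
    assert (H0 : nth 0 (run inp vals [to_gate (ANot 0)]) false = nth 0 vals false)
      by (apply run_nth_old; auto).
    assert (H1 : nth (b + o) (run inp vals [to_gate (ANot 0)]) false = negb (nth 0 vals false)).
    { rewrite <- Hlen. apply run_nth_new. }
    destruct (phi []) eqn:E; cbn [to_gate gate_val] in *; rewrite H0, H1; now destruct (nth 0 vals false).
  - cbn [synth length synth_size]. set (m := synth_size (length js)) in *.
    cbn [length synth_size] in Hj. fold m in Hj.
    assert (Hm : 2 <= m) by apply synth_size_pos.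
    rewrite !map_app, !run_app.
    set (v1 := run inp vals (map to_gate (synth (fun o => b + o) 0 (fun l => phi (false :: l)) js o))).
    set (v2 := run inp v1 (map to_gate (synth (fun o => b + o) 0 (fun l => phi (true :: l)) js (o + m)))).
    assert (L1 : length v1 = length vals + m).
    { unfold v1. now rewrite run_length, length_map, synth_length. }
    assert (L2 : length v2 = length vals + m + m).
    { unfold v2. now rewrite run_length, length_map, synth_length, L1. }
    assert (Hold1 : forall i, i < length vals -> nth i v1 false = nth i vals false).
    { intros i Hi. now apply run_nth_old. }
    assert (Hold2 : forall i, i < length v1 -> nth i v2 false = nth i v1 false).
    { intros i Hi. now apply run_nth_old. }
    assert (R1 : nth (length vals + m - 1) v2 false = phi (false :: map (fun j => nth j vals false) js)).
    { rewrite Hold2 by lia. unfold v1, m. rewrite IH; auto.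
      intros i Hi. fold m. destruct (Hj i); [now right|now left|right; lia]. }
    assert (R2 : nth (length vals + m + m - 1) v2 false = phi (true :: map (fun j => nth j vals false) js)).
    { rewrite <- L1. unfold v2, m. rewrite IH; try lia.
      - f_equal. f_equal. apply map_ext_in. intros i Hi.
        destruct (Hj i); [now right|auto|]. rewrite !nth_overflow; auto; lia.
      - intros i Hi. fold m. rewrite L1. destruct (Hj i); [now right|left; lia|right; lia]. }
    assert (Hjv : forall vs, length vs <= length vals + (2 * m + 4) - 1 ->
      (forall i, i < length vals -> nth i vs false = nth i vals false) ->
      nth j vs false = nth j vals false).
    { intros vs Hl Ho. destruct (Hj j); [now left|auto|]. rewrite !nth_overflow; auto; lia. }
    set (q := o + m + m). cbn [map to_gate].
    rewrite (run_cons _ v2). set (v3 := run inp v2 _).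
    rewrite (run_cons _ v3). set (v4 := run inp v3 _).
    rewrite (run_cons _ v4). set (v5 := run inp v4 _).
    assert (L3 : length v3 = length v2 + 1) by (unfold v3; now rewrite run_length).
    assert (L4 : length v4 = length v3 + 1) by (unfold v4; now rewrite run_length).
    assert (L5 : length v5 = length v4 + 1) by (unfold v5; now rewrite run_length).
    assert (O3 : forall i, i < length v2 -> nth i v3 false = nth i v2 false) by (intros; now apply run_nth_old).
    assert (O4 : forall i, i < length v3 -> nth i v4 false = nth i v3 false) by (intros; now apply run_nth_old).
    assert (O5 : forall i, i < length v4 -> nth i v5 false = nth i v4 false) by (intros; now apply run_nth_old).
    assert (E3 : nth (b + q) v3 false = negb (nth j vals false)).
    { replace (b + q) with (length v2) by (unfold q; lia). unfold v3. rewrite run_nth_new. cbn [gate_val].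
      f_equal. apply Hjv; [lia|]. intros i Hi. rewrite Hold2, Hold1; auto; lia. }
    assert (E4 : nth (b + (q + 1)) v4 false =
      negb (nth j vals false) && phi (false :: map (fun j => nth j vals false) js)).
    { replace (b + (q + 1)) with (length v3) by (unfold q; lia). unfold v4. rewrite run_nth_new. cbn [gate_val].
      f_equal; [exact E3|]. rewrite O3 by lia. rewrite <- R1. f_equal. lia. }
    assert (E5 : nth (b + (q + 2)) v5 false =
      nth j vals false && phi (true :: map (fun j => nth j vals false) js)).
    { replace (b + (q + 2)) with (length v4) by (unfold q; lia). unfold v5. rewrite run_nth_new. cbn [gate_val].
      f_equal.
      - apply Hjv; [lia|]. intros i Hi. rewrite O4, O3, Hold2, Hold1; auto; lia.
      - rewrite O4, O3 by (unfold q; lia). rewrite <- R2. f_equal. unfold q. lia. }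
    replace (length vals + (2 * m + 4) - 1) with (length v5) by lia.
    rewrite run_nth_new. cbn [gate_val]. rewrite O5, E4, E5 by (unfold q; lia).
    cbn [map]. now destruct (nth j vals false), (phi _), (phi _).
Qed.

Inductive kgate :=
| GI (i : nat)
| GF (phi : list bool -> bool) (js : list nat).

Definition kgate_val (inp vals : list bool) (k : kgate) : bool :=
  match k with
  | GI i => nth i inp false
  | GF phi js => phi (map (fun j => nth j vals false) js)
  end.

Definition kvals (inp : list bool) (ks : list kgate) : list bool :=
  fold_left (fun vals k => vals ++ [kgate_val inp vals k]) ks [].

Lemma kvals_snoc inp ks k : kvals inp (ks ++ [k]) = kvals inp ks ++ [kgate_val inp (kvals inp ks) k].
Proof. unfold kvals. now rewrite fold_left_app. Qed.

Lemma kvals_length inp ks : length (kvals inp ks) = length ks.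
Proof.
  induction ks using rev_ind; auto. rewrite kvals_snoc, !length_app, IHks. reflexivity.
Qed.

(** * Printing gates with counting loops *)

Fixpoint pushes (l : list bool) : cmd :=
  match l with [] => Skip | b :: l => Seq (Push b) (pushes l) end.

(* [(m, r, c)] denotes [m] times the value of register [r] plus [c]. *)
Definition expr : Type := (nat * nat * nat)%type.

Definition expr_val (rg : nat -> nat) (e : expr) : nat :=
  let '(m, r, c) := e in m * rg r + c.

Definition push_unary (e : expr) : cmd :=
  let '(m, r, c) := e in Seq (For r (pushes (repeat true m))) (pushes (unary c)).

Definition push_gate (g : agate expr) : cmd :=
  match g with
  | ANot a => Seq (pushes [false; true]) (push_unary a)
  | AAnd a b => Seq (pushes [true; false]) (Seq (push_unary a) (push_unary b))
  | AOr a b => Seq (pushes [true; true]) (Seq (push_unary a) (push_unary b))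
  end.

Fixpoint push_gates (gs : list (agate expr)) : cmd :=
  match gs with [] => Skip | g :: gs => Seq (push_gate g) (push_gates gs) end.

Fixpoint push_inputs (n : nat) (e : expr) : cmd :=
  match n with 0 => Skip | S n => Seq (Seq (pushes [false; false]) (push_unary e)) (push_inputs n e) end.

Definition pushes_out (c : cmd) (f : (nat -> nat) -> list bool) : Prop :=
  forall x s, sem x c s = mk_st (regs s) (out s ++ f (regs s)).

Lemma st_eta s : s = mk_st (regs s) (out s).
Proof. now destruct s. Qed.

Lemma pushes_out_pushes l : pushes_out (pushes l) (fun _ => l).
Proof.
  induction l as [|b l IH]; intros x s; cbn.
  - rewrite app_nil_r. apply st_eta.
  - rewrite IH. cbn. now rewrite <- app_assoc.
Qed.

Lemma pushes_out_Seq c1 c2 f1 f2 : pushes_out c1 f1 -> pushes_out c2 f2 ->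
  pushes_out (Seq c1 c2) (fun rg => f1 rg ++ f2 rg).
Proof. intros H1 H2 x s. cbn. rewrite H1, H2. cbn. now rewrite <- app_assoc. Qed.

Lemma pushes_out_ext c f f' : (forall rg, f rg = f' rg) -> pushes_out c f -> pushes_out c f'.
Proof. intros E H x s. now rewrite H, E. Qed.

Lemma unary_repeat n : unary n = repeat true n ++ [false].
Proof. induction n; cbn; congruence. Qed.

Lemma pushes_out_unary e : pushes_out (push_unary e) (fun rg => unary (expr_val rg e)).
Proof.
  destruct e as [[m r] c]. cbn. eapply pushes_out_ext; [|eapply pushes_out_Seq;
    [instantiate (1 := fun rg => repeat true (m * rg r))|apply pushes_out_pushes]].
  - intros rg. cbn. rewrite !unary_repeat, app_assoc. f_equal. now rewrite repeat_app.
  - intros x s. cbn. generalize (regs s r) as n. induction n; cbn.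
    + rewrite Nat.mul_0_r, app_nil_r. apply st_eta.
    + rewrite pushes_out_pushes. unfold Nat.iter in IHn. rewrite IHn. cbn.
      rewrite <- app_assoc. f_equal. f_equal. rewrite <- repeat_app. f_equal. lia.
Qed.

Lemma pushes_out_gate g :
  pushes_out (push_gate g) (fun rg => encode_gate (to_gate (amap (expr_val rg) g))).
Proof.
  destruct g; cbn [push_gate amap to_gate encode_gate];
    repeat first [apply pushes_out_Seq | apply pushes_out_pushes | apply pushes_out_unary].
Qed.

Lemma pushes_out_gates gs : pushes_out (push_gates gs)
  (fun rg => flat_map encode_gate (map to_gate (map (amap (expr_val rg)) gs))).
Proof.
  induction gs as [|g gs IH]; cbn [push_gates map flat_map].
  - apply (pushes_out_pushes []).
  - apply pushes_out_Seq; [apply pushes_out_gate | exact IH].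
Qed.

Lemma pushes_out_inputs n e : pushes_out (push_inputs n e)
  (fun rg => flat_map encode_gate (repeat (GIn (expr_val rg e)) n)).
Proof.
  induction n; cbn [push_inputs repeat flat_map].
  - apply (pushes_out_pushes []).
  - apply pushes_out_Seq; [|exact IHn].
    apply (pushes_out_Seq _ _ _ _ (pushes_out_pushes _) (pushes_out_unary e)).
Qed.

Lemma noinc_bounds c : incs c = [] -> bounds c = [].
Proof.
  induction c; cbn; auto; intros H; try discriminate.
  - apply app_eq_nil in H as [H1 H2]. now rewrite IHc1, IHc2.
  - now rewrite H.
  - apply app_eq_nil in H as [H1 H2]. now rewrite IHc1, IHc2.
Qed.

Lemma noinc_ok c : incs c = [] -> ok c.
Proof.
  induction c; cbn; auto; intros H; try discriminate.
  - apply app_eq_nil in H as [H1 H2]. auto.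
  - split; auto. intros q Hq. cbn in Hq. rewrite H in Hq. destruct Hq.
  - apply app_eq_nil in H as [H1 H2]. repeat split; auto.
    intros q Hq. cbn in Hq. rewrite !noinc_bounds in Hq by auto. destruct Hq.
Qed.

Lemma incs_pushes l : incs (pushes l) = [].
Proof. induction l; cbn; auto. Qed.

Lemma incs_push_unary e : incs (push_unary e) = [].
Proof. destruct e as [[m r] c]. cbn. now rewrite !incs_pushes. Qed.

Lemma incs_push_gates gs : incs (push_gates gs) = [].
Proof.
  induction gs as [|[] gs IH]; cbn; auto; now rewrite !incs_push_unary, IH.
Qed.

Lemma incs_push_inputs n e : incs (push_inputs n e) = [].
Proof. induction n; cbn; auto. now rewrite incs_push_unary, IHn. Qed.

Section Arity.
(* Every wide gate has [K] arguments and becomes a block of [G] binary gates whose last gate carries its value. *)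
Variable K : nat.
Let G := synth_size K.

(** An input gate is repeated [G] times so that block [i] always occupies the gates from [G * i] to
    [G * i + (G - 1)]. *)
Definition expand (base : nat) (k : kgate) : list gate :=
  match k with
  | GI i => repeat (GIn i) G
  | GF phi js => map to_gate
      (synth (fun o => G * base + o) 0 phi (map (fun j => G * j + (G - 1)) js) 0)
  end.

Fixpoint expand_from (base : nat) (ks : list kgate) : list gate :=
  match ks with
  | [] => []
  | k :: ks => expand base k ++ expand_from (S base) ks
  end.

Definition arity_ok (k : kgate) : Prop :=
  match k with GI _ => True | GF _ js => length js = K end.

Lemma expand_from_snoc base ks k :
  expand_from base (ks ++ [k]) = expand_from base ks ++ expand (base + length ks) k.
Proof.
  revert base; induction ks as [|k' ks IH]; intros base; cbn.
  - now rewrite app_nil_r, Nat.add_0_r.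
  - rewrite IH, <- app_assoc. do 3 f_equal. lia.
Qed.

Lemma expand_length base k : arity_ok k -> length (expand base k) = G.
Proof.
  destruct k; cbn; intros H.
  - apply repeat_length.
  - now rewrite length_map, synth_length, length_map, H.
Qed.

Lemma G_pos : 2 <= G.
Proof. apply synth_size_pos. Qed.

Lemma run_repeat_GIn inp vals i n :
  nth (length vals + n) (run inp vals (repeat (GIn i) (S n))) false = nth i inp false.
Proof.
  revert vals; induction n; intros vals.
  - rewrite Nat.add_0_r. apply run_nth_new.
  - cbn [repeat]. rewrite run_cons.
    replace (length vals + S n) with (length (run inp vals [GIn i]) + n)
      by (rewrite run_length; cbn; lia).
    apply IHn.
Qed.

(** The list starts with an input gate, so that gate 0, from which the blocks draw their constants,
    exists before any [GF] block. *)
Lemma expand_correct inp i0 ks :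
  Forall arity_ok ks ->
  let vals := run inp [] (expand_from 0 (GI i0 :: ks)) in
  length vals = G * S (length ks) /\
  forall i, i < S (length ks) -> nth (G * i + (G - 1)) vals false = nth i (kvals inp (GI i0 :: ks)) false.
Proof.
  pose proof G_pos as HG.
  induction ks as [|k ks IH] using rev_ind; intros Hk; cbn [length]; rewrite ?app_comm_cons.
  - cbn [expand_from expand]. rewrite app_nil_r. split.
    + rewrite run_length, repeat_length. cbn. lia.
    + intros i Hi. replace i with 0 by lia. rewrite Nat.mul_0_r.
      destruct G as [|G']; [lia|]. cbn [kvals fold_left app nth kgate_val].
      replace (S G' - 1) with G' by lia. apply (run_repeat_GIn inp []).
  - apply Forall_app in Hk as [Hks Hk]. apply Forall_inv in Hk. specialize (IH Hks).
    rewrite expand_from_snoc, run_app.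
    set (v := run inp [] (expand_from 0 (GI i0 :: ks))) in *. cbn zeta in *.
    destruct IH as [Hl Hv]. cbn [length Nat.add].
    split.
    { rewrite run_length, expand_length, Hl, length_app by auto. cbn. lia. }
    intros i Hi. rewrite length_app in Hi. cbn in Hi. rewrite kvals_snoc.
    assert (Hkl : length (kvals inp (GI i0 :: ks)) = S (length ks)) by now rewrite kvals_length.
    destruct (Nat.eq_dec i (S (length ks))) as [->|Hne].
    + rewrite (app_nth2 (kvals inp (GI i0 :: ks))), Hkl, Nat.sub_diag by lia. cbn [nth].
      destruct k as [i1|phi js]; cbn [expand kgate_val].
      * rewrite <- Hl. destruct G as [|G']; [lia|]. replace (S G' - 1) with G' by lia.
        apply run_repeat_GIn.
      * cbn in Hk. rewrite <- Hl.
        assert (HGj : G = synth_size (length (map (fun j => G * j + (G - 1)) js)))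
          by (unfold G; now rewrite length_map, Hk).
        replace (length v + (G - 1)) with
          (length v + synth_size (length (map (fun j => G * j + (G - 1)) js)) - 1) by lia.
        rewrite synth_correct.
        -- f_equal. rewrite map_map. apply map_ext. intros j.
           (* A reference to a wide gate not yet computed reads [false] at both levels; this lets
              the ends of a row refer to anything. *)
           destruct (Nat.lt_ge_cases j (S (length ks))); [now apply Hv|].
           rewrite !nth_overflow; auto; [now rewrite Hkl|]. nia.
        -- nia.
        -- lia.
        -- intros a Ha. apply in_map_iff in Ha as (j & <- & _). rewrite <- HGj.
           destruct (Nat.lt_ge_cases j (S (length ks))); [left|right]; nia.
    + rewrite run_nth_old by nia. rewrite Hv by lia. rewrite app_nth1; auto. lia.
Qed.

Definition circuit_of (n : nat) (ks : list kgate) : circuit := Build_circuit n (expand_from 0 ks).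

Lemma last_nth (l : list bool) d : last l d = nth (length l - 1) l d.
Proof.
  destruct l as [|b l] using rev_ind; auto. rewrite last_last, length_app. cbn.
  replace (length l + 1 - 1) with (length l) by lia. symmetry. apply nth_middle.
Qed.

Lemma circuit_of_eval n i0 ks inp :
  Forall arity_ok ks ->
  circuit_eval (circuit_of n (GI i0 :: ks)) inp = nth (length ks) (kvals inp (GI i0 :: ks)) false.
Proof.
  intros Hk. unfold circuit_eval. cbn [c_gates circuit_of].
  change (fold_left _ (expand_from 0 (GI i0 :: ks)) []) with (run inp [] (expand_from 0 (GI i0 :: ks))).
  destruct (expand_correct inp i0 ks Hk) as [Hl Hv].
  rewrite last_nth, Hl, <- Hv by lia. f_equal. pose proof G_pos. nia.
Qed.

(* Register 1 counts the wide gates emitted so far, register 2 is constantly 0; a reference [(r, c)]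
   denotes the wide gate whose index is the value of register [r] plus [c]. *)
Inductive kcmd :=
| KSkip
| KInc (r : nat)
| KIn (r c : nat)
| KEmit (phi : list bool -> bool) (refs : list (nat * nat))
| KSeq (c1 c2 : kcmd)
| KFor (r : nat) (c : kcmd)
| KForIn (c0 c1 : kcmd).

Record kst := mk_kst { kr : nat -> nat; kg : list kgate }.

(** Padding refers to wide gate 0, as register 2 is constantly 0. Its value is unknown, hence the
    [rest] over which statements on emitted functions quantify. *)
Definition pad (refs : list (nat * nat)) : list (nat * nat) :=
  refs ++ repeat (2, 0) (K - length refs).

Definition ref_val (rg : nat -> nat) (e : nat * nat) : nat := rg (fst e) + snd e.

Definition emit (k : kgate) (s : kst) : kst :=
  mk_kst (kset (kr s) 1 (S (kr s 1))) (kg s ++ [k]).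

Fixpoint ksem (x : list bool) (c : kcmd) (s : kst) : kst :=
  match c with
  | KSkip => s
  | KInc r => mk_kst (kset (kr s) r (S (kr s r))) (kg s)
  | KIn r c => emit (GI (ref_val (kr s) (r, c))) s
  | KEmit phi refs => emit (GF phi (map (ref_val (kr s)) (pad refs))) s
  | KSeq c1 c2 => ksem x c2 (ksem x c1 s)
  | KFor r c => Nat.iter (kr s r) (ksem x c) s
  | KForIn c0 c1 => fold_left (fun s (b : bool) => if b then ksem x c1 s else ksem x c0 s) x s
  end.

Fixpoint fits (c : kcmd) : Prop :=
  match c with
  | KEmit _ refs => length refs <= K
  | KSeq c1 c2 | KForIn c1 c2 => fits c1 /\ fits c2
  | KFor _ c => fits c
  | _ => True
  end.

Fixpoint cmd_of (c : kcmd) : cmd :=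
  match c with
  | KSkip => Skip
  | KInc r => Inc r
  | KIn r c => Seq (push_inputs G (1, r, c)) (Inc 1)
  | KEmit phi refs =>
      (* [G] times register 1 is where the current block starts; an argument is the last gate of the
         block it refers to, which explains the [G - 1]. *)
      Seq (push_gates (synth (fun o => (G, 1, o)) (0, 2, 0) phi
             (map (fun e => (G, fst e, G * snd e + (G - 1))) (pad refs)) 0))
          (Inc 1)
  | KSeq c1 c2 => Seq (cmd_of c1) (cmd_of c2)
  | KFor r c => For r (cmd_of c)
  | KForIn c0 c1 => ForIn (cmd_of c0) (cmd_of c1)
  end.

Fixpoint reserved_ok (c : kcmd) : Prop :=
  match c with
  | KInc r => 2 < r
  | KSeq c1 c2 | KForIn c1 c2 => reserved_ok c1 /\ reserved_ok c2
  | KFor _ c => reserved_ok c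
  | _ => True
  end.

Definition sync (hdr : list bool) (s : st) (k : kst) : Prop :=
  (forall r, regs s r = kr k r) /\ kr k 1 = length (kg k) /\ kr k 2 = 0 /\
  Forall arity_ok (kg k) /\ out s = hdr ++ flat_map encode_gate (expand_from 0 (kg k)).

Lemma length_pad refs : length refs <= K -> length (pad refs) = K.
Proof. intros H. unfold pad. rewrite length_app, repeat_length. lia. Qed.

Lemma sync_emit hdr x s k g c :
  sync hdr s k -> arity_ok g ->
  sem x c s = mk_st (regs s) (out s ++ flat_map encode_gate (expand (length (kg k)) g)) ->
  sync hdr (sem x (Seq c (Inc 1)) s) (emit g k).
Proof.
  intros (H1 & H2 & H3 & H4 & H5) Hg Hc. cbn [sem]. rewrite Hc.
  unfold sync, emit. cbn [regs out kr kg]. repeat split.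
  - intros r. unfold kset. rewrite !H1. reflexivity.
  - rewrite kset_same, length_app. cbn. lia.
  - rewrite kset_other by lia. exact H3.
  - apply Forall_app. auto.
  - rewrite expand_from_snoc, flat_map_app, H5, <- app_assoc. reflexivity.
Qed.

Lemma cmd_of_correct hdr x c s k :
  fits c -> reserved_ok c -> sync hdr s k -> sync hdr (sem x (cmd_of c) s) (ksem x c k).
Proof.
  revert s k; induction c; intros s k Hf Hr H; cbn [cmd_of ksem] in *.
  - exact H.
  - destruct H as (H1 & H2 & H3 & H4 & H5). cbn in Hr. repeat split; cbn; auto.
    + intros q. unfold kset. now rewrite !H1.
    + now rewrite kset_other by lia.
    + now rewrite kset_other by lia.
  - apply sync_emit; cbn; auto. rewrite pushes_out_inputs. do 2 f_equal.
    destruct H as (H1 & _). cbn. now rewrite H1, Nat.add_0_r.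
  - apply sync_emit; auto.
    + cbn in *. rewrite length_map. now apply length_pad.
    + rewrite pushes_out_gates. do 2 f_equal. destruct H as (H1 & H2 & H3 & _).
      cbn [expand]. rewrite synth_map, !map_map. cbn. rewrite H1, H2. f_equal. f_equal. f_equal.
      apply map_ext. intros [r c]. cbn. unfold ref_val. cbn. rewrite H1. lia.
  - destruct Hf, Hr. cbn. auto.
  - cbn in *. destruct H as (H1 & H'). rewrite H1. 
    assert (G0 : forall n, sync hdr (Nat.iter n (sem x (cmd_of c)) s) (Nat.iter n (ksem x c) k)).
    { induction n; cbn; [split; auto|]. apply IHc; auto. }
    apply G0.
  - destruct Hf, Hr. cbn. clear - IHc1 IHc2 H H0 H1 H2 H3. revert s k H.
    generalize x at 3 6 as l. induction l as [|[] l IHl]; intros s k H'; cbn; auto.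
Qed.

(** [I] contains the registers that may be incremented, [B] those that may bound a loop. One such
    description yields framing and, when [I] and [B] are disjoint and 0 is not in [I], the condition
    [ok]. *)
Fixpoint uses (I B : nat -> Prop) (c : kcmd) : Prop :=
  match c with
  | KSkip => True
  | KInc r => I r /\ 2 < r
  | KIn _ _ => I 1
  | KEmit _ refs => I 1 /\ length refs <= K
  | KSeq c1 c2 | KForIn c1 c2 => uses I B c1 /\ uses I B c2
  | KFor r c => B r /\ uses I B c
  end.

Lemma uses_fits I B c : uses I B c -> fits c.
Proof. induction c; cbn; intuition. Qed.

Lemma uses_reserved I B c : uses I B c -> reserved_ok c.
Proof. induction c; cbn; intuition. Qed.

Lemma uses_mono (I I' B B' : nat -> Prop) c :
  (forall r, I r -> I' r) -> (forall r, B r -> B' r) -> uses I B c -> uses I' B' c.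
Proof. intros HI HB. induction c; cbn; intuition. Qed.

Lemma ksem_frame I B x c s r : uses I B c -> ~ I r -> kr (ksem x c s) r = kr s r.
Proof.
  intros H Hr. revert s H; induction c; intros s H; cbn in *; auto.
  - apply kset_other. intros ->. tauto.
  - apply kset_other. congruence.
  - apply kset_other. intros ->. tauto.
  - destruct H. rewrite IHc2, IHc1; auto.
  - destruct H. generalize (kr s r0) as n. induction n; cbn; auto. now rewrite IHc.
  - destruct H. generalize x at 3 as l. intros l; revert s. induction l as [|[] l IHl]; intros s; cbn; auto;
      rewrite IHl; auto.
Qed.

Lemma uses_incs I B c r : uses I B c -> In r (incs (cmd_of c)) -> I r.
Proof.
  induction c; cbn; rewrite ?incs_push_inputs, ?incs_push_gates, ?in_app_iff; cbn; intuition congruence.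
Qed.

Lemma uses_bounds I B c r : uses I B c -> In r (bounds (cmd_of c)) -> B r.
Proof.
  induction c; cbn; rewrite ?noinc_bounds by auto using incs_push_inputs, incs_push_gates;
    rewrite ?in_app_iff; cbn; try tauto.
  destruct (incs (cmd_of c)); cbn; intuition congruence.
Qed.

Lemma uses_ok I B c : (forall r, I r -> B r -> False) -> ~ I 0 -> uses I B c -> ok (cmd_of c).
Proof.
  intros HIB H0. induction c; cbn; auto.
  - intros [Hr _] ->. auto.
  - split; auto. apply noinc_ok, incs_push_inputs.
  - split; auto. apply noinc_ok, incs_push_gates.
  - intuition.
  - intros [Hr Hc]. split; auto. intros q Hq Hin.
    assert (B q). { apply (uses_bounds I B (KFor r c)); cbn; auto. }
    cbn in Hin. apply (uses_incs I B) in Hin; eauto.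
  - intros [Hc1 Hc2]. repeat split; auto. intros q Hq Hin.
    apply (uses_bounds I B (KForIn c1 c2)) in Hq; cbn; auto.
    apply (uses_incs I B (KForIn c1 c2)) in Hin; cbn; eauto.
Qed.

(** Unlike [uses] with disjoint sets, this is closed under sequencing in full generality: a register
    may be incremented in one phase and bound a loop in another. *)
Definition good (c : kcmd) : Prop := fits c /\ reserved_ok c /\ ok (cmd_of c).

Lemma good_Seq c1 c2 : good c1 -> good c2 -> good (KSeq c1 c2).
Proof. unfold good. cbn. tauto. Qed.

Lemma good_uses I B c : (forall r, I r -> B r -> False) -> ~ I 0 -> uses I B c -> good c.
Proof.
  intros H1 H2 H3. split; [|split]; [eapply uses_fits | eapply uses_reserved | eapply uses_ok]; eauto.
Qed.

Lemma ksem_ext x c k : exists l, kg (ksem x c k) = kg k ++ l.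
Proof.
  revert k; induction c; intros k; cbn.
  - exists []. now rewrite app_nil_r.
  - exists []. now rewrite app_nil_r.
  - eauto.
  - eauto.
  - destruct (IHc1 k) as [l1 E1], (IHc2 (ksem x c1 k)) as [l2 E2].
    exists (l1 ++ l2). now rewrite E2, E1, app_assoc.
  - generalize (kr k r) as n. induction n as [|n [l E]]; cbn.
    + exists []. now rewrite app_nil_r.
    + destruct (IHc (Nat.iter n (ksem x c) k)) as [l' E'].
      exists (l ++ l'). unfold Nat.iter in *. now rewrite E', E, app_assoc.
  - generalize x at 3 as l. intros l. revert k. induction l as [|b l IHl]; intros k; cbn.
    + exists []. now rewrite app_nil_r.
    + destruct (IHl (if b then ksem x c2 k else ksem x c1 k)) as [l' E'].
      assert (exists l0, kg (if b then ksem x c2 k else ksem x c1 k) = kg k ++ l0) as [l0 E0]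
        by (destruct b; auto).
      exists (l0 ++ l'). now rewrite E', E0, app_assoc.
Qed.

Definition counted (k : kst) : Prop := kr k 1 = length (kg k) /\ kr k 2 = 0.

Lemma ksem_counted x c k : reserved_ok c -> counted k -> counted (ksem x c k).
Proof.
  unfold counted. revert k; induction c; intros k Hr H; cbn in *; auto.
  - rewrite !kset_other by lia. auto.
  - rewrite length_app. cbn. lia.
  - rewrite length_app. cbn. lia.
  - destruct Hr. auto.
  - generalize (kr k r) as n. induction n; cbn; auto.
  - destruct Hr. generalize x at 3 6 9 as l. intros l. revert k H.
    induction l as [|[] l IHl]; intros k H; cbn; auto.
Qed.
End Arity.

(** * Simulation of Turing machines by circuits *)

(* Head-centred semantics: the head always scans position 0 and the tape is shifted instead. *)
Definition hconf : Type := (nat * (Z -> sym))%type.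

Definition ctrl (M : TM) (q : nat) (a : sym) : nat * sym * move :=
  if tm_halt M q then (q, a, MN) else tm_delta M q a.

Definition hstep (M : TM) (c : hconf) : hconf :=
  let '(q, R) := c in
  let '(q', w, m) := ctrl M q (R 0%Z) in
  (q', fun i => upd R 0 w (i + dir m)%Z).

Definition hrun (M : TM) (t : nat) (c : hconf) : hconf := Nat.iter t (hstep M) c.

Lemma hrun_S M t c : hrun M (S t) c = hstep M (hrun M t c).
Proof. reflexivity. Qed.

Lemma crep_shift c q T h : crep c q T h -> crep c q (fun i => T (i + h)%Z) 0.
Proof.
  destruct c as [[[q' l] a] r]. intros (-> & -> & Hl & Hr). unfold crep. repeat split.
  - intros i. rewrite Hl. f_equal. lia.
  - intros i. rewrite Hr. f_equal. lia.
Qed.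

Lemma hstep_correct M c hc :
  crep c (fst hc) (snd hc) 0 ->
  crep (tm_step M c) (fst (hstep M hc)) (snd (hstep M hc)) 0.
Proof.
  destruct hc as [q R]. cbn [fst snd hstep]. unfold ctrl. intros H.
  destruct (tm_halt M q) eqn:Hh.
  - cbn [fst snd].
    replace (tm_step M c) with c.
    + eapply crep_ext; [|exact H]. intros z. cbn [dir]. rewrite Z.add_0_r. unfold upd.
      now destruct (Z.eqb_spec z 0) as [->|].
    + destruct c as [[[q' l] a] r]. destruct H as (-> & _). cbn. now rewrite Hh.
  - destruct (tm_delta M q (R 0%Z)) as [[q' w] m] eqn:Hd. cbn [fst snd].
    pose proof (crep_step M c q R 0 q' w m H Hh Hd) as H'.
    apply crep_shift in H'. eapply crep_ext; [|exact H']. intros z. cbn. f_equal; lia.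
Qed.

Lemma hrun_correct M t c hc :
  crep c (fst hc) (snd hc) 0 ->
  crep (tm_run M t c) (fst (hrun M t hc)) (snd (hrun M t hc)) 0.
Proof.
  revert c; induction t; intros c H; [exact H|].
  replace (S t) with (t + 1) by lia. rewrite tm_run_add.
  rewrite Nat.add_1_r, hrun_S. cbn [tm_run]. apply hstep_correct. now apply IHt.
Qed.

Definition hinit (M : TM) (x : list bool) : hconf :=
  (tm_start M, fun i => tape_of_input x (i + 1)%Z).

Lemma hinit_correct M x : crep (tm_init M x) (fst (hinit M x)) (snd (hinit M x)) 0.
Proof. apply crep_shift with (h := 1%Z). apply tm_init_crep. Qed.

Lemma hrun_state M t hc : fst hc < tm_n M -> fst (hrun M t hc) < tm_n M.
Proof.
  intros H. induction t; [exact H|]. rewrite hrun_S.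
  destruct (hrun M t hc) as [q R]. cbn in *. unfold ctrl.
  destruct (tm_halt M q); [exact IHt|].
  pose proof (tm_delta_ok M q (R 0%Z) IHt) as Hd.
  destruct (tm_delta M q (R 0%Z)) as [[q' w] m]. exact Hd.
Qed.

(** Relative to the head, the non-blank part extends to the right by at most one cell per step. This
    will bound the length of an output. *)
Lemma hrun_blank M x t i :
  (Z.of_nat (length x + 1 + t) <= i)%Z -> snd (hrun M t (hinit M x)) i = SB.
Proof.
  revert i; induction t; intros i Hi.
  - cbn. unfold tape_of_input. destruct (Z.ltb_spec (i + 1) 1); auto. apply nth_syms_ge. lia.
  - rewrite hrun_S.
    destruct (hrun M t (hinit M x)) as [q R]. cbn in *.
    destruct (ctrl M q (R 0%Z)) as [[q' w] m]. cbn.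
    rewrite upd_other; [apply IHt|]; destruct m; cbn [dir]; lia.
Qed.

Lemma read_bits_inv l y : read_bits l = y ->
  (forall i, i < length y -> nth i l SB = sym_of_bool (nth i y false)) /\ nth (length y) l SB = SB.
Proof.
  intros <-. induction l as [|[] l [IH1 IH2]]; cbn; split; auto; try lia.
  - intros [|i] Hi; auto. apply IH1. lia.
  - intros [|i] Hi; auto. apply IH1. lia.
Qed.

Lemma halts_with_hrun M x t t' y :
  halts_with M x t y -> t <= t' ->
  let R := snd (hrun M t' (hinit M x)) in
  (forall i, i < length y -> R (Z.of_nat i) = sym_of_bool (nth i y false)) /\
  R (Z.of_nat (length y)) = SB.
Proof.
  intros H Ht. apply (halts_with_mono _ _ _ t') in H; auto. unfold halts_with in H.
  pose proof (hrun_correct M t' _ _ (hinit_correct M x)) as Hc.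
  destruct (tm_run M t' (tm_init M x)) as [[[q l] a] r]. destruct H as [_ H].
  destruct Hc as (_ & Ha & _ & Hr). cbn [tm_output] in H. apply read_bits_inv in H as [H1 H2].
  assert (E : forall i, nth i (a :: r) SB = snd (hrun M t' (hinit M x)) (Z.of_nat i)).
  { intros [|i]; cbn [nth]; [exact Ha|]. rewrite Hr. f_equal. lia. }
  split.
  - intros i Hi. rewrite <- E. auto.
  - now rewrite <- E.
Qed.

(** * Values of emitted gates *)

(** With [nth_error] the gate is required to exist already, so that its value survives all later
    emissions. *)
Definition bit_at (k : kst) (inp : list bool) (i : nat) (b : bool) : Prop :=
  nth_error (kvals inp (kg k)) i = Some b.

Definition cell_at (k : kst) (inp : list bool) (i : nat) (s : sym) : Prop :=
  bit_at k inp i (nonblank s) /\ bit_at k inp (S i) (bit_sym s).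

Lemma kvals_ext inp ks l : exists v, kvals inp (ks ++ l) = kvals inp ks ++ v.
Proof.
  induction l as [|k l [v IH]] using rev_ind.
  - exists []. now rewrite !app_nil_r.
  - rewrite app_assoc, kvals_snoc, IH. eexists. rewrite <- app_assoc. reflexivity.
Qed.

Section Sim.
Variables (K : nat) (x inp : list bool).

Local Notation sem := (ksem K x).

Lemma ksem_Seq c1 c2 k : sem (KSeq c1 c2) k = sem c2 (sem c1 k).
Proof. reflexivity. Qed.

Lemma bit_ksem c k i b : bit_at k inp i b -> bit_at (sem c k) inp i b.
Proof.
  unfold bit_at. destruct (ksem_ext K x c k) as [l ->]. destruct (kvals_ext inp (kg k) l) as [v ->].
  intros H. rewrite nth_error_app1; auto. apply nth_error_Some. congruence.
Qed.

Lemma cell_ksem c k i s : cell_at k inp i s -> cell_at (sem c k) inp i s.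
Proof. intros [H1 H2]. split; now apply bit_ksem. Qed.

Definition bits_at (k : kst) (refs : list (nat * nat)) (vs : list bool) : Prop :=
  Forall2 (fun e v => bit_at k inp (ref_val (kr k) e) v) refs vs.

Lemma emit_bit phi refs k vs :
  counted k -> bits_at k refs vs ->
  exists rest, bit_at (sem (KEmit phi refs) k) inp (kr k 1) (phi (vs ++ rest)).
Proof.
  intros [Hc _] H. unfold bit_at at 1. cbn [ksem emit kg]. rewrite kvals_snoc, Hc.
  rewrite <- (kvals_length inp (kg k)).
  rewrite nth_error_app2, Nat.sub_diag by lia. cbn. unfold pad. rewrite !map_app.
  eexists. do 3 f_equal. clear - H. induction H as [|[r c] v refs vs E _ IH]; cbn; auto.
  f_equal; auto. now apply nth_error_nth.
Qed.

Fixpoint incn (r n : nat) : kcmd :=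
  match n with 0 => KSkip | S n => KSeq (KInc r) (incn r n) end.

Lemma incn_reg r n k q : kr (sem (incn r n) k) q = if q =? r then kr k r + n else kr k q.
Proof.
  revert k; induction n; intros k; cbn [incn ksem].
  - destruct (Nat.eqb_spec q r) as [->|]; auto.
  - rewrite IHn. cbn. unfold kset. rewrite Nat.eqb_refl.
    destruct (q =? r) eqn:E; [apply Nat.eqb_eq in E; subst|]; lia.
Qed.

Lemma incn_uses (I B : nat -> Prop) r n : I r -> 2 < r -> uses K I B (incn r n).
Proof. intros HI Hr. induction n; cbn; auto. Qed.

Lemma incn_reserved r n : 2 < r -> reserved_ok (incn r n).
Proof. intros Hr. induction n; cbn; auto. Qed.

Lemma for_inv (P : nat -> kst -> Prop) r c k :
  P 0 k -> (forall j k', j < kr k r -> P j k' -> P (S j) (sem c k')) -> P (kr k r) (sem (KFor r c) k).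
Proof.
  intros H0 HS. cbn. remember (kr k r) as n eqn:En. clear En.
  induction n as [|n IH]; [exact H0|]. apply HS; [lia|]. apply IH. intros. apply HS; auto.
Qed.

Lemma for_incn_reg r p n k q :
  kr (sem (KFor r (incn p n)) k) q = if q =? p then kr k p + n * kr k r else kr k q.
Proof.
  cbn [ksem]. revert q. generalize (kr k r) as m. induction m; intros q.
  - cbn. destruct (Nat.eqb_spec q p); subst; lia.
  - change (Nat.iter (S m) (sem (incn p n)) k) with (sem (incn p n) (Nat.iter m (sem (incn p n)) k)).
    rewrite incn_reg, !IHm, Nat.eqb_refl.
    destruct (q =? p) eqn:E; [apply Nat.eqb_eq in E; subst|]; lia.
Qed.

Definition emit_cell (F : list bool -> sym) (refs : list (nat * nat)) : kcmd :=
  KSeq (KEmit (fun l => nonblank (F l)) refs) (KEmit (fun l => bit_sym (F l)) refs).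

Lemma emit_cell_reg F refs k q :
  kr (sem (emit_cell F refs) k) q = if q =? 1 then kr k 1 + 2 else kr k q.
Proof. cbn. unfold kset. destruct (Nat.eqb_spec q 1); cbn; lia. Qed.

(** Register 1 advances with every emission, so only references through other registers keep their
    meaning. *)
Lemma bits_emit phi refs' refs k vs :
  Forall (fun e => fst e <> 1) refs -> bits_at k refs vs ->
  bits_at (sem (KEmit phi refs') k) refs vs.
Proof.
  intros Hr H. unfold bits_at in *. induction H as [|e v refs vs He _ IH]; [constructor|].
  inversion Hr; subst. constructor; [|now apply IH].
  apply bit_ksem. cbn. unfold ref_val in *. rewrite kset_other; auto.
Qed.

Lemma emit_cell_correct F refs k vs s :
  counted k -> Forall (fun e => fst e <> 1) refs -> bits_at k refs vs ->
  (forall rest, F (vs ++ rest) = s) ->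
  cell_at (sem (emit_cell F refs) k) inp (kr k 1) s.
Proof.
  intros Hc Hr H HF.
  destruct (emit_bit (fun l => nonblank (F l)) refs k vs Hc H) as [r1 H1].
  assert (Hc2 := ksem_counted K x (KEmit (fun l => nonblank (F l)) refs) k I Hc).
  destruct (emit_bit (fun l => bit_sym (F l)) refs (sem (KEmit (fun l => nonblank (F l)) refs) k) vs Hc2)
    as [r2 H2].
  { now apply bits_emit. }
  rewrite HF in H1, H2. split.
  - cbn [emit_cell]. apply (bit_ksem (KEmit _ refs)). exact H1.
  - exact H2.
Qed.

Lemma eqb_neq_false a b : a <> b -> (a =? b) = false.
Proof. apply Nat.eqb_neq. Qed.

Fixpoint emit_list (l : list (list bool -> bool)) (refs : list (nat * nat)) : kcmd :=
  match l with [] => KSkip | phi :: l => KSeq (KEmit phi refs) (emit_list l refs) end.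

Lemma emit_list_reg l refs k q :
  kr (sem (emit_list l refs) k) q = if q =? 1 then kr k 1 + length l else kr k q.
Proof.
  revert k; induction l; intros k; cbn [emit_list ksem length].
  - destruct (Nat.eqb_spec q 1) as [->|]; auto.
  - rewrite IHl. cbn. unfold kset. destruct (Nat.eqb_spec q 1); cbn; lia.
Qed.

Lemma emit_list_correct l refs k vs (ws : list bool) :
  counted k -> Forall (fun e => fst e <> 1) refs -> bits_at k refs vs ->
  Forall2 (fun (phi : list bool -> bool) w => forall rest, phi (vs ++ rest) = w) l ws ->
  forall j w, nth_error ws j = Some w -> bit_at (sem (emit_list l refs) k) inp (kr k 1 + j) w.
Proof.
  intros Hc Hr H HF. revert k Hc H. induction HF as [|phi w l ws Hphi _ IH]; intros k Hc H j w' Hj.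
  - destruct j; discriminate.
  - cbn [emit_list ksem]. destruct (emit_bit phi refs k vs Hc H) as [r1 H1]. rewrite Hphi in H1.
    destruct j as [|j]; cbn in Hj.
    + injection Hj as <-. rewrite Nat.add_0_r. apply bit_ksem. exact H1.
    + specialize (IH (sem (KEmit phi refs) k)).
      replace (kr k 1 + S j) with (kr (sem (KEmit phi refs) k) 1 + j) by (cbn; lia).
      apply IH; auto.
      * apply ksem_counted; auto. exact I.
      * now apply bits_emit.
Qed.

Lemma emit_list_reserved l refs : reserved_ok (emit_list l refs).
Proof. induction l; cbn; auto. Qed.

Definition const_cell (s : sym) : kcmd := emit_cell (fun _ => s) [].

Lemma const_cell_correct s k : counted k -> cell_at (sem (const_cell s) k) inp (kr k 1) s.
Proof. intros H. eapply emit_cell_correct with (vs := []); auto; constructor. Qed.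

Lemma const_cells r s n k :
  r <> 1 -> kr k r = n -> counted k ->
  let k' := sem (KFor r (const_cell s)) k in
  counted k' /\ (forall q, kr k' q = if q =? 1 then kr k 1 + 2 * n else kr k q) /\
  forall i, i < n -> cell_at k' inp (kr k 1 + 2 * i) s.
Proof.
  intros Hr Hn Hc.
  pose proof (for_inv (fun j k' => counted k' /\
    (forall q, kr k' q = if q =? 1 then kr k 1 + 2 * j else kr k q) /\
    forall i, i < j -> cell_at k' inp (kr k 1 + 2 * i) s) r (const_cell s) k) as H.
  rewrite Hn in H. apply H.
  - split; [exact Hc|]. split; [|intros; lia]. intros q. destruct (Nat.eqb_spec q 1); subst; lia.
  - intros j k' _ (Hc' & Hr' & Hcell). split; [|split].
    + apply ksem_counted; auto. split; exact I.
    + intros q. unfold const_cell. rewrite emit_cell_reg, !Hr'. cbn. destruct (q =? 1); lia.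
    + intros i Hi. destruct (Nat.eq_dec i j) as [->|].
      * specialize (Hr' 1). cbn [Nat.eqb] in Hr'. rewrite <- Hr'. now apply const_cell_correct.
      * apply cell_ksem, Hcell. lia.
Qed.

Lemma const_cell_uses (I B : nat -> Prop) s : I 1 -> uses K I B (const_cell s).
Proof. intros H. cbn. repeat split; auto; lia. Qed.

Lemma for_const_cell_uses (I B : nat -> Prop) r s : I 1 -> B r -> uses K I B (KFor r (const_cell s)).
Proof. intros H1 H2. split; auto using const_cell_uses. Qed.

Lemma for_incn_uses (I B : nat -> Prop) r p n : I p -> 2 < p -> B r -> uses K I B (KFor r (incn p n)).
Proof. intros H1 H2 H3. split; auto using incn_uses. Qed.

Lemma emit_list_uses (I B : nat -> Prop) l refs : I 1 -> length refs <= K -> uses K I B (emit_list l refs).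
Proof. intros H1 H2. induction l; cbn; auto. Qed.

Lemma emit_list_consts_bits l k j b :
  counted k -> nth_error l j = Some b ->
  bit_at (sem (emit_list (map (fun b _ => b) l) []) k) inp (kr k 1 + j) b.
Proof.
  intros Hc Hj. eapply emit_list_correct with (vs := []) (ws := l); auto; try constructor.
  clear. induction l; cbn; constructor; auto.
Qed.

(** Decodes the one-hot encoding [qbits] of a state. *)
Fixpoint qindex (l : list bool) : nat :=
  match l with
  | [] | true :: _ => 0
  | false :: l => S (qindex l)
  end.

Definition qbits (Q q : nat) : list bool := map (Nat.eqb q) (seq 0 Q).

Lemma qindex_qbits Q q : q < Q -> qindex (qbits Q q) = q.
Proof.
  unfold qbits. intros H. enough (G : forall a, qindex (map (Nat.eqb (a + q)) (seq a Q)) = q) by apply (G 0).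
  revert q H; induction Q as [|Q IH]; intros q H a; [lia|]. cbn.
  destruct (Nat.eqb_spec (a + q) a) as [E|E]; [lia|].
  destruct q as [|q]; [lia|]. rewrite <- (IH q ltac:(lia) (S a)) at 2.
  f_equal. f_equal. apply map_ext_in. intros. f_equal. lia.
Qed.

Definition dec (v b : bool) : sym := if v then sym_of_bool b else SB.

Lemma dec_sym s : dec (nonblank s) (bit_sym s) = s.
Proof. now destruct s. Qed.

Definition cell_refs (e : nat * nat) : list (nat * nat) := [(fst e, snd e); (fst e, S (snd e))].

Definition cell_bits (s : sym) : list bool := [nonblank s; bit_sym s].

(** * One machine step as a row of gates *)

Variable M : TM.
Let Q := tm_n M.

(* The three neighbours [l], [c], [r] of a cell in the old row determine its new content; [u] tells
   which of them (1, 2 or 3) is the scanned cell, and hence reads as the written symbol. *)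
Definition new_sym (u q : nat) (a l c r : sym) : sym :=
  let '(_, w, m) := ctrl M q a in
  match m with
  (* A head move to the left shifts the centred tape to the right, so a cell receives the content of
     its left neighbour. *)
  | ML => if u =? 1 then w else l
  | MN => if u =? 2 then w else c
  | MR => if u =? 3 then w else r
  end.

Definition cell_fun (u : nat) (l : list bool) : sym :=
  let s i := dec (nth i l false) (nth (S i) l false) in
  new_sym u (qindex (firstn Q (skipn 8 l))) (s 0) (s 2) (s 4) (s 6).

Definition state_fun (j : nat) (l : list bool) : bool :=
  fst (fst (ctrl M (qindex (firstn Q (skipn 2 l))) (dec (nth 0 l false) (nth 1 l false)))) =? j.

(** [pv] sweeps the previous row one cell (two gates) behind the cell being emitted, so its offsets
    0, 2 and 4 are the left neighbour, the cell and the right neighbour. [ph] stays on cell [W] of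
    that row: the state bits start at offset 2 and the scanned cell at offset [2 + Q]. *)
Variables (rW rlen ph pv : nat).

Definition qrefs : list (nat * nat) := map (fun j => (ph, 2 + j)) (seq 0 Q).

Definition step_cell (u : nat) (L C R : nat * nat) : kcmd :=
  KSeq (emit_cell (cell_fun u)
         (cell_refs (ph, 2 + Q) ++ cell_refs L ++ cell_refs C ++ cell_refs R ++ qrefs))
       (incn pv 2).

Definition emit_state : kcmd :=
  KSeq (emit_list (map state_fun (seq 0 Q)) (cell_refs (ph, 2 + Q) ++ qrefs)) (incn pv Q).

Definition generic_cell : kcmd := step_cell 0 (pv, 0) (pv, 2) (pv, 4).

(** The state bits interrupt the sequence of cells, so the two cells beside them see each other only
    through [ph]. The sweep leaves [pv] where the next row needs it; [ph] is advanced by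
    [4 * W + 2 * len + 6 + Q], the length of a row. *)
Definition emit_row : kcmd :=
  KSeq (KFor rW generic_cell)
  (KSeq (step_cell 3 (pv, 0) (pv, 2) (ph, 2 + Q))
  (KSeq emit_state
  (KSeq (step_cell 2 (ph, 0) (pv, 2) (pv, 4))
  (KSeq (step_cell 1 (pv, 0) (pv, 2) (pv, 4))
  (KSeq (KFor rlen generic_cell)
  (KSeq (KFor rW generic_cell)
  (KSeq (KFor rW (incn ph 4))
  (KSeq (KFor rlen (incn ph 2))
        (incn ph (6 + Q)))))))))).

Variables (W len : nat).
Let N := 2 * W + len + 3.

(* Address of cell [c] in the row starting at [base]; cell [W + 1] is the scanned one and the
   state bits sit just before it. *)
Definition caddr (base c : nat) : nat := base + 2 * c + (if c <=? W then 0 else Q).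

Definition row_size : nat := 2 * N + Q.

(* The row represents configuration [hc], except possibly within [t] cells of its ends: the outermost cells of a
   row take unrelated earlier gates for their missing neighbours, and the errors travel one cell per step. *)
Definition row_at (k : kst) (base t : nat) (hc : hconf) : Prop :=
  (forall j, j < Q -> bit_at k inp (base + 2 * (W + 1) + j) (fst hc =? j)) /\
  (forall c, t <= c -> c + t < N -> cell_at k inp (caddr base c) (snd hc (Z.of_nat c - Z.of_nat W - 1)%Z)).

Lemma row_at_ksem c k base t hc : row_at k base t hc -> row_at (sem c k) base t hc.
Proof.
  intros [H1 H2]. split; intros.
  - now apply bit_ksem, H1.
  - now apply cell_ksem, H2.
Qed.

Hypothesis Hph : ph <> 1 /\ 2 < ph.
Hypothesis Hpv : pv <> 1 /\ 2 < pv.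
Hypothesis Hphv : ph <> pv.

Lemma step_cell_reg u L C R k q :
  kr (sem (step_cell u L C R) k) q =
  if q =? 1 then kr k 1 + 2 else if q =? pv then kr k pv + 2 else kr k q.
Proof.
  unfold step_cell. cbn [ksem]. rewrite incn_reg, !emit_cell_reg.
  rewrite (proj2 (Nat.eqb_neq pv 1)) by apply Hpv.
  destruct (q =? pv) eqn:E; auto. apply Nat.eqb_eq in E. subst q.
  now rewrite (proj2 (Nat.eqb_neq pv 1)) by apply Hpv.
Qed.

Lemma cell_refs_bits k e s : cell_at k inp (ref_val (kr k) e) s -> bits_at k (cell_refs e) (cell_bits s).
Proof.
  intros [H1 H2]. destruct e as [r c]. unfold cell_refs, cell_bits, bits_at, ref_val in *. cbn in *.
  repeat constructor; auto. cbn. now rewrite Nat.add_succ_r.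
Qed.

Lemma qrefs_bits k q :
  (forall j, j < Q -> bit_at k inp (kr k ph + 2 + j) (q =? j)) -> bits_at k qrefs (qbits Q q).
Proof.
  intros H. unfold bits_at, qrefs, qbits. cbn.
  enough (G : forall n a, a + n <= Q -> Forall2 (fun e v => bit_at k inp (ref_val (kr k) e) v)
    (map (fun j => (ph, 2 + j)) (seq a n)) (map (Nat.eqb q) (seq a n))) by (apply (G Q 0); lia).
  induction n as [|n IH]; intros a Ha; cbn; constructor.
  - unfold ref_val. cbn. replace (kr k ph + S (S a)) with (kr k ph + 2 + a) by lia. apply H. lia.
  - apply IH. lia.
Qed.

Lemma bits_at_app k r1 r2 v1 v2 : bits_at k r1 v1 -> bits_at k r2 v2 -> bits_at k (r1 ++ r2) (v1 ++ v2).
Proof. apply Forall2_app. Qed.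

Lemma qrefs_not1 : Forall (fun e => fst e <> 1) qrefs.
Proof. apply Forall_map, Forall_forall. intros j _. cbn. apply Hph. Qed.

Lemma firstn_qbits q rest : firstn Q (qbits Q q ++ rest) = qbits Q q.
Proof.
  assert (E : length (qbits Q q) = Q) by (unfold qbits; now rewrite length_map, length_seq).
  rewrite firstn_app, E, Nat.sub_diag. cbn. rewrite app_nil_r. rewrite <- E at 1. apply firstn_all.
Qed.

Lemma step_cell_correct u L C R k q a l c r :
  counted k -> fst L <> 1 -> fst C <> 1 -> fst R <> 1 -> q < Q ->
  (forall j, j < Q -> bit_at k inp (kr k ph + 2 + j) (q =? j)) ->
  cell_at k inp (kr k ph + (2 + Q)) a ->
  cell_at k inp (ref_val (kr k) L) l ->
  cell_at k inp (ref_val (kr k) C) c ->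
  cell_at k inp (ref_val (kr k) R) r ->
  cell_at (sem (step_cell u L C R) k) inp (kr k 1) (new_sym u q a l c r).
Proof.
  intros Hc HL HC HR Hq Hqb Ha Hl Hcc Hr. unfold step_cell. cbn [ksem]. apply cell_ksem.
  eapply emit_cell_correct; auto.
  - repeat (apply Forall_app; split); try apply qrefs_not1; repeat constructor; cbn; auto; apply Hph.
  - repeat apply bits_at_app; try (apply cell_refs_bits; eassumption).
    apply qrefs_bits. exact Hqb.
  - intros rest. unfold cell_fun, cell_bits. cbn [app nth skipn]. rewrite firstn_qbits, qindex_qbits, !dec_sym by auto. reflexivity.
Qed.

(** The cells at -1, 0 and 1 see the scanned cell as right neighbour, as themselves and as left
    neighbour, hence the codes 3, 2 and 1; code 0 is for the cells that do not see it. *)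
Lemma new_sym_hstep u q R i l c r :
  u = 0 /\ (i <> -1 /\ i <> 0 /\ i <> 1)%Z \/ u = 3 /\ i = (-1)%Z \/ u = 2 /\ i = 0%Z \/ u = 1 /\ i = 1%Z ->
  (u <> 1 -> l = R (i - 1)%Z) -> (u <> 2 -> c = R i) -> (u <> 3 -> r = R (i + 1)%Z) ->
  new_sym u q (R 0%Z) l c r = snd (hstep M (q, R)) i.
Proof.
  intros Hu Hl Hc Hr. unfold new_sym, hstep. destruct (ctrl M q (R 0%Z)) as [[q' w] m]. cbn [snd].
  destruct m; cbn [dir].
  - destruct (Nat.eqb_spec u 1) as [->|Hn]; unfold upd; destruct (Z.eqb_spec (i + -1) 0);
      try lia; auto.
  - destruct (Nat.eqb_spec u 3) as [->|Hn]; unfold upd; destruct (Z.eqb_spec (i + 1) 0);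
      try lia; auto.
  - destruct (Nat.eqb_spec u 2) as [->|Hn]; unfold upd; destruct (Z.eqb_spec (i + 0) 0);
      try lia; auto. rewrite Hc by auto. f_equal. lia.
Qed.

Hypothesis HrW : rW <> 1 /\ rW <> ph /\ rW <> pv.
Hypothesis Hrlen : rlen <> 1 /\ rlen <> ph /\ rlen <> pv.

Section Row.
Variables (base base' t : nat) (hc : hconf).
Hypothesis Ht : t < W.
Hypothesis Hq : fst hc < Q.

(* The first [c] cells of the new row have been emitted; both row pointers are [o] bits into their rows. *)
Record in_row (o c : nat) (k : kst) : Prop := {
  ir_counted : counted k;
  ir_cur : kr k 1 = base' + o;
  ir_pv : kr k pv + 2 = base + o;
  ir_ph : kr k ph = base + 2 * W;
  ir_W : kr k rW = W;
  ir_len : kr k rlen = len;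
  ir_old : row_at k base t hc;
  ir_new : forall i, i < c -> S t <= i -> i + S t < N ->
    cell_at k inp (caddr base' i) (snd (hstep M hc) (Z.of_nat i - Z.of_nat W - 1)%Z) }.

Lemma in_row_a o c k : in_row o c k -> cell_at k inp (kr k ph + (2 + Q)) (snd hc 0%Z).
Proof.
  intros H. destruct (ir_old _ _ _ H) as [_ Hold]. specialize (Hold (S W)).
  rewrite (ir_ph _ _ _ H). unfold caddr in Hold. rewrite (proj2 (Nat.leb_gt (S W) W)) in Hold by lia.
  replace (base + 2 * W + (2 + Q)) with (base + 2 * S W + Q) by lia.
  replace 0%Z with (Z.of_nat (S W) - Z.of_nat W - 1)%Z by lia. apply Hold; unfold N; lia.
Qed.

Lemma in_row_cell o c k i : in_row o c k -> t <= i -> i + t < N ->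
  forall a, a = caddr base i -> cell_at k inp a (snd hc (Z.of_nat i - Z.of_nat W - 1)%Z).
Proof. intros H H1 H2 a ->. destruct (ir_old _ _ _ H) as [_ Hold]. now apply Hold. Qed.

Lemma in_row_step u L C R o c k :
  in_row o c k -> o = 2 * c + (if c <=? W then 0 else Q) ->
  fst L <> 1 -> fst C <> 1 -> fst R <> 1 ->
  (S t <= c -> c + S t < N -> exists l m r,
     cell_at k inp (ref_val (kr k) L) l /\ cell_at k inp (ref_val (kr k) C) m /\
     cell_at k inp (ref_val (kr k) R) r /\
     new_sym u (fst hc) (snd hc 0%Z) l m r = snd (hstep M hc) (Z.of_nat c - Z.of_nat W - 1)%Z) ->
  in_row (o + 2) (S c) (sem (step_cell u L C R) k).
Proof.
  intros H Ho HL HC HR Hex.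
  assert (Hnew : S t <= c -> c + S t < N ->
    cell_at (sem (step_cell u L C R) k) inp (kr k 1) (snd (hstep M hc) (Z.of_nat c - Z.of_nat W - 1)%Z)).
  { intros H1 H2. destruct (Hex H1 H2) as (l & m & r & Hl & Hm & Hr & <-).
    apply step_cell_correct; auto.
    - apply H.
    - intros j Hj. rewrite (ir_ph _ _ _ H). destruct (ir_old _ _ _ H) as [Hold _].
      replace (base + 2 * W + 2 + j) with (base + 2 * (W + 1) + j) by lia. auto.
    - eapply in_row_a; eauto. }
  split.
  - apply ksem_counted; [|apply H]. split; [split; exact I | apply incn_reserved, Hpv].
  - rewrite step_cell_reg. cbn. rewrite (ir_cur _ _ _ H). lia.
  - rewrite step_cell_reg. rewrite eqb_neq_false by apply Hpv. rewrite Nat.eqb_refl.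
    pose proof (ir_pv _ _ _ H). lia.
  - rewrite step_cell_reg, !eqb_neq_false by (auto; apply Hph). apply H.
  - rewrite step_cell_reg, !eqb_neq_false by apply HrW. apply H.
  - rewrite step_cell_reg, !eqb_neq_false by apply Hrlen. apply H.
  - apply row_at_ksem, H.
  - intros i Hi H1 H2. destruct (Nat.eq_dec i c) as [->|].
    + unfold caddr. rewrite <- Nat.add_assoc, <- Ho, <- (ir_cur _ _ _ H). auto.
    + apply cell_ksem. apply (ir_new _ _ _ H); auto. lia.
Qed.

Lemma in_row_generic o c k :
  in_row o c k -> o = 2 * c + (if c <=? W then 0 else Q) ->
  c <> W -> c <> S W -> c <> S (S W) ->
  in_row (o + 2) (S c) (sem generic_cell k).
Proof.
  intros H Ho Hc1 Hc2 Hc3. apply in_row_step; auto; try apply Hpv.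
  intros H1 H2. pose proof (ir_pv _ _ _ H) as Hp. unfold ref_val. cbn [fst snd].
  do 3 eexists. split; [|split; [|split]].
  - apply (in_row_cell _ _ _ (c - 1) H); try lia. unfold caddr.
    destruct (Nat.leb_spec (c - 1) W), (Nat.leb_spec c W); lia.
  - apply (in_row_cell _ _ _ c H); try lia. unfold caddr. lia.
  - apply (in_row_cell _ _ _ (S c) H); try lia. unfold caddr.
    destruct (Nat.leb_spec (S c) W), (Nat.leb_spec c W); lia.
  - destruct hc as [q R]. cbn [fst snd]. apply new_sym_hstep; [left; lia|..];
      intros _; f_equal; lia.
Qed.

Lemma in_row_generics r n o c k :
  kr k r = n -> in_row o c k -> o = 2 * c + (if c <=? W then 0 else Q) ->
  (c + n <= W \/ S (S W) < c) ->
  in_row (o + 2 * n) (c + n) (sem (KFor r generic_cell) k).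
Proof.
  intros Hr H Ho Hcn.
  pose proof (for_inv (fun j k => in_row (o + 2 * j) (c + j) k) r generic_cell k) as HI.
  rewrite Hr in HI. apply HI.
  - now rewrite Nat.mul_0_r, !Nat.add_0_r.
  - intros j k' Hj Hk. replace (o + 2 * S j) with (o + 2 * j + 2) by lia.
    replace (c + S j) with (S (c + j)) by lia.
    apply in_row_generic; auto; try lia.
    destruct (Nat.leb_spec c W), (Nat.leb_spec (c + j) W); lia.
Qed.

Lemma in_row_left k :
  in_row (2 * W) W k -> in_row (2 * W + 2) (S W) (sem (step_cell 3 (pv, 0) (pv, 2) (ph, 2 + Q)) k).
Proof.
  intros H. apply in_row_step; auto; try apply Hpv; try apply Hph.
  { rewrite Nat.leb_refl. lia. }
  intros H1 H2. pose proof (ir_pv _ _ _ H) as Hp. unfold ref_val. cbn [fst snd].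
  do 3 eexists. split; [|split; [|split]].
  - apply (in_row_cell _ _ _ (W - 1) H); try lia. unfold caddr.
    destruct (Nat.leb_spec (W - 1) W); lia.
  - apply (in_row_cell _ _ _ W H); try lia. unfold caddr. rewrite Nat.leb_refl. lia.
  - eapply in_row_a; eauto.
  - destruct hc as [q R]. cbn [fst snd]. apply new_sym_hstep; [right; left; lia|..];
      intros Hu; try lia; f_equal; lia.
Qed.

Lemma in_row_mid k :
  in_row (2 * W + 2 + Q) (S W) k ->
  in_row (2 * W + 2 + Q + 2) (S (S W)) (sem (step_cell 2 (ph, 0) (pv, 2) (pv, 4)) k).
Proof.
  intros H. apply in_row_step; auto; try apply Hpv; try apply Hph.
  { rewrite (proj2 (Nat.leb_gt (S W) W)) by lia. lia. }
  intros H1 H2. pose proof (ir_pv _ _ _ H) as Hp. pose proof (ir_ph _ _ _ H) as Hh.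
  unfold ref_val. cbn [fst snd].
  do 3 eexists. split; [|split; [|split]].
  - apply (in_row_cell _ _ _ W H); try lia. unfold caddr. rewrite Nat.leb_refl. lia.
  - apply (in_row_cell _ _ _ (S W) H); try lia. unfold caddr.
    rewrite (proj2 (Nat.leb_gt (S W) W)); lia.
  - apply (in_row_cell _ _ _ (S (S W)) H); try lia. unfold caddr.
    rewrite (proj2 (Nat.leb_gt (S (S W)) W)); lia.
  - destruct hc as [q R]. cbn [fst snd]. apply new_sym_hstep; [right; right; left; lia|..];
      intros Hu; try lia; f_equal; lia.
Qed.

Lemma in_row_right k :
  in_row (2 * W + 2 + Q + 2) (S (S W)) k ->
  in_row (2 * W + 2 + Q + 4) (S (S (S W))) (sem (step_cell 1 (pv, 0) (pv, 2) (pv, 4)) k).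
Proof.
  intros H. replace (2 * W + 2 + Q + 4) with (2 * W + 2 + Q + 2 + 2) by lia.
  apply in_row_step; auto; try apply Hpv; try apply Hph.
  { rewrite (proj2 (Nat.leb_gt (S (S W)) W)) by lia. lia. }
  intros H1 H2. pose proof (ir_pv _ _ _ H) as Hp.
  unfold ref_val. cbn [fst snd].
  do 3 eexists. split; [|split; [|split]].
  - apply (in_row_cell _ _ _ (S W) H); try lia. unfold caddr.
    rewrite (proj2 (Nat.leb_gt (S W) W)); lia.
  - apply (in_row_cell _ _ _ (S (S W)) H); try lia. unfold caddr.
    rewrite (proj2 (Nat.leb_gt (S (S W)) W)); lia.
  - apply (in_row_cell _ _ _ (S (S (S W))) H); try lia. unfold caddr.
    rewrite (proj2 (Nat.leb_gt (S (S (S W))) W)); lia.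
  - destruct hc as [q R]. cbn [fst snd]. apply new_sym_hstep; [right; right; right; lia|..];
      intros Hu; try lia; f_equal; lia.
Qed.

Lemma emit_state_reg k q :
  kr (sem emit_state k) q =
  if q =? 1 then kr k 1 + Q else if q =? pv then kr k pv + Q else kr k q.
Proof.
  unfold emit_state. cbn [ksem]. rewrite incn_reg, !emit_list_reg, length_map, length_seq.
  rewrite (proj2 (Nat.eqb_neq pv 1)) by apply Hpv.
  destruct (q =? pv) eqn:E; auto. apply Nat.eqb_eq in E. subst q.
  now rewrite (proj2 (Nat.eqb_neq pv 1)) by apply Hpv.
Qed.

Lemma in_row_state k :
  in_row (2 * W + 2) (S W) k ->
  in_row (2 * W + 2 + Q) (S W) (sem emit_state k) /\
  forall j, j < Q -> bit_at (sem emit_state k) inp (base' + 2 * (W + 1) + j) (fst (hstep M hc) =? j).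
Proof.
  intros H. split.
  - split.
    + apply ksem_counted; [|apply H]. cbn. split; [apply emit_list_reserved | apply incn_reserved, Hpv].
    + rewrite emit_state_reg. cbn. rewrite (ir_cur _ _ _ H). lia.
    + rewrite emit_state_reg. rewrite eqb_neq_false by apply Hpv. rewrite Nat.eqb_refl.
      pose proof (ir_pv _ _ _ H). lia.
    + rewrite emit_state_reg, !eqb_neq_false by (auto; apply Hph). apply H.
    + rewrite emit_state_reg, !eqb_neq_false by apply HrW. apply H.
    + rewrite emit_state_reg, !eqb_neq_false by apply Hrlen. apply H.
    + apply row_at_ksem, H.
    + intros i Hi H1 H2. apply cell_ksem. apply (ir_new _ _ _ H); auto.
  - intros j Hj. unfold emit_state. cbn [ksem]. apply bit_ksem.
    replace (base' + 2 * (W + 1) + j) with (kr k 1 + j) by (rewrite (ir_cur _ _ _ H); lia).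
    apply emit_list_correct with (vs := cell_bits (snd hc 0%Z) ++ qbits Q (fst hc))
      (ws := map (fun j => fst (hstep M hc) =? j) (seq 0 Q)).
    + apply H.
    + apply Forall_app. split; [|apply qrefs_not1]. repeat constructor; cbn; apply Hph.
    + apply bits_at_app.
      * apply cell_refs_bits. eapply in_row_a; eauto.
      * apply qrefs_bits. intros i Hi. rewrite (ir_ph _ _ _ H). destruct (ir_old _ _ _ H) as [Hold _].
        replace (base + 2 * W + 2 + i) with (base + 2 * (W + 1) + i) by lia. auto.
    + generalize (seq 0 Q) as l. intros l. induction l as [|i l IH]; cbn [map]; constructor; auto.
      intros rest. unfold state_fun. rewrite <- app_assoc. cbn [cell_bits app skipn nth].
      rewrite firstn_qbits, qindex_qbits, dec_sym by auto.
      destruct hc as [q R]. cbn [hstep fst snd]. now destruct (ctrl M q (R 0%Z)) as [[q' w] m].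
    + rewrite nth_error_map, nth_error_seq. rewrite (proj2 (Nat.ltb_lt j Q) Hj). reflexivity.
Qed.

Hypothesis Hbase : base' = base + row_size.

Lemma emit_row_correct k :
  in_row 0 0 k ->
  let k' := sem emit_row k in
  counted k' /\ kr k' 1 = base' + row_size /\ kr k' pv + 2 = base' /\ kr k' ph = base' + 2 * W /\
  kr k' rW = W /\ kr k' rlen = len /\ row_at k' base' (S t) (hstep M hc).
Proof.
  intros H0. unfold emit_row. cbn zeta. rewrite !ksem_Seq.
  apply (in_row_generics rW W) in H0; [|apply H0|reflexivity|lia].
  change (0 + 2 * W) with (2 * W) in H0. change (0 + W) with W in H0.
  apply in_row_left in H0. apply in_row_state in H0 as [H0 Hst].
  apply in_row_mid in H0. apply in_row_right in H0.
  apply (in_row_generics rlen len) in H0;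
    [|apply H0|rewrite (proj2 (Nat.leb_gt (S (S (S W))) W)) by lia; lia|lia].
  apply (in_row_generics rW W) in H0;
    [|apply H0|rewrite (proj2 (Nat.leb_gt (S (S (S W)) + len) W)) by lia; lia|lia].
  match type of H0 with in_row _ _ ?s => set (ks := s) in * end.
  assert (Hregs : forall q, kr (sem (incn ph (6 + Q)) (sem (KFor rlen (incn ph 2)) (sem (KFor rW (incn ph 4)) ks))) q
     = if q =? ph then kr ks ph + 4 * W + 2 * len + (6 + Q) else kr ks q).
  { intros q. rewrite incn_reg, !for_incn_reg, Nat.eqb_refl.
    rewrite (eqb_neq_false rlen ph) by apply Hrlen. rewrite (ir_W _ _ _ H0), (ir_len _ _ _ H0).
    destruct (q =? ph); lia. }
  split; [|split; [|split; [|split; [|split; [|split]]]]]; rewrite ?Hregs.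
  - apply ksem_counted; [apply incn_reserved, Hph|].
    apply ksem_counted; [cbn; repeat split; apply Hph|].
    apply ksem_counted; [cbn; repeat split; apply Hph|]. apply H0.
  - rewrite eqb_neq_false by (apply not_eq_sym, Hph). rewrite (ir_cur _ _ _ H0).
    unfold row_size, N. lia.
  - rewrite eqb_neq_false by auto. pose proof (ir_pv _ _ _ H0).
    rewrite Hbase. unfold row_size, N. lia.
  - rewrite Nat.eqb_refl, (ir_ph _ _ _ H0), Hbase. unfold row_size, N. lia.
  - rewrite eqb_neq_false by apply HrW. apply H0.
  - rewrite eqb_neq_false by apply Hrlen. apply H0.
  - split.
    + intros j Hj. do 3 apply bit_ksem. unfold ks. do 4 apply bit_ksem. apply Hst. exact Hj.
    + intros c H1 H2. do 3 apply cell_ksem. apply (ir_new _ _ _ H0); auto. unfold N in *. lia.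
Qed.
End Row.

(** * The initial row and the whole simulation *)

(** The first blank cell belongs to no row: it makes room for [pv], which has to start one cell
    before the row. [cont] prints the input, whose first cell is the scanned one; the two blanks
    after it complete the three special cells of a row. *)
Definition sim_init (cont : kcmd) : kcmd :=
  KSeq (KFor 1 (incn pv 1))
  (KSeq (const_cell SB)
  (KSeq (KFor rW (const_cell SB))
  (KSeq (KFor 1 (incn ph 1))
  (KSeq (const_cell SB)
  (KSeq (emit_list (map (fun j _ => tm_start M =? j) (seq 0 Q)) [])
  (KSeq cont
  (KSeq (const_cell SB)
  (KSeq (const_cell SB) (KFor rW (const_cell SB)))))))))).

Section Init.
(** [Pc] is the condition under which [cont] prints [str]. It must survive the rest of the
    initialisation, which increments only register 1, [ph] and [pv]. *)
Variables (cont : kcmd) (str : list bool) (Pc : kst -> Prop).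
Hypothesis Hlen : length str = len.
Hypothesis Hcont_res : reserved_ok cont.
Hypothesis HPc : forall c k, uses K (fun r => r = 1 \/ r = ph \/ r = pv) (fun _ => True) c -> Pc k -> Pc (sem c k).
Hypothesis Hcont : forall k, Pc k -> counted k ->
  kr (sem cont k) 1 = kr k 1 + 2 * len /\
  (forall q, q = ph \/ q = pv \/ q = rW \/ q = rlen -> kr (sem cont k) q = kr k q) /\
  forall i, i < len -> cell_at (sem cont k) inp (kr k 1 + 2 * i) (sym_of_bool (nth i str false)).

Lemma sim_init_correct k :
  counted k -> Pc k -> kr k ph = 0 -> kr k pv = 0 -> kr k rW = W -> kr k rlen = len ->
  let k' := sem (sim_init cont) k in
  let base := kr k 1 + 2 in
  counted k' /\ kr k' 1 = base + row_size /\ kr k' pv + 2 = base /\ kr k' ph = base + 2 * W /\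
  kr k' rW = W /\ kr k' rlen = len /\ row_at k' base 0 (hinit M str).
Proof.
  intros Hc HP Hph0 Hpv0 HW Hln. unfold sim_init. cbn zeta. rewrite !ksem_Seq.
  set (k1 := sem (KFor 1 (incn pv 1)) k).
  assert (C1 : counted k1) by (apply ksem_counted; auto; cbn; repeat split; apply Hpv).
  assert (P1 : Pc k1) by (apply HPc; auto; apply for_incn_uses; auto; apply Hpv).
  assert (R1 : forall q, kr k1 q = if q =? pv then kr k 1 else kr k q).
  { intros q. unfold k1. rewrite for_incn_reg, Hpv0. destruct (q =? pv); lia. }
  set (k2 := sem (const_cell SB) k1).
  assert (C2 : counted k2) by (apply ksem_counted; auto; split; exact I).
  assert (P2 : Pc k2) by (apply HPc; auto; apply const_cell_uses; auto).
  assert (R2 : forall q, kr k2 q = if q =? 1 then kr k 1 + 2 else kr k1 q).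
  { intros q. unfold k2, const_cell. rewrite emit_cell_reg, (R1 1), (eqb_neq_false 1 pv); auto.
    apply not_eq_sym, Hpv. }
  destruct (const_cells rW SB W k2) as (C3 & R3 & B3); auto; [apply HrW| |].
  { rewrite R2, R1, !eqb_neq_false by apply HrW. exact HW. }
  set (k3 := sem (KFor rW (const_cell SB)) k2) in *.
  assert (P3 : Pc k3) by (apply HPc; auto; apply for_const_cell_uses; auto).
  rewrite (R2 1) in R3, B3. cbn [Nat.eqb] in R3, B3.
  set (k4 := sem (KFor 1 (incn ph 1)) k3).
  assert (C4 : counted k4) by (apply ksem_counted; auto; cbn; repeat split; apply Hph).
  assert (P4 : Pc k4) by (apply HPc; auto; apply for_incn_uses; auto; apply Hph).
  assert (R4 : forall q, kr k4 q = if q =? ph then kr k 1 + 2 + 2 * W else kr k3 q).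
  { intros q. unfold k4. rewrite for_incn_reg. rewrite (R3 ph), (R2 ph), (R1 ph).
    rewrite !(eqb_neq_false ph) by (auto; apply Hph). rewrite Hph0, (R3 1). cbn [Nat.eqb].
    destruct (q =? ph); lia. }
  set (k5 := sem (const_cell SB) k4).
  assert (C5 : counted k5) by (apply ksem_counted; auto; split; exact I).
  assert (P5 : Pc k5) by (apply HPc; auto; apply const_cell_uses; auto).
  assert (E4 : kr k4 1 = kr k 1 + 2 + 2 * W).
  { rewrite R4, eqb_neq_false by apply not_eq_sym, Hph. now rewrite R3. }
  assert (R5 : forall q, kr k5 q = if q =? 1 then kr k 1 + 2 + 2 * W + 2 else kr k4 q).
  { intros q. unfold k5, const_cell. rewrite emit_cell_reg, E4. auto. }
  assert (B5 := const_cell_correct SB k4 C4). fold k5 in B5. rewrite E4 in B5.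
  set (k6 := sem (emit_list (map (fun j _ => tm_start M =? j) (seq 0 Q)) []) k5).
  assert (C6 : counted k6) by (apply ksem_counted; auto; apply emit_list_reserved).
  assert (P6 : Pc k6).
  { apply HPc; auto. apply emit_list_uses; cbn; auto; lia. }
  assert (R6 : forall q, kr k6 q = if q =? 1 then kr k 1 + 2 + 2 * W + 2 + Q else kr k5 q).
  { intros q. unfold k6. rewrite emit_list_reg, length_map, length_seq, (R5 1). auto. }
  assert (B6 : forall j, j < Q -> bit_at k6 inp (kr k 1 + 2 + 2 * (W + 1) + j) (tm_start M =? j)).
  { intros j Hj. replace (kr k 1 + 2 + 2 * (W + 1) + j) with (kr k5 1 + j) by (rewrite R5; cbn [Nat.eqb]; lia).
    unfold k6. rewrite <- (map_map (fun j => tm_start M =? j) (fun b (_ : list bool) => b)).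
    apply emit_list_consts_bits; auto.
    rewrite nth_error_map, nth_error_seq. rewrite (proj2 (Nat.ltb_lt j Q) Hj). reflexivity. }
  destruct (Hcont k6 P6 C6) as (E7 & R7 & B7).
  set (k7 := sem cont k6) in *. rewrite (R6 1) in E7, B7. cbn [Nat.eqb] in E7, B7.
  assert (C7 : counted k7) by (apply ksem_counted; auto).
  set (k8 := sem (const_cell SB) k7).
  assert (C8 : counted k8) by (apply ksem_counted; auto; split; exact I).
  assert (B8 := const_cell_correct SB k7 C7). fold k8 in B8. rewrite E7 in B8.
  assert (R8 : forall q, kr k8 q = if q =? 1 then kr k7 1 + 2 else kr k7 q) by apply emit_cell_reg.
  set (k9 := sem (const_cell SB) k8).
  assert (C9 : counted k9) by (apply ksem_counted; auto; split; exact I).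
  assert (B9 := const_cell_correct SB k8 C8). fold k9 in B9. rewrite (R8 1), E7 in B9.
  cbn [Nat.eqb] in B9.
  assert (R9 : forall q, kr k9 q = if q =? 1 then kr k7 1 + 4 else kr k7 q).
  { intros q. unfold k9, const_cell. rewrite emit_cell_reg, (R8 q), (R8 1). cbn [Nat.eqb].
    destruct (q =? 1); lia. }
  assert (RR : forall q, q = ph \/ q = pv \/ q = rW \/ q = rlen ->
    kr k9 q = if q =? ph then kr k 1 + 2 + 2 * W else if q =? pv then kr k 1 else kr k q).
  { intros q Hq. assert (Hq1 : q <> 1).
    { destruct Hq as [-> | [-> | [-> | ->]]]; [apply Hph|apply Hpv|apply HrW|apply Hrlen]. }
    rewrite R9, (R7 q Hq), R6, R5, R4, R3, R2, R1, !(eqb_neq_false q 1) by auto. reflexivity. }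
  destruct (const_cells rW SB W k9) as (C10 & R10 & B10); auto; [apply HrW| |].
  { rewrite RR, !eqb_neq_false by (auto; apply HrW). exact HW. }
  set (k10 := sem (KFor rW (const_cell SB)) k9) in *.
  rewrite (R9 1) in R10, B10. cbn [Nat.eqb] in R10, B10. rewrite E7 in R10, B10.
  split; [exact C10|]. split; [rewrite R10; cbn [Nat.eqb]; unfold row_size, N; lia|].
  split; [rewrite R10, RR, !eqb_neq_false, Nat.eqb_refl by (auto; apply Hpv); lia|].
  split; [rewrite R10, RR, Nat.eqb_refl, eqb_neq_false by (auto; apply Hph); lia|].
  split; [rewrite R10, RR, !eqb_neq_false by (auto; apply HrW); exact HW|].
  split; [rewrite R10, RR, !eqb_neq_false by (auto; apply Hrlen); exact Hln|].
  split.
  - intros j Hj. cbn [hinit fst]. unfold k10, k9, k8, k7. do 4 apply bit_ksem. now apply B6.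
  - intros c _ Hcn. rewrite Nat.add_0_r in Hcn. cbn [hinit snd]. unfold caddr.
    destruct (Nat.leb_spec c W) as [HcW|HcW].
    + assert (HSB : tape_of_input str (Z.of_nat c - Z.of_nat W - 1 + 1)%Z = SB).
      { unfold tape_of_input. destruct (Z.ltb_spec (Z.of_nat c - Z.of_nat W - 1 + 1) 1); auto. lia. }
      rewrite HSB, Nat.add_0_r. unfold k10, k9, k8, k7, k6. do 5 apply cell_ksem.
      destruct (Nat.eq_dec c W) as [->|]; [exact B5|]. unfold k5, k4. do 2 apply cell_ksem. apply B3. lia.
    + unfold tape_of_input. destruct (Z.ltb_spec (Z.of_nat c - Z.of_nat W - 1 + 1) 1); try lia.
      replace (Z.to_nat (Z.of_nat c - Z.of_nat W - 1 + 1 - 1)) with (c - S W) by lia.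
      destruct (Nat.lt_ge_cases (c - S W) len) as [Hl|Hl].
      * rewrite nth_indep with (d' := sym_of_bool false) by (rewrite length_map; lia).
        rewrite map_nth. unfold k10, k9, k8. do 3 apply cell_ksem.
        replace (kr k 1 + 2 + 2 * c + Q) with (kr k 1 + 2 + 2 * W + 2 + Q + 2 * (c - S W)) by lia.
        now apply B7.
      * rewrite nth_syms_ge by lia.
        destruct (Nat.eq_dec (c - S W) len).
        { unfold k10, k9. do 2 apply cell_ksem.
          replace (kr k 1 + 2 + 2 * c + Q) with (kr k 1 + 2 + 2 * W + 2 + Q + 2 * len) by lia. exact B8. }
        destruct (Nat.eq_dec (c - S W) (S len)).
        { unfold k10. apply cell_ksem.
          replace (kr k 1 + 2 + 2 * c + Q) with (kr k 1 + 2 + 2 * W + 2 + Q + 2 * len + 2) by lia. exact B9. }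
        replace (kr k 1 + 2 + 2 * c + Q)
          with (kr k 1 + 2 + 2 * W + 2 + Q + 2 * len + 4 + 2 * (c - S W - S (S len))) by lia.
        apply B10. unfold N in Hcn. lia.
Qed.

Variables (rT T : nat).
(** Each step may spoil one more cell at either end; this keeps the scanned cell clear of the damage
    throughout the run. *)
Hypothesis HTW : T <= W.
Hypothesis HrT : rT <> 1 /\ rT <> ph /\ rT <> pv.

Definition sim : kcmd := KSeq (sim_init cont) (KFor rT emit_row).

Lemma sim_correct k :
  counted k -> Pc k -> kr k ph = 0 -> kr k pv = 0 -> kr k rW = W -> kr k rlen = len ->
  kr (sem (sim_init cont) k) rT = T ->
  let k' := sem sim k in
  forall i, i + T < len + 2 + W ->
    cell_at k' inp (kr k' ph + (2 + Q) + 2 * i) (snd (hrun M T (hinit M str)) (Z.of_nat i)).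
Proof.
  intros Hc HP Hph0 Hpv0 HW Hln HT. cbn zeta. unfold sim. rewrite ksem_Seq.
  destruct (sim_init_correct k) as (C & E1 & Epv & Eph & EW & Eln & Hrow); auto.
  set (ki := sem (sim_init cont) k) in *. set (base := kr k 1 + 2) in *.
  pose proof (for_inv (fun j k' => counted k' /\ kr k' 1 = base + j * row_size + row_size /\
    kr k' pv + 2 = base + j * row_size /\ kr k' ph = base + j * row_size + 2 * W /\
    kr k' rW = W /\ kr k' rlen = len /\ row_at k' (base + j * row_size) j (hrun M j (hinit M str)))
    rT emit_row ki) as H.
  rewrite HT in H.
  destruct H as (_ & _ & _ & Hph' & _ & _ & _ & Hcells).
  - rewrite Nat.mul_0_l, !Nat.add_0_r. repeat (split; [assumption|]). assumption.
  - intros j k' Hj (Cj & Ej & Epvj & Ephj & EWj & Elnj & Hrowj).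
    assert (Hq : fst (hrun M j (hinit M str)) < Q) by (apply hrun_state; apply tm_start_ok).
    replace (base + S j * row_size) with (base + j * row_size + row_size) by lia.
    rewrite hrun_S. rewrite <- Ej at 1 2 3 4.
    apply (emit_row_correct (base + j * row_size) _ j (hrun M j (hinit M str))); auto; try lia.
    split; auto; try lia; intros; lia.
  - intros i Hi. specialize (Hcells (S W + i)).
    rewrite Hph'. unfold caddr in Hcells. rewrite (proj2 (Nat.leb_gt (S W + i) W)) in Hcells by lia.
    replace (base + T * row_size + 2 * W + (2 + Q) + 2 * i)
      with (base + T * row_size + 2 * (S W + i) + Q) by lia.
    replace (Z.of_nat i) with (Z.of_nat (S W + i) - Z.of_nat W - 1)%Z by lia.
    apply Hcells; unfold N; lia.
Qed.
End Init.
End Sim.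

(** * Scanning arrays of bits *)

Fixpoint bval (f : nat -> bool) (n : nat) : nat :=
  match n with
  | 0 => 0
  | S n => bval f n + (if f n then 2 ^ n else 0)
  end.

Lemma bval_lt f n : bval f n < 2 ^ n.
Proof. induction n; cbn; [lia|]. destruct (f n); lia. Qed.

(** The top bit decides unless the two agree, so numbers can be compared from the least significant
    bit upwards with one bit of state. *)
Lemma bval_le_step f g n :
  (bval f (S n) <=? bval g (S n)) = if eqb (f n) (g n) then bval f n <=? bval g n else g n.
Proof.
  cbn. pose proof (bval_lt f n). pose proof (bval_lt g n).
  destruct (f n), (g n); cbn [eqb];
    destruct (Nat.leb_spec (bval f n) (bval g n));
    match goal with |- (?a <=? ?b) = _ => destruct (Nat.leb_spec a b) end; auto; lia.
Qed.

Lemma bval_cons f n : bval f (S n) = (if f 0 then 1 else 0) + 2 * bval (fun i => f (S i)) n.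
Proof.
  induction n; [cbn; lia|]. cbn [bval] in *. rewrite IHn. cbn [Nat.pow].
  destruct (f (S n)), (f 0); lia.
Qed.

Lemma bin_val_bval l n : length l <= n -> bin_val l = bval (fun i => nth i l false) n.
Proof.
  revert n; induction l as [|b l IH]; intros n Hn.
  - cbn. clear Hn. induction n; cbn; auto. rewrite <- IHn. now destruct n.
  - destruct n as [|n]; cbn in Hn; [lia|]. rewrite bval_cons. cbn [nth bin_val].
    rewrite (IH n) by lia. reflexivity.
Qed.

Ltac eqb_simp := repeat (rewrite !Nat.eqb_refl ||
  match goal with |- context [?a =? ?b] => rewrite (eqb_neq_false a b) by lia end).

Section Emission.
Variables (K : nat) (x inp : list bool).
Local Notation sem := (ksem K x).
Local Notation bit_at k := (bit_at k inp).
Local Notation cell_at k := (cell_at k inp).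

Lemma frame L c k r : uses K (fun r => In r L) (fun _ => True) c -> ~ In r L -> kr (sem c k) r = kr k r.
Proof. apply (ksem_frame K (fun r => In r L) (fun _ => True)). Qed.

Definition emits (k k' : kst) (l : list sym) : Prop :=
  counted k' /\ kr k' 1 = kr k 1 + 2 * length l /\
  forall i, i < length l -> cell_at k' (kr k 1 + 2 * i) (nth i l SB).

Lemma emits_nil k : counted k -> emits k k [].
Proof. intros H. repeat split; auto; try apply H; cbn in *; lia. Qed.

Lemma emits_app c k k1 l1 l2 : emits k k1 l1 -> emits k1 (sem c k1) l2 -> emits k (sem c k1) (l1 ++ l2).
Proof.
  intros (C1 & E1 & B1) (C2 & E2 & B2). split; [exact C2|]. rewrite length_app. split; [lia|].
  intros i Hi. destruct (Nat.lt_ge_cases i (length l1)).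
  - rewrite app_nth1 by auto. apply cell_ksem. auto.
  - rewrite app_nth2 by auto. replace (kr k 1 + 2 * i) with (kr k1 1 + 2 * (i - length l1)) by lia.
    apply B2. lia.
Qed.

Lemma emits_const s k : counted k -> emits k (sem (const_cell s) k) [s].
Proof.
  intros H. split; [|split].
  - apply ksem_counted; auto. split; exact I.
  - unfold const_cell. rewrite emit_cell_reg. cbn. lia.
  - intros i Hi. cbn in Hi. replace i with 0 by lia. rewrite Nat.mul_0_r, Nat.add_0_r.
    now apply const_cell_correct.
Qed.

Lemma emits_forin c0 c1 F k :
  (forall (b : bool) k, counted k -> emits k (sem (if b then c1 else c0) k) (F b)) ->
  counted k -> emits k (sem (KForIn c0 c1) k) (flat_map F x).
Proof.
  intros HF Hc. cbn.
  enough (G : forall l k, counted k ->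
    emits k (fold_left (fun s (b : bool) => if b then sem c1 s else sem c0 s) l k) (flat_map F l))
    by now apply G.
  clear k Hc. induction l as [|b l IH] using rev_ind; intros k Hc.
  - now apply emits_nil.
  - rewrite fold_left_app, flat_map_app. cbn. rewrite app_nil_r.
    specialize (IH k Hc). set (k1 := fold_left _ l k) in *.
    pose proof (HF b k1 (proj1 IH)) as H1.
    destruct b; eapply emits_app; eauto.
Qed.

(* The characters of [pair_enc x w], where the bits of [w] are wide gates starting at the value of register [ptr]. *)
Definition pair_cells (ptr rp : nat) : kcmd :=
  KSeq (KForIn (KSeq (const_cell S0) (const_cell S0)) (KSeq (const_cell S1) (const_cell S1)))
  (KSeq (const_cell S0)
  (KSeq (const_cell S1)
        (KFor rp (KSeq (emit_cell (fun l => sym_of_bool (nth 0 l false)) [(ptr, 0)]) (incn ptr 1))))).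

Definition input_cells : kcmd := KForIn (const_cell S0) (const_cell S1).

Lemma input_cells_correct k : counted k -> emits k (sem input_cells k) (map sym_of_bool x).
Proof.
  intros Hc. replace (map sym_of_bool x) with (flat_map (fun b => [sym_of_bool b]) x).
  - apply emits_forin; auto. intros [] k' Hk; now apply emits_const.
  - clear. induction x; cbn; congruence.
Qed.

Lemma input_cells_uses (I B : nat -> Prop) : I 1 -> uses K I B input_cells.
Proof. intros H. split; now apply const_cell_uses. Qed.

Lemma pair_cells_uses (I B : nat -> Prop) ptr rp :
  I 1 -> I ptr -> 2 < ptr -> B rp -> 1 <= K -> uses K I B (pair_cells ptr rp).
Proof.
  intros H1 H2 H3 H4 H5. cbn -[incn]. repeat split; auto; try lia.
Qed.

Lemma pair_cells_correct ptr rp a w k :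
  2 < ptr -> rp <> 1 -> rp <> ptr -> 1 <= K ->
  counted k -> kr k ptr = a -> kr k rp = length w ->
  (forall i, i < length w -> bit_at k (a + i) (nth i w false)) ->
  emits k (sem (pair_cells ptr rp) k) (map sym_of_bool (pair_enc x w)).
Proof.
  intros Hptr Hrp1 Hrp2 HK Hc Ha Hp Hw. unfold pair_cells, pair_enc. rewrite !ksem_Seq.
  set (k1 := sem (KForIn _ _) k).
  assert (H1 : emits k k1 (map sym_of_bool (flat_map (fun b => [b; b]) x))).
  { replace (map sym_of_bool (flat_map (fun b => [b; b]) x))
      with (flat_map (fun b => [sym_of_bool b; sym_of_bool b]) x)
      by (clear; induction x as [|b l IH]; cbn; congruence).
    apply emits_forin; auto.
    intros [] k' Hk; rewrite ksem_Seq;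
      (eapply (emits_app _ _ _ [_] [_]); [now apply emits_const|]; apply emits_const;
       apply ksem_counted; auto; split; exact I). }
  rewrite map_app.
  assert (H2 : emits k (sem (const_cell S0) k1) (map sym_of_bool (flat_map (fun b => [b; b]) x) ++ [S0])).
  { eapply emits_app; eauto. apply emits_const. apply H1. }
  set (k2 := sem (const_cell S0) k1) in *.
  assert (H3 : emits k (sem (const_cell S1) k2) ((map sym_of_bool (flat_map (fun b => [b; b]) x) ++ [S0]) ++ [S1])).
  { eapply emits_app; eauto. apply emits_const. apply H2. }
  set (k3 := sem (const_cell S1) k2) in *.
  replace (map sym_of_bool (flat_map (fun b => [b; b]) x) ++ map sym_of_bool ([false; true] ++ w))
    with (((map sym_of_bool (flat_map (fun b => [b; b]) x) ++ [S0]) ++ [S1]) ++ map sym_of_bool w)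
    by (now rewrite <- !app_assoc).
  apply emits_app with (k1 := k3); auto.
  assert (R3 : forall q, q <> 1 -> kr k3 q = kr k q).
  { intros q Hq. unfold k3, k2, k1.
    rewrite !(frame [1]) by (try (intros [E|[]]; congruence); cbn; repeat split; auto; lia). reflexivity. }
  set (body := KSeq (emit_cell (fun l => sym_of_bool (nth 0 l false)) [(ptr, 0)]) (incn ptr 1)).
  pose proof (for_inv K x (fun j k' => emits k3 k' (map sym_of_bool (firstn j w)) /\ kr k' ptr = a + j /\
    (forall i, i < length w -> bit_at k' (a + i) (nth i w false))) rp body k3) as H.
  rewrite (R3 rp) in H by auto. rewrite Hp in H.
  destruct H as (H & _).
  - split; [apply emits_nil, H3|]. split; [rewrite R3 by lia; lia|]. intros i Hi.
    unfold k3, k2, k1. do 3 apply bit_ksem. auto.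
  - intros j k' Hj (He & Hr & Hb). unfold body. rewrite ksem_Seq.
    assert (Hcell := emit_cell_correct K x inp (fun l => sym_of_bool (nth 0 l false)) [(ptr, 0)] k' [nth j w false]
      (sym_of_bool (nth j w false)) (proj1 He)).
    specialize (Hcell ltac:(repeat constructor; cbn; lia)).
    specialize (Hcell ltac:(repeat constructor; unfold ref_val; cbn; rewrite Nat.add_0_r, Hr; auto)).
    specialize (Hcell ltac:(reflexivity)).
    split; [|split].
    + rewrite firstn_S_nth, map_app by auto.
      match goal with |- emits _ ?a _ => change a with (sem body k') end.
      apply emits_app with (k1 := k'); auto. split; [|split].
      * apply ksem_counted; [|apply He]. cbn. repeat split; auto.
      * unfold body. rewrite ksem_Seq, incn_reg, eqb_neq_false, emit_cell_reg by lia. cbn. lia.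
      * intros i Hi. cbn in Hi. replace i with 0 by lia. rewrite Nat.mul_0_r, Nat.add_0_r.
        unfold body. rewrite ksem_Seq. apply cell_ksem. exact Hcell.
    + rewrite incn_reg, Nat.eqb_refl, emit_cell_reg, eqb_neq_false by lia. lia.
    + intros i Hi. do 2 apply bit_ksem. auto.
  - unfold emits in *. rewrite firstn_all in H. exact H.
Qed.

Lemma emit_bit_det phi refs k vs b :
  counted k -> bits_at inp k refs vs -> (forall rest, phi (vs ++ rest) = b) ->
  bit_at (sem (KEmit phi refs) k) (kr k 1) b.
Proof.
  intros Hc H E. destruct (emit_bit K x inp phi refs k vs Hc H) as [rest Hr]. now rewrite E in Hr.
Qed.

Lemma emit_reg phi refs k q : kr (sem (KEmit phi refs) k) q = if q =? 1 then S (kr k 1) else kr k q.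
Proof. cbn. unfold kset. now destruct (q =? 1). Qed.

Lemma emit_counted phi refs k : counted k -> counted (sem (KEmit phi refs) k).
Proof. intros H. apply ksem_counted; auto. exact I. Qed.

Lemma incn_counted r n k : 2 < r -> counted k -> counted (sem (incn r n) k).
Proof. intros H. apply ksem_counted. now apply incn_reserved. Qed.

(** Pointers start at 0, so adding register 1 makes [r] the index of the next gate. *)
Definition copy_cur (r : nat) : kcmd := KFor 1 (incn r 1).

Lemma copy_cur_reg r k q : kr k r = 0 -> kr (sem (copy_cur r) k) q = if q =? r then kr k 1 else kr k q.
Proof. intros H. unfold copy_cur. rewrite for_incn_reg, H. destruct (q =? r); lia. Qed.

Lemma copy_cur_counted r k : 2 < r -> counted k -> counted (sem (copy_cur r) k).
Proof. intros H. apply ksem_counted. cbn. auto. Qed.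

Lemma bits_cons k r c refs v vs :
  bit_at k (kr k r + c) v -> bits_at inp k refs vs -> bits_at inp k ((r, c) :: refs) (v :: vs).
Proof. intros H1 H2. constructor; auto. Qed.

Lemma bits_nil k : bits_at inp k [] [].
Proof. constructor. Qed.

Definition zero_body (pz pw : nat) : kcmd :=
  KSeq (KEmit (fun l => nth 0 l false && negb (nth 1 l false)) [(pz, 0); (pw, 0)])
       (KSeq (incn pz 1) (incn pw 1)).

(** [pz] stays one behind register 1 and so always denotes the latest partial conjunction, the first
    one being the constant true. *)
Definition zero_prog (pz pw rd : nat) : kcmd :=
  KSeq (copy_cur pz) (KSeq (KEmit (fun _ => true) []) (KFor rd (zero_body pz pw))).

Lemma zero_prog_correct pz pw rd a w k :
  2 < pz -> 2 < pw -> pz <> pw -> rd <> 1 -> rd <> pz -> rd <> pw ->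
  counted k -> kr k pz = 0 -> kr k pw = a -> kr k rd = length w ->
  (forall i, i < length w -> bit_at k (a + i) (nth i w false)) ->
  bit_at (sem (zero_prog pz pw rd) k) (kr (sem (zero_prog pz pw rd) k) pz) (forallb negb w).
Proof.
  intros H1 H2 H3 H4 H5 H6 Hc Hz Ha Hd Hw. unfold zero_prog. rewrite !ksem_Seq.
  set (k1 := sem (copy_cur pz) k).
  assert (C1 : counted k1) by (apply copy_cur_counted; auto).
  assert (R1 : forall q, kr k1 q = if q =? pz then kr k 1 else kr k q) by (intros; now apply copy_cur_reg).
  set (k2 := sem (KEmit (fun _ => true) []) k1).
  assert (C2 : counted k2) by (now apply emit_counted).
  assert (R2 : forall q, kr k2 q = if q =? 1 then S (kr k 1) else if q =? pz then kr k 1 else kr k q).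
  { intros q. unfold k2. rewrite emit_reg, (R1 1), R1, (eqb_neq_false 1 pz) by lia. reflexivity. }
  assert (B2 : bit_at k2 (kr k2 pz) true).
  { rewrite R2, Nat.eqb_refl, eqb_neq_false by lia.
    replace (kr k 1) with (kr k1 1) by (rewrite R1, eqb_neq_false; lia).
    now apply emit_bit_det with (vs := []); [|apply bits_nil|]. }
  pose proof (for_inv K x (fun j k' => counted k' /\ kr k' 1 = S (kr k' pz) /\ kr k' pw = a + j /\
    (forall i, i < length w -> bit_at k' (a + i) (nth i w false)) /\
    bit_at k' (kr k' pz) (forallb negb (firstn j w))) rd (zero_body pz pw) k2) as H.
  rewrite R2, !eqb_neq_false, Hd in H by auto.
  destruct H as (_ & _ & _ & _ & H).
  - repeat split; auto; try apply C2.
    + rewrite !R2. eqb_simp. reflexivity.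
    + rewrite R2, !eqb_neq_false by lia. lia.
    + intros i Hi. unfold k2, k1. do 2 apply bit_ksem. auto.
  - intros j k' Hj (C & Ecur & Ew & Hwb & Hb). unfold zero_body. rewrite !ksem_Seq.
    set (k3 := sem (KEmit _ _) k').
    assert (R3 : forall q, kr k3 q = if q =? 1 then S (kr k' 1) else kr k' q) by (intros; apply emit_reg).
    assert (Rf : forall q, kr (sem (incn pw 1) (sem (incn pz 1) k3)) q =
      if q =? pw then a + S j else if q =? pz then S (kr k' pz) else kr k3 q).
    { intros q. rewrite !incn_reg, !R3, !(eqb_neq_false pw), !(eqb_neq_false pz) by lia.
      rewrite Ew. destruct (q =? pw), (q =? pz); lia. }
    split; [|split; [|split; [|split]]].
    + apply incn_counted; auto. apply incn_counted; auto. now apply emit_counted.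
    + rewrite !Rf, R3. eqb_simp. lia.
    + rewrite Rf. eqb_simp. reflexivity.
    + intros i Hi. unfold k3. do 3 apply bit_ksem. auto.
    + rewrite Rf. eqb_simp. rewrite <- Ecur.
      do 2 apply bit_ksem. unfold k3.
      apply emit_bit_det with (vs := [forallb negb (firstn j w); nth j w false]); auto.
      * repeat apply bits_cons; try apply bits_nil; rewrite Nat.add_0_r; auto. rewrite Ew. auto.
      * intros rest. rewrite firstn_S_nth, forallb_app by auto. cbn. now rewrite andb_true_r.
  - now rewrite firstn_all in H.
Qed.

Definition le_fun (l : list bool) : bool :=
  if eqb (nth 1 l false) (nth 2 l false) then nth 0 l false else nth 2 l false.

Definition le_body (pl py pz : nat) : kcmd :=
  KSeq (KEmit le_fun [(pl, 0); (py, 0); (pz, 0)])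
       (KSeq (incn pl 1) (KSeq (incn py 1) (incn pz 1))).

Definition le_prog (pl py pz rn : nat) : kcmd :=
  KSeq (copy_cur pl) (KSeq (KEmit (fun _ => true) []) (KFor rn (le_body pl py pz))).

Lemma le_prog_correct pl py pz rn n a b f g k :
  2 < pl -> 2 < py -> 2 < pz -> pl <> py -> pl <> pz -> py <> pz ->
  rn <> 1 -> rn <> pl -> rn <> py -> rn <> pz ->
  counted k -> kr k pl = 0 -> kr k py = a -> kr k pz = b -> kr k rn = n ->
  (forall i, i < n -> bit_at k (a + i) (f i)) ->
  (forall i, i < n -> bit_at k (b + i) (g i)) ->
  bit_at (sem (le_prog pl py pz rn) k) (kr (sem (le_prog pl py pz rn) k) pl) (bval f n <=? bval g n).
Proof.
  intros H1 H2 H3 H4 H5 H6 H7 H8 H9 H10 Hc Hl Ha Hb Hn Hf Hg. unfold le_prog. rewrite !ksem_Seq.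
  set (k1 := sem (copy_cur pl) k).
  assert (C1 : counted k1) by (apply copy_cur_counted; auto).
  assert (R1 : forall q, kr k1 q = if q =? pl then kr k 1 else kr k q) by (intros; now apply copy_cur_reg).
  set (k2 := sem (KEmit (fun _ => true) []) k1).
  assert (C2 : counted k2) by (now apply emit_counted).
  assert (R2 : forall q, kr k2 q = if q =? 1 then S (kr k 1) else if q =? pl then kr k 1 else kr k q).
  { intros q. unfold k2. rewrite emit_reg, (R1 1), R1, (eqb_neq_false 1 pl) by lia. reflexivity. }
  assert (B2 : bit_at k2 (kr k2 pl) true).
  { rewrite R2, Nat.eqb_refl, eqb_neq_false by lia.
    replace (kr k 1) with (kr k1 1) by (rewrite R1, eqb_neq_false; lia).
    now apply emit_bit_det with (vs := []); [|apply bits_nil|]. }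
  pose proof (for_inv K x (fun j k' => counted k' /\ kr k' 1 = S (kr k' pl) /\ kr k' py = a + j /\
    kr k' pz = b + j /\
    (forall i, i < n -> bit_at k' (a + i) (f i)) /\ (forall i, i < n -> bit_at k' (b + i) (g i)) /\
    bit_at k' (kr k' pl) (bval f j <=? bval g j)) rn (le_body pl py pz) k2) as H.
  rewrite R2, !eqb_neq_false, Hn in H by auto.
  destruct H as (_ & _ & _ & _ & _ & _ & H).
  - repeat split; auto; try apply C2.
    + rewrite !R2. eqb_simp. reflexivity.
    + rewrite R2, !eqb_neq_false by lia. lia.
    + rewrite R2, !eqb_neq_false by lia. lia.
    + intros i Hi. unfold k2, k1. do 2 apply bit_ksem. auto.
    + intros i Hi. unfold k2, k1. do 2 apply bit_ksem. auto.
  - intros j k' Hj (C & Ecur & Ey & Ez & Hfb & Hgb & Hle). unfold le_body. rewrite !ksem_Seq.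
    set (k3 := sem (KEmit _ _) k').
    assert (R3 : forall q, kr k3 q = if q =? 1 then S (kr k' 1) else kr k' q) by (intros; apply emit_reg).
    assert (Rf : forall q, kr (sem (incn pz 1) (sem (incn py 1) (sem (incn pl 1) k3))) q =
      if q =? pz then b + S j else if q =? py then a + S j else if q =? pl then S (kr k' pl) else kr k3 q).
    { intros q. rewrite !incn_reg, !R3, !(eqb_neq_false pz), !(eqb_neq_false py), !(eqb_neq_false pl) by lia.
      rewrite Ey, Ez. destruct (q =? pz), (q =? py), (q =? pl); lia. }
    split; [|split; [|split; [|split; [|split; [|split]]]]].
    + do 3 (apply incn_counted; auto). now apply emit_counted.
    + rewrite !Rf, R3. eqb_simp. lia.
    + rewrite Rf. eqb_simp. reflexivity.
    + rewrite Rf. eqb_simp. reflexivity.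
    + intros i Hi. unfold k3. do 4 apply bit_ksem. auto.
    + intros i Hi. unfold k3. do 4 apply bit_ksem. auto.
    + rewrite Rf. eqb_simp. rewrite <- Ecur.
      do 3 apply bit_ksem. unfold k3.
      apply emit_bit_det with (vs := [bval f j <=? bval g j; f j; g j]); auto.
      * repeat apply bits_cons; try apply bits_nil; rewrite Nat.add_0_r, ?Ey, ?Ez; auto.
      * intros rest. rewrite bval_le_step. reflexivity.
  - exact H.
Qed.

(* The state is a pair of bits: no blank cell has been met, and the number read so far is at most the
   number formed by the bits of [w] read so far. *)
Definition ge_fun (l : list bool) : bool :=
  let h := nth 0 l false && nth 2 l false && nth 3 l false in
  if eqb h (nth 4 l false) then nth 1 l false else nth 4 l false.

Definition ge_body (pc ph o pw : nat) : kcmd :=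
  KSeq (KEmit (fun l => nth 0 l false && nth 2 l false) [(pc, 0); (pc, 1); (ph, o); (ph, S o); (pw, 0)])
  (KSeq (KEmit ge_fun [(pc, 0); (pc, 1); (ph, o); (ph, S o); (pw, 0)])
  (KSeq (incn pc 2) (KSeq (incn ph 2) (incn pw 1)))).

Definition ge_prog (pc ph o pw rm : nat) : kcmd :=
  KSeq (copy_cur pc)
  (KSeq (KEmit (fun _ => true) []) (KSeq (KEmit (fun _ => true) []) (KFor rm (ge_body pc ph o pw)))).

Lemma ge_prog_correct pc ph o pw rm m a b y s g k :
  2 < pc -> 2 < ph -> 2 < pw -> pc <> ph -> pc <> pw -> ph <> pw ->
  rm <> 1 -> rm <> pc -> rm <> ph -> rm <> pw ->
  counted k -> kr k pc = 0 -> kr k ph + o = a -> kr k pw = b -> kr k rm = m ->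
  (forall i, i < m -> cell_at k (a + 2 * i) (s i)) ->
  (forall i, i < length y -> s i = sym_of_bool (nth i y false)) -> s (length y) = SB ->
  (forall i, i < m -> bit_at k (b + i) (g i)) ->
  bit_at (sem (ge_prog pc ph o pw rm) k) (kr (sem (ge_prog pc ph o pw rm) k) pc + 1)
    (bval (fun i => nth i y false) m <=? bval g m).
Proof.
  intros H1 H2 H3 H4 H5 H6 H7 H8 H9 H10 Hc Hl Ha Hb Hm Hs Hsy HsB Hg.
  set (f := fun i => nth i y false).
  unfold ge_prog. rewrite !ksem_Seq.
  set (k1 := sem (copy_cur pc) k).
  assert (C1 : counted k1) by (apply copy_cur_counted; auto).
  assert (R1 : forall q, kr k1 q = if q =? pc then kr k 1 else kr k q) by (intros; now apply copy_cur_reg).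
  set (k2 := sem (KEmit (fun _ => true) []) k1).
  assert (C2 : counted k2) by (now apply emit_counted).
  assert (R2 : forall q, kr k2 q = if q =? 1 then S (kr k 1) else if q =? pc then kr k 1 else kr k q).
  { intros q. unfold k2. rewrite emit_reg, (R1 1), R1, (eqb_neq_false 1 pc) by lia. reflexivity. }
  assert (B2 : bit_at k2 (kr k 1) true).
  { replace (kr k 1) with (kr k1 1) by (rewrite R1, eqb_neq_false; lia).
    now apply emit_bit_det with (vs := []); [|apply bits_nil|]. }
  set (k2' := sem (KEmit (fun _ => true) []) k2).
  assert (C2' : counted k2') by (now apply emit_counted).
  assert (R2' : forall q, kr k2' q = if q =? 1 then S (S (kr k 1)) else if q =? pc then kr k 1 else kr k q).
  { intros q. unfold k2'. rewrite emit_reg, !R2. cbn [Nat.eqb]. now destruct (q =? 1). }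
  assert (B2' : bit_at k2' (kr k 1 + 1) true).
  { replace (kr k 1 + 1) with (kr k2 1) by (rewrite R2; cbn [Nat.eqb]; lia).
    now apply emit_bit_det with (vs := []); [|apply bits_nil|]. }
  pose proof (for_inv K x (fun j k' => counted k' /\ kr k' 1 = 2 + kr k' pc /\ kr k' ph + o = a + 2 * j /\
    kr k' pw = b + j /\
    (forall i, i < m -> cell_at k' (a + 2 * i) (s i)) /\ (forall i, i < m -> bit_at k' (b + i) (g i)) /\
    bit_at k' (kr k' pc + 0) (j <=? length y) /\
    bit_at k' (kr k' pc + 1) (bval f j <=? bval g j)) rm (ge_body pc ph o pw) k2') as H.
  rewrite R2', !eqb_neq_false, Hm in H by auto.
  destruct H as (_ & _ & _ & _ & _ & _ & _ & H).
  - assert (Epc : kr k2' pc = kr k 1) by (rewrite R2'; eqb_simp; reflexivity).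
    split; [exact C2'|]. rewrite Epc, (R2' 1), (R2' ph), (R2' pw). eqb_simp.
    split; [reflexivity|]. split; [lia|]. split; [lia|].
    split; [intros i Hi; unfold k2', k2, k1; do 3 apply cell_ksem; auto|].
    split; [intros i Hi; unfold k2', k2, k1; do 3 apply bit_ksem; auto|].
    split; [rewrite Nat.add_0_r; unfold k2'; now apply bit_ksem | exact B2'].
  - intros j k' Hj (C & Ecur & Eh & Ew & Hsb & Hgb & Hv & Hle). unfold ge_body. rewrite !ksem_Seq.
    set (refs := [(pc, 0); (pc, 1); (ph, o); (ph, S o); (pw, 0)]).
    set (phi := fun l : list bool => nth 0 l false && nth 2 l false).
    set (vs := [j <=? length y; bval f j <=? bval g j; nonblank (s j); bit_sym (s j); g j]).
    assert (Hrefs : Forall (fun e => fst e <> 1) refs) by (repeat constructor; cbn; lia).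
    assert (Hbits : bits_at inp k' refs vs).
    { destruct (Hsb j Hj) as [Hs1 Hs2].
      repeat apply bits_cons; try apply bits_nil; auto.
      - now rewrite Eh.
      - rewrite Nat.add_succ_r, Eh. exact Hs2.
      - rewrite Nat.add_0_r, Ew. auto. }
    set (k3 := sem (KEmit phi refs) k').
    assert (Hbits3 : bits_at inp k3 refs vs) by now apply bits_emit.
    assert (C3 : counted k3) by now apply emit_counted.
    set (k4 := sem (KEmit ge_fun refs) k3).
    assert (R4 : forall q, kr k4 q = if q =? 1 then S (S (kr k' 1)) else kr k' q).
    { intros q. unfold k4, k3. rewrite !emit_reg. cbn [Nat.eqb]. now destruct (q =? 1). }
    assert (Rf : forall q, kr (sem (incn pw 1) (sem (incn ph 2) (sem (incn pc 2) k4))) q =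
      if q =? pw then b + S j else if q =? ph then kr k' ph + 2 else if q =? pc then 2 + kr k' pc else kr k4 q).
    { intros q. rewrite !incn_reg, !R4, !(eqb_neq_false pw), !(eqb_neq_false ph), !(eqb_neq_false pc) by lia.
      rewrite Ew. destruct (q =? pw), (q =? ph), (q =? pc); lia. }
    (* Behind the first blank the tape may hold anything, while [y] is continued by zeros; the
       validity bit forces those cells to count as zeros. *)
    assert (Hsj : (j <=? length y) && nonblank (s j) = (S j <=? length y) /\
      (j <=? length y) && nonblank (s j) && bit_sym (s j) = f j).
    { unfold f. destruct (Nat.lt_total j (length y)) as [Hlt|[->|Hgt]].
      - rewrite (Hsy j Hlt), (proj2 (Nat.leb_le j (length y))), (proj2 (Nat.leb_le (S j) (length y))) by lia.
        now destruct (nth j y false).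
      - rewrite HsB, (proj2 (Nat.leb_gt (S (length y)) (length y))), nth_overflow by lia.
        now rewrite andb_false_r.
      - rewrite (proj2 (Nat.leb_gt j (length y))), (proj2 (Nat.leb_gt (S j) (length y))), nth_overflow by lia. auto. }
    destruct Hsj as [Hsj1 Hsj2].
    assert (Bv : bit_at (sem (incn pw 1) (sem (incn ph 2) (sem (incn pc 2) k4))) (kr k' 1) (S j <=? length y)).
    { do 3 apply bit_ksem. unfold k4. apply bit_ksem. rewrite <- Hsj1.
      apply emit_bit_det with (vs := vs); auto. }
    assert (Bg : bit_at (sem (incn pw 1) (sem (incn ph 2) (sem (incn pc 2) k4))) (S (kr k' 1))
      (bval f (S j) <=? bval g (S j))).
    { do 3 apply bit_ksem. unfold k4.
      replace (S (kr k' 1)) with (kr k3 1) by (unfold k3; now rewrite emit_reg).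
      apply emit_bit_det with (vs := vs); auto.
      intros rest. rewrite bval_le_step, <- Hsj2. reflexivity. }
    split; [do 3 (apply incn_counted; auto); now apply emit_counted|].
    rewrite (Rf 1), (Rf ph), (Rf pc), (Rf pw), R4. eqb_simp.
    split; [lia|]. split; [lia|]. split; [lia|].
    split; [intros i Hi; unfold k4, k3; do 5 apply cell_ksem; auto|].
    split; [intros i Hi; unfold k4, k3; do 5 apply bit_ksem; auto|].
    split.
    + replace (2 + kr k' pc + 0) with (kr k' 1) by lia. exact Bv.
    + replace (2 + kr k' pc + 1) with (S (kr k' 1)) by lia. exact Bg.
  - exact H.
Qed.
End Emission.

(** * The colour of a string *)

Section Uses.
Variables (K : nat) (I B : nat -> Prop).
Hypothesis H1 : I 1.
Local Notation uses := (uses K I B).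

Lemma copy_cur_uses r : I r -> 2 < r -> B 1 -> uses (copy_cur r).
Proof. intros. now apply for_incn_uses. Qed.

Lemma zero_body_uses pz pw : I pz -> I pw -> 2 < pz -> 2 < pw -> 2 <= K -> uses (zero_body pz pw).
Proof. intros. cbn. auto 10. Qed.

Lemma zero_prog_uses pz pw rd :
  I pz -> I pw -> 2 < pz -> 2 < pw -> 2 <= K -> B 1 -> B rd -> uses (zero_prog pz pw rd).
Proof.
  intros. split; [now apply copy_cur_uses|]. split; [cbn; auto with arith|].
  split; auto. now apply zero_body_uses.
Qed.

Lemma le_body_uses pl py pz :
  I pl -> I py -> I pz -> 2 < pl -> 2 < py -> 2 < pz -> 3 <= K -> uses (le_body pl py pz).
Proof. intros. cbn. auto 10. Qed.

Lemma le_prog_uses pl py pz rn :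
  I pl -> I py -> I pz -> 2 < pl -> 2 < py -> 2 < pz -> 3 <= K -> B 1 -> B rn ->
  uses (le_prog pl py pz rn).
Proof.
  intros. split; [now apply copy_cur_uses|]. split; [cbn; auto with arith|].
  split; auto. now apply le_body_uses.
Qed.

Lemma ge_body_uses pc ph o pw :
  I pc -> I ph -> I pw -> 2 < pc -> 2 < ph -> 2 < pw -> 5 <= K -> uses (ge_body pc ph o pw).
Proof. intros. cbn. auto 15. Qed.

Lemma ge_prog_uses pc ph o pw rm :
  I pc -> I ph -> I pw -> 2 < pc -> 2 < ph -> 2 < pw -> 5 <= K -> B 1 -> B rm ->
  uses (ge_prog pc ph o pw rm).
Proof.
  intros. split; [now apply copy_cur_uses|]. split; [cbn; auto with arith|].
  split; [cbn; auto with arith|]. split; auto. now apply ge_body_uses.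
Qed.

Variables (M : TM) (rW rlen ph pv rT : nat).
Hypothesis HK : 8 + tm_n M <= K.
Hypothesis Hph : I ph /\ 2 < ph.
Hypothesis Hpv : I pv /\ 2 < pv.

Lemma step_cell_uses u L C R : uses (step_cell M ph pv u L C R).
Proof.
  assert (E : length (cell_refs (ph, 2 + tm_n M) ++ cell_refs L ++ cell_refs C ++ cell_refs R ++ qrefs M ph) <= K).
  { rewrite !length_app. unfold qrefs. rewrite length_map, length_seq. cbn. lia. }
  split; [split; split; auto|]. apply incn_uses; apply Hpv.
Qed.

Lemma emit_row_uses : B rW -> B rlen -> uses (emit_row M rW rlen ph pv).
Proof.
  intros HW Hl.
  split; [split; [exact HW | apply step_cell_uses]|].
  split; [apply step_cell_uses|].
  split.
  { split; [|apply incn_uses; apply Hpv].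
    apply emit_list_uses; auto. rewrite length_app. unfold qrefs. rewrite length_map, length_seq. cbn. lia. }
  split; [apply step_cell_uses|]. split; [apply step_cell_uses|].
  split; [split; [exact Hl | apply step_cell_uses]|].
  split; [split; [exact HW | apply step_cell_uses]|].
  split; [apply for_incn_uses; auto; apply Hph|].
  split; [apply for_incn_uses; auto; apply Hph|].
  apply incn_uses; apply Hph.
Qed.

Lemma sim_init_uses cont : B 1 -> B rW -> uses cont -> uses (sim_init M rW ph pv cont).
Proof.
  intros HB1 HBW Hc.
  split; [apply for_incn_uses; auto; apply Hpv|].
  split; [now apply const_cell_uses|].
  split; [now apply for_const_cell_uses|].
  split; [apply for_incn_uses; auto; apply Hph|].
  split; [now apply const_cell_uses|].
  split; [apply emit_list_uses; cbn; auto with arith|].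
  split; [exact Hc|].
  split; [now apply const_cell_uses|].
  split; [now apply const_cell_uses|].
  now apply for_const_cell_uses.
Qed.

Lemma sim_uses cont :
  B 1 -> B rW -> B rlen -> B rT -> uses cont -> uses (sim M rW rlen ph pv cont rT).
Proof.
  intros. split; [now apply sim_init_uses|]. split; auto. now apply emit_row_uses.
Qed.
End Uses.

Section Good.
Variable K : nat.

Lemma good_in I B c :
  (forall r, In r I -> In r B -> False) -> ~ In 0 I ->
  uses K (fun r => In r I) (fun r => In r B) c -> good K c.
Proof. apply good_uses. Qed.

Ltac by_lists I B := apply (good_in I B); [cbn; lia | cbn; lia |].

Lemma good_for_incn r p n : r <> p -> 2 < p -> good K (KFor r (incn p n)).
Proof. intros. by_lists [p] [r]. apply for_incn_uses; cbn; auto. Qed.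

Lemma good_incn p n : 2 < p -> good K (incn p n).
Proof. intros. by_lists [p] (@nil nat). apply incn_uses; cbn; auto. Qed.

Lemma good_copy_cur r : 2 < r -> good K (copy_cur r).
Proof. intros. apply good_for_incn; lia. Qed.

Lemma good_emit phi refs : length refs <= K -> good K (KEmit phi refs).
Proof. intros. by_lists [1] (@nil nat). cbn. auto. Qed.

Lemma good_const_cell s : good K (const_cell s).
Proof. by_lists [1] (@nil nat). apply const_cell_uses. cbn. auto. Qed.

Lemma good_zero_prog pz pw rd : 2 < pz -> 2 < pw -> 2 <= K -> rd <> 0 -> rd <> 1 -> rd <> pz -> rd <> pw ->
  good K (zero_prog pz pw rd).
Proof.
  intros. apply good_Seq; [now apply good_copy_cur|]. apply good_Seq; [apply good_emit; cbn; lia|].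
  by_lists [1; pz; pw] [rd]. split; [cbn; auto|]. apply zero_body_uses; cbn; auto.
Qed.

Lemma good_le_prog pl py pz rn : 2 < pl -> 2 < py -> 2 < pz -> 3 <= K ->
  rn <> 0 -> rn <> 1 -> rn <> pl -> rn <> py -> rn <> pz -> good K (le_prog pl py pz rn).
Proof.
  intros. apply good_Seq; [now apply good_copy_cur|]. apply good_Seq; [apply good_emit; cbn; lia|].
  by_lists [1; pl; py; pz] [rn]. split; [cbn; auto|]. apply le_body_uses; cbn; auto.
Qed.

Lemma good_ge_prog pc ph o pw rm : 2 < pc -> 2 < ph -> 2 < pw -> 5 <= K ->
  rm <> 0 -> rm <> 1 -> rm <> pc -> rm <> ph -> rm <> pw -> good K (ge_prog pc ph o pw rm).
Proof.
  intros. apply good_Seq; [now apply good_copy_cur|]. apply good_Seq; [apply good_emit; cbn; lia|].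
  apply good_Seq; [apply good_emit; cbn; lia|].
  by_lists [1; pc; ph; pw] [rm]. split; [cbn; auto|]. apply ge_body_uses; cbn; auto.
Qed.

Lemma good_sim M rW rlen ph pv cont rT :
  8 + tm_n M <= K -> 2 < ph -> 2 < pv -> good K cont ->
  (forall r, r = rW \/ r = rlen \/ r = rT -> r <> 1 /\ r <> ph /\ r <> pv) ->
  good K (sim M rW rlen ph pv cont rT).
Proof.
  intros HK Hph Hpv Hc Hr.
  assert (HfW : good K (KFor rW (const_cell SB))).
  { destruct (Hr rW); auto. by_lists [1] [rW]. apply for_const_cell_uses; cbn; auto. }
  apply good_Seq; [|].
  - apply good_Seq; [now apply good_copy_cur|]. apply good_Seq; [apply good_const_cell|].
    apply good_Seq; [exact HfW|]. apply good_Seq; [now apply good_copy_cur|].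
    apply good_Seq; [apply good_const_cell|].
    apply good_Seq; [by_lists [1] (@nil nat); apply emit_list_uses; cbn; auto with arith|].
    apply good_Seq; [exact Hc|]. apply good_Seq; [apply good_const_cell|].
    apply good_Seq; [apply good_const_cell | exact HfW].
  - assert (H1 := Hr rW). assert (H2 := Hr rlen). assert (H3 := Hr rT).
    by_lists [1; ph; pv] [rW; rlen; rT]. split; [cbn; auto|]. apply emit_row_uses; cbn; auto.
Qed.

Lemma good_pair_cells ptr rp : 2 < ptr -> rp <> 1 -> rp <> ptr -> 1 <= K -> good K (pair_cells ptr rp).
Proof. intros. by_lists [1; ptr] [rp]. apply pair_cells_uses; cbn; auto. Qed.

Lemma good_input_cells : good K input_cells.
Proof. by_lists [1] (@nil nat). apply input_cells_uses; cbn; auto. Qed.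
End Good.

Section Side.
Variables (K : nat) (x inp : list bool).
Local Notation sem := (ksem K x).
Local Notation bit_at k := (bit_at k inp).
Local Notation cell_at k := (cell_at k inp).

Variables MR MG : TM.
Hypothesis HKR : 8 + tm_n MR <= K.
Hypothesis HKG : 8 + tm_n MG <= K.

(* The arguments are the first bit of the point, the two bits of the scanned cell of the machine for [R], whether
   the padding vanishes, and the result of the comparison with [h x]. *)
Definition side_fun (l : list bool) : bool :=
  if nth 0 l false then nth 4 l false else nth 1 l false && nth 2 l false && nth 3 l false.

(* The bits of the point start at the gate given by register [yb]; the pointers are [o], [o + 2], .., [o + 18]. *)
Definition side_prog (yb o : nat) : kcmd :=
  KSeq (KFor yb (incn (o + 4) 1))
  (KSeq (incn (o + 4) 1)
  (KSeq (sim MR 16 10 o (o + 2) (pair_cells (o + 4) 4) 6)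
  (KSeq (sim MG 16 0 (o + 6) (o + 8) input_cells 8)
  (KSeq (KFor yb (incn (o + 12) 1))
  (KSeq (KFor 4 (incn (o + 12) 1))
  (KSeq (incn (o + 12) 1)
  (KSeq (zero_prog (o + 10) (o + 12) 18)
  (KSeq (KFor yb (incn (o + 16) 1))
  (KSeq (incn (o + 16) 1)
  (KSeq (ge_prog (o + 14) (o + 6) (2 + tm_n MG) (o + 16) 12)
  (KSeq (copy_cur (o + 18))
        (KEmit side_fun [(yb, 0); (o, 2 + tm_n MR); (o, S (2 + tm_n MR)); (o + 10, 0); (o + 14, 1)])))))))))))).

Definition pointers (o : nat) : list nat :=
  [o; o + 2; o + 4; o + 6; o + 8; o + 10; o + 12; o + 14; o + 16; o + 18].

Lemma side_prog_uses yb o :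
  2 < o -> uses K (fun r => In r (1 :: pointers o)) (fun _ => True) (side_prog yb o).
Proof.
  intros Ho. unfold side_prog, pointers.
  repeat match goal with |- uses _ _ _ (KSeq _ _) => split end.
  - apply for_incn_uses; auto; cbn; lia.
  - apply incn_uses; cbn; lia.
  - apply sim_uses; auto;
      first [split; cbn; lia | now left | apply pair_cells_uses; auto; cbn; lia].
  - apply sim_uses; auto;
      first [split; cbn; lia | now left | apply input_cells_uses; now left].
  - apply for_incn_uses; auto; cbn; lia.
  - apply for_incn_uses; auto; cbn; lia.
  - apply incn_uses; cbn; lia.
  - apply zero_prog_uses; auto; cbn; lia.
  - apply for_incn_uses; auto; cbn; lia.
  - apply incn_uses; cbn; lia.
  - apply ge_prog_uses; auto; cbn; lia.
  - apply copy_cur_uses; auto; cbn; lia.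
  - cbn; lia.
Qed.

Lemma side_prog_good yb o :
  2 < o -> Nat.odd o = true -> Nat.even yb = true -> good K (side_prog yb o).
Proof.
  intros Ho Hodd Hev.
  (* Parity separates the loop bounds, in even registers, from the pointers that the loops
     increment. *)
  assert (Hne : forall i j, Nat.even i = true -> Nat.even j = true -> i <> o + j).
  { intros i j Hi Hj ->. rewrite Nat.even_add, Hj, <- Nat.negb_odd, Hodd in Hi. discriminate. }
  assert (Ho0 := Hne 16 0 eq_refl eq_refl). assert (Ho1 := Hne 10 0 eq_refl eq_refl).
  assert (Ho2 := Hne 6 0 eq_refl eq_refl). rewrite Nat.add_0_r in *.
  unfold side_prog. repeat match goal with |- good _ (KSeq _ _) => apply good_Seq end;
    try (apply good_for_incn; [now apply Hne | lia]);
    try (apply good_incn; lia).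
  - apply good_sim; auto; try lia.
    + apply good_pair_cells; lia.
    + intros r [-> | [-> | ->]]; repeat split; auto; try lia; apply Hne; auto.
  - apply good_sim; auto; try lia.
    + apply good_input_cells.
    + intros r [-> | [-> | ->]]; repeat split; auto; try lia; apply Hne; auto.
  - apply good_zero_prog; try lia; apply Hne; auto.
  - apply good_ge_prog; try lia; apply Hne; auto.
  - apply good_copy_cur; lia.
  - apply good_emit. cbn. lia.
Qed.
Variables (p TR TG m W d : nat) (R : list bool -> bool) (y : list bool).
Hypothesis Hm : m = p + d.
(** The second inequality keeps the first [m] output cells of the machine for [h] inside the
    reliable part of its last row. *)
Hypothesis HW : TR <= W /\ TG + m <= W.
Hypothesis HR : forall w, length w = p ->
  snd (hrun MR TR (hinit MR (pair_enc x w))) 0%Z = sym_of_bool (R (pair_enc x w)).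
Hypothesis Hy : forall i, i < length y ->
  snd (hrun MG TG (hinit MG x)) (Z.of_nat i) = sym_of_bool (nth i y false).
Hypothesis HyB : snd (hrun MG TG (hinit MG x)) (Z.of_nat (length y)) = SB.

(* Even registers hold the parameters of the construction, odd registers above 2 are pointers. *)
Record params (k : kst) : Prop := {
  pa_counted : counted k;
  pa_n : kr k 0 = length x;
  pa_p : kr k 4 = p;
  pa_TR : kr k 6 = TR;
  pa_TG : kr k 8 = TG;
  pa_len : kr k 10 = 2 * length x + 2 + p;
  pa_m : kr k 12 = m;
  pa_cn : kr k 14 = S m;
  pa_W : kr k 16 = W;
  pa_d : kr k 18 = d }.

Definition side (v : list bool) : bool :=
  match v with
  | [] => false
  | b :: w =>
      if b then bval (fun i => nth i y false) m <=? bval (fun i => nth i w false) m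
      else R (pair_enc x (firstn p w)) && forallb negb (skipn p w)
  end.

Lemma sim_init_reg M rW ph pv cont L k r :
  uses K (fun r => In r L) (fun _ => True) (sim_init M rW ph pv cont) -> ~ In r L ->
  kr (sem (sim_init M rW ph pv cont) k) r = kr k r.
Proof. apply frame. Qed.

Lemma firstn_nth_lt (w : list bool) n i : i < n -> nth i (firstn n w) false = nth i w false.
Proof. intros H. rewrite nth_firstn. now rewrite (proj2 (Nat.ltb_lt _ _) H). Qed.

Lemma side_prog_correct yb o v k :
  2 < o -> Nat.odd o = true -> Nat.even yb = true -> params k ->
  (forall r, In r (pointers o) -> kr k r = 0) -> length v = S m ->
  (forall i, i < S m -> bit_at k (kr k yb + i) (nth i v false)) ->
  bit_at (sem (side_prog yb o) k) (kr (sem (side_prog yb o) k) (o + 18)) (side v).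
Proof.
  intros Ho Hodd Hev HP H0 Hlen Hv.
  apply Nat.odd_spec in Hodd as [q Hq]. apply Nat.even_spec in Hev as [e He].
  destruct v as [|b0 w]; [discriminate|]. cbn in Hlen. injection Hlen as Hlen.
  set (a := kr k yb) in *.
  assert (Hw : forall i, i < m -> bit_at k (a + 1 + i) (nth i w false)).
  { intros i Hi. specialize (Hv (S i) ltac:(lia)). cbn in Hv.
    now replace (a + 1 + i) with (a + S i) by lia. }
  assert (Hb0 : bit_at k a b0).
  { specialize (Hv 0 ltac:(lia)). cbn in Hv. now rewrite Nat.add_0_r in Hv. }
  clear Hv. unfold pointers in H0. cbn [In] in H0.
  destruct HP as [Hc Hn Hp HTR HTG Hl Hmm Hcn HWW Hd].
  assert (U := side_prog_uses yb o Ho). apply uses_reserved in U.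
  unfold side_prog in U. cbn [reserved_ok] in U.
  destruct U as (U1 & U2 & U3 & U4 & U5 & U6 & U7 & U8 & U9 & U10 & U11 & U12 & _).
  unfold side_prog. rewrite !ksem_Seq.
  set (k1 := sem (KFor yb (incn (o + 4) 1)) k).
  assert (E1 : forall r, kr k1 r = if r =? o + 4 then a else kr k r).
  { intros r. unfold k1. rewrite for_incn_reg. rewrite (H0 (o + 4)) by lia. fold a. destruct (r =? o + 4); lia. }
  assert (C1 : counted k1) by (now apply ksem_counted).
  set (k2 := sem (incn (o + 4) 1) k1).
  assert (E2 : forall r, kr k2 r = if r =? o + 4 then a + 1 else kr k r).
  { intros r. unfold k2. rewrite incn_reg, !E1, Nat.eqb_refl. destruct (r =? o + 4); lia. }
  assert (C2 : counted k2) by (now apply ksem_counted).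
  set (w1 := firstn p w).
  assert (Lw1 : length w1 = p) by (unfold w1; rewrite length_firstn; lia).
  set (c3 := sim MR 16 10 o (o + 2) (pair_cells (o + 4) 4) 6).
  set (k3 := sem c3 k2).
  assert (E3 : forall r, ~ In r [1; o; o + 2; o + 4] -> kr k3 r = kr k2 r).
  { intros r Hr. apply (frame K x [1; o; o + 2; o + 4]); auto.
    apply sim_uses; auto;
      first [split; cbn; lia | now left | apply pair_cells_uses; auto; cbn; lia]. }
  assert (C3 : counted k3) by (now apply ksem_counted).
  assert (B3 : cell_at k3 (kr k3 o + (2 + tm_n MR)) (sym_of_bool (R (pair_enc x w1)))).
  { rewrite <- HR by exact Lw1.
    replace (kr k3 o + (2 + tm_n MR)) with (kr k3 o + (2 + tm_n MR) + 2 * 0) by lia.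
    change 0%Z with (Z.of_nat 0).
    (* [Pc] records what [pair_cells] needs: its pointer, the length [p] of the witness, and the
       witness bits. *)
    apply (sim_correct K x inp MR 16 10 o (o + 2) W (2 * length x + 2 + p)) with
      (Pc := fun k => kr k (o + 4) = a + 1 /\ kr k 4 = p /\
        forall i, i < p -> bit_at k (a + 1 + i) (nth i w1 false)); auto; try lia.
    - unfold pair_enc. rewrite !length_app, Lw1. cbn [length].
      enough (length (flat_map (fun b : bool => [b; b]) x) = 2 * length x) by lia.
      clear. induction x; cbn; lia.
    - apply (uses_reserved K (fun _ => True) (fun _ => True)). apply pair_cells_uses; auto; lia.
    - intros c k' Hcu (P1 & P2 & P3). split; [|split].
      + rewrite <- P1. eapply ksem_frame; [exact Hcu|]. cbn. lia.
      + rewrite <- P2. eapply ksem_frame; [exact Hcu|]. cbn. lia.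
      + intros i Hi. apply bit_ksem. auto.
    - intros k' (P1 & P2 & P3) Hc'.
      destruct (pair_cells_correct K x inp (o + 4) 4 (a + 1) w1 k') as (_ & Q1 & Q2); auto; try lia.
      { rewrite Lw1. exact P3. }
      assert (Ll : length (map sym_of_bool (pair_enc x w1)) = 2 * length x + 2 + p).
      { rewrite length_map. unfold pair_enc. rewrite !length_app, Lw1. cbn [length].
        enough (length (flat_map (fun b : bool => [b; b]) x) = 2 * length x) by lia.
        clear. induction x; cbn; lia. }
      rewrite Ll in Q1, Q2. split; [exact Q1|]. split.
      + intros r Hr. apply (frame K x [1; o + 4]).
        * apply pair_cells_uses; auto; cbn; lia.
        * cbn. lia.
      + intros i Hi. specialize (Q2 i Hi).
        rewrite nth_indep with (d' := sym_of_bool false) in Q2 by lia. now rewrite map_nth in Q2.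
    - rewrite !E2. eqb_simp. split; [lia|]. split; [lia|]. intros i Hi.
      unfold k2, k1. do 2 apply bit_ksem. unfold w1. rewrite firstn_nth_lt by lia. apply Hw. lia.
    - rewrite E2. eqb_simp. apply H0. lia.
    - rewrite E2. eqb_simp. apply H0. lia.
    - rewrite E2. eqb_simp. auto.
    - rewrite E2. eqb_simp. auto.
    - rewrite (sim_init_reg MR 16 o (o + 2) (pair_cells (o + 4) 4) [1; o; o + 2; o + 4]).
      + rewrite E2. eqb_simp. auto.
      + apply sim_init_uses; auto;
          first [split; cbn; lia | now left | apply pair_cells_uses; auto; cbn; lia].
      + cbn. lia. }
  set (c4 := sim MG 16 0 (o + 6) (o + 8) input_cells 8).
  set (k4 := sem c4 k3).
  assert (E4 : forall r, ~ In r [1; o + 6; o + 8] -> kr k4 r = kr k3 r).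
  { intros r Hr. apply (frame K x [1; o + 6; o + 8]); auto.
    apply sim_uses; auto;
      first [split; cbn; lia | now left | apply input_cells_uses; now left]. }
  assert (C4 : counted k4) by (now apply ksem_counted).
  assert (B4 : forall i, i < m ->
    cell_at k4 (kr k4 (o + 6) + (2 + tm_n MG) + 2 * i) (snd (hrun MG TG (hinit MG x)) (Z.of_nat i))).
  { intros i Hi.
    apply (sim_correct K x inp MG 16 0 (o + 6) (o + 8) W (length x)) with (Pc := fun _ => True);
      auto; try lia.
    - exact (uses_reserved K (fun _ => True) (fun _ => True) _ (input_cells_uses K _ _ I)).
    - intros k' _ Hc'.
      destruct (input_cells_correct K x inp k' Hc') as (_ & Q1 & Q2).
      rewrite length_map in Q1, Q2. split; [exact Q1|]. split.
      + intros r Hr. apply (frame K x [1]).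
        * apply input_cells_uses; now left.
        * cbn. lia.
      + intros j Hj. specialize (Q2 j Hj).
        rewrite nth_indep with (d' := sym_of_bool false) in Q2 by now rewrite length_map.
        now rewrite map_nth in Q2.
    - rewrite E3, E2 by (cbn; lia). eqb_simp. apply H0. lia.
    - rewrite E3, E2 by (cbn; lia). eqb_simp. apply H0. lia.
    - rewrite E3, E2 by (cbn; lia). eqb_simp. auto.
    - rewrite E3, E2 by (cbn; lia). eqb_simp. auto.
    - rewrite (sim_init_reg MG 16 (o + 6) (o + 8) input_cells [1; o + 6; o + 8]).
      + rewrite E3, E2 by (cbn; lia). eqb_simp. auto.
      + apply sim_init_uses; auto;
          first [split; cbn; lia | now left | apply input_cells_uses; now left].
      + cbn. lia. }
  assert (Hw4 : forall i, i < m -> bit_at k4 (a + 1 + i) (nth i w false)).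
  { intros i Hi. unfold k4, k3, k2, k1. do 4 apply bit_ksem. auto. }
  assert (Hb4 : bit_at k4 a b0).
  { unfold k4, k3, k2, k1. do 4 apply bit_ksem. auto. }
  assert (B34 : cell_at k4 (kr k4 o + (2 + tm_n MR)) (sym_of_bool (R (pair_enc x w1)))).
  { rewrite E4 by (cbn; lia). unfold k4. now apply cell_ksem. }
  assert (R4 : forall r, ~ In r [1; o; o + 2; o + 4; o + 6; o + 8] -> kr k4 r = kr k r).
  { intros r Hr. cbn in Hr. rewrite E4, E3, E2 by (cbn; lia). eqb_simp. reflexivity. }
  assert (Hyb : kr k4 yb = a) by (apply R4; cbn; lia).
  clearbody k4. clear k1 E1 C1 k2 E2 C2 c3 k3 E3 C3 B3 c4 E4 U1 U2 U3 U4.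
  set (k5 := sem (KFor yb (incn (o + 12) 1)) k4).
  assert (E5 : forall r, kr k5 r = if r =? o + 12 then a else kr k4 r).
  { intros r. unfold k5. rewrite for_incn_reg, Hyb, (R4 (o + 12)), (H0 (o + 12)) by (cbn; lia).
    destruct (r =? o + 12); lia. }
  set (k6 := sem (KFor 4 (incn (o + 12) 1)) k5).
  assert (E6 : forall r, kr k6 r = if r =? o + 12 then a + p else kr k4 r).
  { intros r. unfold k6. rewrite for_incn_reg, !E5. eqb_simp. rewrite (R4 4), Hp by (cbn; lia).
    destruct (r =? o + 12); lia. }
  set (k7 := sem (incn (o + 12) 1) k6).
  assert (E7 : forall r, kr k7 r = if r =? o + 12 then a + p + 1 else kr k4 r).
  { intros r. unfold k7. rewrite incn_reg, !E6, Nat.eqb_refl. destruct (r =? o + 12); lia. }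
  assert (C7 : counted k7) by (do 3 (apply ksem_counted; auto)).
  set (k8 := sem (zero_prog (o + 10) (o + 12) 18) k7).
  assert (C8 : counted k8) by (now apply ksem_counted).
  assert (E8 : forall r, ~ In r [1; o + 10; o + 12] -> kr k8 r = kr k7 r).
  { intros r Hr. apply (frame K x [1; o + 10; o + 12]); auto. apply zero_prog_uses; auto; cbn; lia. }
  assert (B8 : bit_at k8 (kr k8 (o + 10)) (forallb negb (skipn p w))).
  { apply zero_prog_correct with (a := a + p + 1); auto; try lia.
    - rewrite E7. eqb_simp. rewrite R4 by (cbn; lia). apply H0. lia.
    - rewrite E7. eqb_simp. reflexivity.
    - rewrite E7. eqb_simp. rewrite R4 by (cbn; lia). rewrite Hd, length_skipn. lia.
    - rewrite length_skipn. intros i Hi. rewrite nth_skipn. unfold k7, k6, k5. do 3 apply bit_ksem.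
      replace (a + p + 1 + i) with (a + 1 + (p + i)) by lia. apply Hw4. lia. }
  set (k9 := sem (KFor yb (incn (o + 16) 1)) k8).
  assert (E9 : forall r, kr k9 r = if r =? o + 16 then a else kr k8 r).
  { intros r. unfold k9. rewrite for_incn_reg, !(E8 yb), !(E8 (o + 16)), !E7 by (cbn; lia).
    eqb_simp. rewrite Hyb, (R4 (o + 16)), (H0 (o + 16)) by (cbn; lia).
    destruct (r =? o + 16); lia. }
  set (k10 := sem (incn (o + 16) 1) k9).
  assert (E10 : forall r, kr k10 r = if r =? o + 16 then a + 1 else kr k8 r).
  { intros r. unfold k10. rewrite incn_reg, !E9, Nat.eqb_refl. destruct (r =? o + 16); lia. }
  assert (C10 : counted k10) by (do 2 (apply ksem_counted; auto)).
  set (k11 := sem (ge_prog (o + 14) (o + 6) (2 + tm_n MG) (o + 16) 12) k10).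
  assert (C11 : counted k11) by (now apply ksem_counted).
  assert (E11 : forall r, ~ In r [1; o + 14; o + 6; o + 16] -> kr k11 r = kr k10 r).
  { intros r Hr. apply (frame K x [1; o + 14; o + 6; o + 16]); auto. apply ge_prog_uses; auto; cbn; lia. }
  assert (B11 : bit_at k11 (kr k11 (o + 14) + 1)
    (bval (fun i => nth i y false) m <=? bval (fun i => nth i w false) m)).
  { apply ge_prog_correct with (a := kr k4 (o + 6) + (2 + tm_n MG)) (b := a + 1)
      (s := fun i => snd (hrun MG TG (hinit MG x)) (Z.of_nat i)); auto; try lia.
    - rewrite E10. eqb_simp. rewrite E8, E7 by (cbn; lia). eqb_simp. rewrite R4 by (cbn; lia).
      apply H0. lia.
    - rewrite E10. eqb_simp. rewrite E8, E7 by (cbn; lia). eqb_simp. reflexivity.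
    - rewrite E10. eqb_simp. reflexivity.
    - rewrite E10. eqb_simp. rewrite E8, E7 by (cbn; lia). eqb_simp. rewrite R4 by (cbn; lia). exact Hmm.
    - intros i Hi. unfold k10, k9, k8, k7, k6, k5. do 6 apply cell_ksem. auto.
    - intros i Hi. unfold k10, k9, k8, k7, k6, k5. do 6 apply bit_ksem. auto. }
  (* The next gate is the colour, so [o + 18] becomes its address. *)
  set (k12 := sem (copy_cur (o + 18)) k11).
  assert (E12 : forall r, kr k12 r = if r =? o + 18 then kr k11 1 else kr k11 r).
  { intros r. unfold k12. apply copy_cur_reg. rewrite E11, E10 by (cbn; lia). eqb_simp.
    rewrite E8, E7 by (cbn; lia). eqb_simp. rewrite R4 by (cbn; lia). apply H0. lia. }
  assert (C12 : counted k12) by (now apply ksem_counted).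
  rewrite emit_reg. eqb_simp. rewrite E12. eqb_simp.
  replace (kr k11 1) with (kr k12 1) by (rewrite E12; eqb_simp; reflexivity).
  assert (R12 : forall r, ~ In r [1; o + 6; o + 10; o + 12; o + 14; o + 16; o + 18] -> kr k12 r = kr k4 r).
  { intros r Hr. cbn in Hr. rewrite E12. eqb_simp. rewrite E11, E10 by (cbn; lia). eqb_simp.
    rewrite E8, E7 by (cbn; lia). eqb_simp. reflexivity. }
  assert (P12 : forall i b, bit_at k4 i b -> bit_at k12 i b).
  { intros i b H. unfold k12, k11, k10, k9, k8, k7, k6, k5. do 8 apply bit_ksem. exact H. }
  apply emit_bit_det with (vs := [b0; nonblank (sym_of_bool (R (pair_enc x w1)));
    bit_sym (sym_of_bool (R (pair_enc x w1))); forallb negb (skipn p w);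
    bval (fun i => nth i y false) m <=? bval (fun i => nth i w false) m]); auto.
  - destruct B34 as [B34a B34b].
    repeat apply bits_cons; try apply bits_nil.
    + rewrite R12, Hyb, Nat.add_0_r by (cbn; lia). auto.
    + rewrite R12 by (cbn; lia). auto.
    + rewrite R12, Nat.add_succ_r by (cbn; lia). auto.
    + rewrite E12, Nat.add_0_r. eqb_simp. rewrite E11, E10 by (cbn; lia). eqb_simp.
      unfold k12, k11, k10, k9. do 4 apply bit_ksem. exact B8.
    + rewrite E12. eqb_simp. unfold k12. apply bit_ksem. exact B11.
  - intros rest. unfold side_fun. cbn [app nth]. unfold side. fold w1.
    destruct b0; auto. now destruct (R (pair_enc x w1)).
Qed.
End Side.

(** * Nim with two heaps *)

Section TwoChains.
(** The laws are restricted to [dom] because the circuit is only controlled on points of the right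
    length. *)
Variables (X : Type) (le : X -> X -> bool) (side : X -> bool) (dom : X -> Prop).
Hypothesis le_refl : forall a, dom a -> le a a = true.
Hypothesis le_antisym : forall a b, dom a -> dom b -> le a b = true -> le b a = true -> a = b.
Hypothesis le_trans : forall a b c, dom a -> dom b -> dom c ->
  le a b = true -> le b c = true -> le a c = true.
Hypothesis le_total : forall a b, dom a -> dom b -> side a = side b -> le a b = true \/ le b a = true.
Hypothesis le_side : forall a b, dom a -> dom b -> side a <> side b -> le a b = false.

Definition on_side (b : bool) (Q : list X) : list X := filter (fun y => eqb (side y) b) Q.
Definition after (a : X) (Q : list X) : list X := filter (fun y => negb (le a y)) Q.

Lemma on_side_after b a Q : on_side b (after a Q) = after a (on_side b Q).
Proof.
  unfold on_side, after. induction Q as [|y Q IH]; cbn; auto.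
  destruct (le a y) eqn:E1, (eqb (side y) b) eqn:E2; cbn; rewrite ?E1, ?E2; cbn; now rewrite ?IH.
Qed.

Lemma filter_all_true {A} (f : A -> bool) l : (forall y, In y l -> f y = true) -> filter f l = l.
Proof.
  induction l as [|y l IH]; cbn; intros H; auto.
  rewrite (H y) by auto. f_equal. apply IH. auto.
Qed.

Lemma filter_length_lt {A} (f : A -> bool) l a :
  In a l -> f a = false -> length (filter f l) < length l.
Proof.
  intros Hin Hf. apply in_split in Hin as (l1 & l2 & ->).
  rewrite filter_app, !length_app. cbn. rewrite Hf.
  pose proof (filter_length_le f l1). pose proof (filter_length_le f l2). lia.
Qed.

Lemma chain_max b L : L <> [] -> (forall y, In y L -> dom y /\ side y = b) ->
  exists m, In m L /\ forall y, In y L -> le y m = true.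
Proof.
  induction L as [|a L IH]; intros Hne HL; [congruence|].
  destruct (HL a) as [Ha1 Ha2]; [now left|].
  destruct L as [|a' L'].
  - exists a. split; [now left|]. intros y [<-|[]]. auto.
  - destruct IH as (m & Hm & Hmax); [discriminate|intros; apply HL; now right|].
    destruct (HL m) as [Hm1 Hm2]; [now right|].
    destruct (le_total a m Ha1 Hm1) as [E|E]; [congruence| |].
    + exists m. split; [now right|]. intros y [<-|Hy]; auto.
    + exists a. split; [now left|]. intros y [<-|Hy]; auto.
      destruct (HL y) as [Hy1 _]; [now right|]. eapply le_trans; [| | |apply Hmax|]; eauto.
Qed.

(** A heap can be reduced to any smaller size by choosing the element of the corresponding rank.
    Remove the maximum: it leaves all the other elements when chosen, and lying above them it never
    counts among the survivors of their moves. *)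
Lemma chain_rank b n L k : length L = n -> NoDup L -> (forall y, In y L -> dom y /\ side y = b) ->
  k < n -> exists a, In a L /\ length (after a L) = k.
Proof.
  revert L; induction n; intros L Hlen Hnd HL Hk; [lia|].
  destruct (chain_max b L) as (m & Hm & Hmax); auto; [intros ->; discriminate|].
  apply in_split in Hm as (l1 & l2 & ->).
  assert (Hsub : forall y, In y (l1 ++ l2) -> In y (l1 ++ m :: l2)).
  { intros y. rewrite !in_app_iff. cbn. tauto. }
  rewrite length_app in Hlen. cbn in Hlen.
  destruct (HL m) as [Hdm _]; [apply in_elt|].
  destruct (Nat.eq_dec k n) as [->|Hkn].
  - exists m. split; [apply in_elt|]. unfold after. rewrite filter_app. cbn.
    rewrite le_refl by auto. cbn. rewrite <- filter_app. rewrite filter_all_true.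
    + rewrite length_app. lia.
    + intros y Hy. destruct (le m y) eqn:E; auto. exfalso.
      apply NoDup_remove_2 in Hnd. apply Hnd. rewrite (le_antisym m y); auto. apply HL; auto.
  - destruct (IHn (l1 ++ l2)) as (a & Ha & Hr).
    + rewrite length_app. lia.
    + eapply NoDup_remove_1; eauto.
    + intros y Hy. auto.
    + lia.
    + exists a. split; [auto|]. unfold after in *. rewrite filter_app in *. cbn.
      rewrite Hmax by auto. cbn. auto.
Qed.

Lemma on_side_other a Q b : dom a -> Forall dom Q -> b <> side a ->
  on_side b (after a Q) = on_side b Q.
Proof.
  intros Ha HQ Hb. rewrite on_side_after. apply filter_all_true.
  intros y Hy. apply filter_In in Hy as [Hy Hs]. apply eqb_prop in Hs.
  rewrite Forall_forall in HQ. rewrite le_side; auto. congruence.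
Qed.

(** From unequal heaps the larger one can be cut down to the smaller, and any move from equal heaps
    makes them unequal. A move leaves the other chain untouched, and by reflexivity it shortens its
    own, so fuel suffices. *)
Theorem win_two_chains fuel Q :
  NoDup Q -> Forall dom Q -> length Q <= fuel ->
  win le fuel Q = negb (length (on_side true Q) =? length (on_side false Q)).
Proof.
  revert Q; induction fuel; intros Q Hnd HQ Hlen.
  - destruct Q; [reflexivity | cbn in Hlen; lia].
  - pose proof (proj1 (Forall_forall _ _) HQ) as HQ'.
    assert (Hwin : forall a, In a Q -> win le fuel (after a Q) =
      negb (length (on_side true (after a Q)) =? length (on_side false (after a Q)))).
    { intros a Ha. apply IHfuel.
      - now apply NoDup_filter.
      - apply Forall_forall. intros y Hy. apply HQ'. unfold after in Hy. apply filter_In in Hy. tauto.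
      - enough (length (after a Q) < length Q) by lia. apply filter_length_lt with (a := a); auto.
        rewrite le_refl; auto. }
    cbn [win]. change (fun x => negb (win le fuel (filter (fun y => negb (le x y)) Q)))
      with (fun a => negb (win le fuel (after a Q))).
    assert (Hside : forall a, In a Q ->
      length (on_side (side a) (after a Q)) < length (on_side (side a) Q)).
    { intros a Ha. rewrite on_side_after. apply filter_length_lt with (a := a).
      - apply filter_In. split; auto. apply eqb_reflx.
      - rewrite le_refl; auto. }
    assert (Hmove : forall b, length (on_side (negb b) Q) < length (on_side b Q) ->
      existsb (fun a => negb (win le fuel (after a Q))) Q = true).
    { intros b Hb. destruct (chain_rank b _ (on_side b Q) (length (on_side (negb b) Q)) eq_refl)
        as (a & Ha & Hr); auto.
      - now apply NoDup_filter.
      - intros y Hy. apply filter_In in Hy as [Hy Hs]. apply eqb_prop in Hs. auto.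
      - apply filter_In in Ha as [Ha Hs]. apply eqb_prop in Hs.
        apply existsb_exists. exists a. split; auto. rewrite Hwin by auto.
        rewrite <- on_side_after in Hr.
        assert (Ho : on_side (negb b) (after a Q) = on_side (negb b) Q).
        { apply on_side_other; auto. rewrite Hs. now destruct b. }
        rewrite <- Ho in Hr. rewrite negb_involutive. apply Nat.eqb_eq.
        destruct b; cbn [negb] in *; congruence. }
    destruct (Nat.eqb_spec (length (on_side true Q)) (length (on_side false Q))) as [E|E]; cbn [negb].
    + apply not_true_is_false. intros Hex. apply existsb_exists in Hex as (a & Ha & Hw).
      rewrite Hwin in Hw by auto. rewrite negb_involutive in Hw. apply Nat.eqb_eq in Hw.
      specialize (Hside a Ha).
      assert (Ho : on_side (negb (side a)) (after a Q) = on_side (negb (side a)) Q).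
      { apply on_side_other; auto. now destruct (side a). }
      destruct (side a); cbn [negb] in Ho; rewrite Ho in Hw; lia.
    + destruct (Nat.lt_total (length (on_side true Q)) (length (on_side false Q))) as [H|[H|H]];
        [now apply (Hmove false) | lia | now apply (Hmove true)].
Qed.
End TwoChains.

(** * Counting strings *)

Lemma all_strings_spec n w : In w (all_strings n) <-> length w = n.
Proof.
  revert w; induction n; intros w; cbn.
  - split; [intros [<-|[]]; reflexivity|]. destruct w; [now left|discriminate].
  - rewrite in_app_iff, !in_map_iff. split.
    + intros [(v & <- & Hv)|(v & <- & Hv)]; apply IHn in Hv; cbn; lia.
    + destruct w as [|b w]; [discriminate|]. cbn. intros H. injection H as H. apply IHn in H.
      destruct b; [right|left]; eauto.
Qed.

Lemma all_strings_NoDup n : NoDup (all_strings n).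
Proof.
  induction n; cbn; [repeat constructor; auto|].
  assert (Hinj : forall b l, NoDup l -> NoDup (map (@cons bool b) l)).
  { intros b l H. apply NoDup_map_NoDup_ForallPairs; auto. intros v w _ _ E. congruence. }
  apply NoDup_app; auto. intros w H1 H2.
  apply in_map_iff in H1 as (v1 & <- & _). apply in_map_iff in H2 as (v2 & E & _). discriminate.
Qed.

Definition count (P : list bool -> bool) (n : nat) : nat := length (filter P (all_strings n)).

Lemma filter_map_comm {A B} (f : A -> B) P l : filter P (map f l) = map f (filter (fun a => P (f a)) l).
Proof. induction l as [|a l IH]; cbn; auto. destruct (P (f a)); cbn; now rewrite IH. Qed.

Lemma count_S P n : count P (S n) = count (fun w => P (false :: w)) n + count (fun w => P (true :: w)) n.
Proof.
  unfold count. cbn [all_strings]. now rewrite filter_app, length_app, !filter_map_comm, !length_map.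
Qed.

Lemma count_ext P P' n : (forall w, length w = n -> P w = P' w) -> count P n = count P' n.
Proof.
  intros H. unfold count. f_equal. apply filter_ext_in. intros w Hw. apply H. now apply all_strings_spec.
Qed.

Lemma count_false n : count (fun _ => false) n = 0.
Proof. unfold count. now induction (all_strings n). Qed.

Lemma length_all_strings n : length (all_strings n) = 2 ^ n.
Proof. induction n; cbn; auto. rewrite length_app, !length_map, IHn. lia. Qed.

Lemma count_compl P n : count P n + count (fun w => negb (P w)) n = 2 ^ n.
Proof. unfold count. rewrite filter_length. apply length_all_strings. Qed.

Lemma count_zeros n : count (fun w => forallb negb w) n = 1.
Proof.
  induction n; [reflexivity|]. rewrite count_S. cbn. now rewrite IHn, count_false.
Qed.

(** Only the zero padding is allowed, so every accepted prefix is counted once. *)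
Lemma count_padded P p d :
  count (fun w => P (firstn p w) && forallb negb (skipn p w)) (p + d) = count P p.
Proof.
  revert P; induction p; intros P; cbn [Nat.add].
  - cbn [firstn skipn]. unfold count at 2. cbn. destruct (P []); cbn.
    + apply count_zeros.
    + apply count_false.
  - rewrite !count_S. cbn [firstn skipn].
    now rewrite (IHp (fun w => P (false :: w))), (IHp (fun w => P (true :: w))).
Qed.

Lemma count_ge h n : h <= 2 ^ n -> count (fun w => h <=? bin_val w) n = 2 ^ n - h.
Proof.
  revert h; induction n; intros h Hh.
  - cbn in Hh. destruct h as [|[|h]]; try lia; reflexivity.
  - rewrite count_S. cbn [Nat.pow] in Hh.
    (* The first bit is the least significant one: with [h = 2 * q + r], the tail has to be at least
       [q + r] after a 0 and at least [q] after a 1. *)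
    assert (Hd : exists q r, h = 2 * q + r /\ r <= 1).
    { exists (h / 2), (h mod 2). pose proof (Nat.div_mod_eq h 2). pose proof (Nat.mod_upper_bound h 2). lia. }
    destruct Hd as (q & r & -> & Hr).
    rewrite (count_ext _ (fun w => (q + r) <=? bin_val w)), (count_ext (fun w => _ <=? bin_val (true :: w)) (fun w => q <=? bin_val w)).
    + rewrite !IHn by lia. cbn [Nat.pow]. lia.
    + intros w _. cbn [bin_val]. destruct (Nat.leb_spec q (bin_val w)), (Nat.leb_spec (2 * q + r) (1 + 2 * bin_val w)); auto; lia.
    + intros w _. cbn [bin_val]. destruct (Nat.leb_spec (q + r) (bin_val w)), (Nat.leb_spec (2 * q + r) (0 + 2 * bin_val w)); auto; lia.
Qed.

Lemma bin_val_inj v w : length v = length w -> bin_val v = bin_val w -> v = w.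
Proof.
  revert w; induction v as [|b v IH]; intros [|c w] Hl H; cbn in *; try discriminate; auto.
  injection Hl as Hl. destruct b, c; try lia; f_equal; apply IH; auto; lia.
Qed.

(** * The reduction *)

(** Each power has its own register, since a loop must not increment its bound and so a product
    cannot be formed in place. The stride 2 keeps the scratch registers even. *)
Fixpoint pows (f src j : nat) : kcmd :=
  match j with
  | 0 => KSkip
  | S j => KSeq (KFor f (KFor src (incn (f + 2) 1))) (pows (f + 2) src j)
  end.

(* Adds [c * b ^ j + c] to register [dst], where [b] is the value of [src]; the scratch registers are
   [f], [f + 2], .., [f + 2 * j]. *)
Definition poly_cmd (f src j c dst : nat) : kcmd :=
  KSeq (KInc f) (KSeq (pows f src j) (KSeq (KFor (f + 2 * j) (incn dst c)) (incn dst c))).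

Section Setup.
Variables (K : nat) (x : list bool).
Local Notation sem := (ksem K x).

Lemma for_for_incn_reg f src r k q :
  r <> f -> r <> src ->
  kr (sem (KFor f (KFor src (incn r 1))) k) q = if q =? r then kr k r + kr k f * kr k src else kr k q.
Proof.
  intros H1 H2.
  pose proof (for_inv K x (fun j k' => forall q, kr k' q = if q =? r then kr k r + j * kr k src else kr k q)
    f (KFor src (incn r 1)) k) as H.
  revert q. apply H.
  - intros q. destruct (Nat.eqb_spec q r); subst; lia.
  - intros j k' _ E q. rewrite for_incn_reg, !E. eqb_simp. destruct (q =? r); lia.
Qed.

Lemma pows_correct f src j k :
  src < f -> (forall r, f < r -> kr k r = 0) ->
  kr (sem (pows f src j) k) (f + 2 * j) = kr k f * kr k src ^ j /\
  (forall r, r <= f -> kr (sem (pows f src j) k) r = kr k r) /\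
  (forall r, f + 2 * j < r -> kr (sem (pows f src j) k) r = 0).
Proof.
  revert f k; induction j; intros f k Hs H0; cbn [pows].
  - cbn. rewrite Nat.add_0_r. split; [lia|]. split; auto.
  - rewrite ksem_Seq. set (k1 := sem _ k).
    assert (E1 : forall q, kr k1 q = if q =? f + 2 then kr k f * kr k src else kr k q).
    { intros q. unfold k1. rewrite for_for_incn_reg, (H0 (f + 2)) by lia. destruct (q =? f + 2); lia. }
    destruct (IHj (f + 2) k1) as (I1 & I2 & I3); [lia| |].
    { intros r Hr. rewrite E1. eqb_simp. apply H0. lia. }
    split; [|split].
    + replace (f + 2 * S j) with (f + 2 + 2 * j) by lia. rewrite I1, !E1. eqb_simp. cbn. lia.
    + intros r Hr. rewrite I2, E1 by lia. eqb_simp. reflexivity.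
    + intros r Hr. apply I3. lia.
Qed.

Lemma poly_cmd_correct f src j c dst k :
  src < f -> dst < f -> (forall r, f <= r -> kr k r = 0) ->
  (forall r, r < f -> kr (sem (poly_cmd f src j c dst) k) r =
    if r =? dst then kr k dst + (c * kr k src ^ j + c) else kr k r) /\
  (forall r, f + 2 * j < r -> kr (sem (poly_cmd f src j c dst) k) r = 0).
Proof.
  intros Hs Hd H0. unfold poly_cmd. rewrite !ksem_Seq.
  set (k1 := sem (KInc f) k).
  assert (E1 : forall q, kr k1 q = if q =? f then 1 else kr k q).
  { intros q. unfold k1. cbn. unfold kset. rewrite (H0 f) by lia. reflexivity. }
  destruct (pows_correct f src j k1 Hs) as (P1 & P2 & P3).
  { intros r Hr. rewrite E1. eqb_simp. apply H0. lia. }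
  rewrite (E1 f), (E1 src), Nat.eqb_refl, (eqb_neq_false src f), Nat.mul_1_l in P1 by lia.
  split; intros r Hr; rewrite incn_reg, !for_incn_reg, Nat.eqb_refl, P1, (P2 dst) by lia.
  - rewrite P2, !E1 by lia. eqb_simp. destruct (r =? dst) eqn:E; auto. lia.
  - eqb_simp. apply P3. exact Hr.
Qed.

Lemma pows_uses (I B : nat -> Prop) f src j :
  (forall i, i <= j -> I (f + 2 * i)) -> 2 < f -> (forall r, B r) -> uses K I B (pows f src j).
Proof.
  revert f; induction j; intros f HI Hf HB; cbn [pows]; [exact Logic.I|].
  split.
  - split; auto. apply for_incn_uses; auto; try lia. apply (HI 1). lia.
  - apply IHj; auto; try lia. intros i Hi. replace (f + 2 + 2 * i) with (f + 2 * S i) by lia. apply HI. lia.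
Qed.

Lemma poly_cmd_uses (I B : nat -> Prop) f src j c dst :
  (forall i, i <= j -> I (f + 2 * i)) -> I dst -> 2 < f -> 2 < dst -> (forall r, B r) ->
  uses K I B (poly_cmd f src j c dst).
Proof.
  intros HI Hd H1 H2 HB. split; [split; auto; specialize (HI 0); rewrite Nat.add_0_r in HI; apply HI; lia|].
  split; [now apply pows_uses|]. split; [now apply for_incn_uses | now apply incn_uses].
Qed.

Lemma pows_good f src j : 2 < f -> src < f -> good K (pows f src j).
Proof.
  revert f; induction j; intros f Hf Hs; cbn [pows].
  - apply (good_in K [] []); cbn; auto.
  - apply good_Seq; [|apply IHj; lia].
    apply (good_in K [f + 2] [f; src]); [cbn; lia|cbn; lia|].
    split; [cbn; auto|]. apply for_incn_uses; cbn; auto; lia.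
Qed.

Lemma poly_cmd_good f src j c dst : 2 < f -> src < f -> 2 < dst -> dst < f -> good K (poly_cmd f src j c dst).
Proof.
  intros. apply good_Seq; [apply (good_in K [f] []); cbn; lia|].
  apply good_Seq; [now apply pows_good|].
  apply good_Seq; [apply good_for_incn; lia | now apply good_incn].
Qed.
End Setup.

Section Program.
Variables (K kP cP kR cR kG cG : nat) (MR MG : TM).
Hypothesis HKR : 8 + tm_n MR <= K.
Hypothesis HKG : 8 + tm_n MG <= K.

(** The scratch ranges lie above the parameters, which end at register 18, and are disjoint because
    registers cannot be reset. *)
Definition f1 : nat := 20.
Definition f2 : nat := f1 + 2 * kP + 2.
Definition f3 : nat := f2 + 2 * kR + 2.

(** Register 10 becomes the length of [pair_enc x w], twice the length of [x] plus two separator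
    bits plus [p]; it has to precede the time bound for [R], which is a polynomial in it. *)
Definition setup : kcmd :=
  KSeq (poly_cmd f1 0 kP cP 4)
  (KSeq (KFor 0 (incn 10 2)) (KSeq (KFor 4 (incn 10 1)) (KSeq (incn 10 2)
  (KSeq (poly_cmd f2 10 kR cR 6)
  (KSeq (poly_cmd f3 0 kG cG 8)
  (KSeq (KFor 0 (incn 18 1)) (KSeq (KFor 8 (incn 18 1)) (KSeq (incn 18 2)
  (KSeq (KFor 4 (incn 12 1)) (KSeq (KFor 18 (incn 12 1))
  (KSeq (KFor 12 (incn 14 1)) (KSeq (incn 14 1)
  (KSeq (KFor 12 (incn 16 1)) (KSeq (KFor 6 (incn 16 1)) (KFor 8 (incn 16 1)))))))))))))))).

Definition final_fun (l : list bool) : bool :=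
  eqb (nth 0 l false) (nth 1 l false) && nth 2 l false.

Definition main : kcmd :=
  (* Register 1 is the number of gates emitted so far, so the wide gate [i] reads input bit [i]. *)
  KSeq (KFor 14 (KIn 1 0))
  (KSeq (KFor 14 (KIn 1 0))
  (* The two points start at the wide gates 0 and [m + 1], the values of registers 2 and 14; their
     colours end up at the addresses in registers [21 = 3 + 18] and [41 = 23 + 18]. *)
  (KSeq (side_prog MR MG 2 3)
  (KSeq (side_prog MR MG 14 23)
  (KSeq (KFor 14 (incn 47 1))
  (KSeq (le_prog 43 45 47 14)
        (KEmit final_fun [(21, 0); (41, 0); (43, 0)])))))).

Definition generator : cmd :=
  (* The encoding begins with the input size [m + 1], which is known after [setup]; that phase emits
     no gate. *)
  Seq (cmd_of K setup) (Seq (push_unary (1, 14, 0)) (cmd_of K main)).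

Lemma setup_good : good K setup.
Proof.
  unfold setup. assert (f1 < f2 /\ f2 < f3 /\ f1 = 20) by (unfold f3, f2, f1; lia).
  repeat match goal with |- good _ (KSeq _ _) => apply good_Seq end;
    match goal with
    | |- good _ (poly_cmd _ _ _ _ _) => apply poly_cmd_good; lia
    | |- good _ (KFor _ _) => apply good_for_incn; lia
    | |- good _ (incn _ _) => apply good_incn; lia
    end.
Qed.

Lemma inputs_good : good K (KFor 14 (KIn 1 0)).
Proof. apply (good_in K [1] [14]); cbn; auto; lia. Qed.

Lemma main_good : good K main.
Proof.
  unfold main. repeat match goal with |- good _ (KSeq _ _) => apply good_Seq end;
    try apply inputs_good.
  - apply side_prog_good; trivial; lia.
  - apply side_prog_good; trivial; lia.
  - apply good_for_incn; lia.
  - apply good_le_prog; lia.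
  - apply good_emit. cbn. lia.
Qed.

Lemma generator_ok : ok generator.
Proof.
  destruct setup_good as (_ & _ & H1), main_good as (_ & _ & H2).
  split; [exact H1|]. split; [|exact H2]. apply noinc_ok, incs_push_unary.
Qed.

Variable x : list bool.
Let n := length x.
Let p := cP * n ^ kP + cP.
Let len := 2 * n + 2 + p.
Let TR := cR * len ^ kR + cR.
Let TG := cG * n ^ kG + cG.
(** The output [y] has at most [n + 1 + TG] bits, so already [d] bits suffice for [bin_val y]. *)
Let d := n + TG + 2.
Let m := p + d.
Let W := m + TR + TG.

Definition start : kst := mk_kst (kset (fun _ => 0) 0 n) [].

Lemma setup_correct :
  params x p TR TG m W d (ksem K x setup start) /\ kg (ksem K x setup start) = [] /\
  forall r, Nat.odd r = true -> kr (ksem K x setup start) r = 0.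
Proof.
  assert (Hf : f1 = 20 /\ f2 = f1 + 2 * kP + 2 /\ f3 = f2 + 2 * kR + 2) by (unfold f3, f2, f1; lia).
  (* Only even registers are incremented, so all pointers are still 0 when [main] starts. *)
  assert (Huses : uses K (fun r => Nat.odd r = false) (fun _ => True) setup).
  { assert (Hodd : forall a b, Nat.odd a = false -> Nat.odd (a + 2 * b) = false).
    { intros a b Ha. now rewrite Nat.odd_add_mul_2. }
    assert (Ho : Nat.odd f1 = false /\ Nat.odd f2 = false /\ Nat.odd f3 = false).
    { unfold f3, f2, f1. repeat split; auto;
        rewrite ?(Nat.add_comm _ 2), ?Nat.add_assoc; repeat (apply Hodd; rewrite ?Nat.add_assoc); auto. }
    unfold setup. repeat match goal with |- uses _ _ _ (KSeq _ _) => split end;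
      match goal with
      | |- uses _ _ _ (poly_cmd _ _ _ _ _) => apply poly_cmd_uses; [intros; apply Hodd; tauto | auto | lia | lia | auto]
      | |- uses _ _ _ (KFor _ _) => apply for_incn_uses; auto; lia
      | |- uses _ _ _ (incn _ _) => apply incn_uses; auto; lia
      end. }
  assert (Hcnt : counted start) by (split; reflexivity).
  assert (Hc : counted (ksem K x setup start)).
  { apply ksem_counted; auto. eapply uses_reserved; eauto. }
  assert (Hodd : forall r, Nat.odd r = true -> kr (ksem K x setup start) r = 0).
  { intros r Hr. rewrite (ksem_frame K _ _ x setup start r Huses) by congruence.
    cbn. unfold kset. destruct (Nat.eqb_spec r 0); subst; [discriminate | reflexivity]. }
  split; [|split; auto].
  (* Register 1, which counts the gates, is odd and hence still 0. *)
  2: { destruct Hc as [Hc _]. rewrite Hodd in Hc by reflexivity.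
       now destruct (kg (ksem K x setup start)). }
  revert Hc. unfold setup. rewrite !ksem_Seq.
  set (k1 := ksem K x (poly_cmd f1 0 kP cP 4) start).
  destruct (poly_cmd_correct K x f1 0 kP cP 4 start) as [E1 Z1]; try lia.
  { intros r Hr. cbn. unfold kset. destruct (Nat.eqb_spec r 0); lia. }
  fold k1 in E1, Z1.
  assert (S0 : forall r, kr start r = if r =? 0 then n else 0) by reflexivity.
  set (k2 := ksem K x (KFor 0 (incn 10 2)) k1).
  assert (E2 : forall r, kr k2 r = if r =? 10 then kr k1 10 + 2 * kr k1 0 else kr k1 r)
    by (intros; apply for_incn_reg).
  set (k3 := ksem K x (KFor 4 (incn 10 1)) k2).
  assert (E3 : forall r, kr k3 r = if r =? 10 then kr k2 10 + 1 * kr k2 4 else kr k2 r)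
    by (intros; apply for_incn_reg).
  set (k4 := ksem K x (incn 10 2) k3).
  assert (E4 : forall r, kr k4 r = if r =? 10 then kr k3 10 + 2 else kr k3 r) by (intros; apply incn_reg).
  set (k5 := ksem K x (poly_cmd f2 10 kR cR 6) k4).
  destruct (poly_cmd_correct K x f2 10 kR cR 6 k4) as [E5 Z5]; try lia.
  { intros r Hr. rewrite E4. eqb_simp. rewrite E3. eqb_simp. rewrite E2. eqb_simp. apply Z1. lia. }
  fold k5 in E5, Z5.
  set (k6 := ksem K x (poly_cmd f3 0 kG cG 8) k5).
  destruct (poly_cmd_correct K x f3 0 kG cG 8 k5) as [E6 Z6]; try lia.
  { intros r Hr. apply Z5. lia. }
  fold k6 in E6, Z6.
  assert (V1 : forall r, r < 20 -> kr k1 r = if r =? 4 then p else if r =? 0 then n else 0).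
  { intros r Hr. rewrite E1, !S0 by lia. cbn [Nat.eqb Nat.add]. reflexivity. }
  assert (V4 : forall r, r < 20 -> kr k4 r =
    if r =? 10 then len else if r =? 4 then p else if r =? 0 then n else 0).
  { intros r Hr. rewrite E4, (E3 r), (E3 10), (E2 r), (E2 10), (E2 4), !V1 by lia.
    cbn [Nat.eqb]. unfold len. destruct (r =? 10); [lia|reflexivity]. }
  assert (V6 : forall r, r < 20 -> kr k6 r =
    if r =? 8 then TG else if r =? 6 then TR else
    if r =? 10 then len else if r =? 4 then p else if r =? 0 then n else 0).
  { intros r Hr. rewrite E6, (E5 r), (E5 0), (E5 8), !V4 by lia.
    cbn [Nat.eqb Nat.add]. reflexivity. }
  clearbody k6. intros Hc.
  assert (Hfor : forall r q v k (V : nat -> nat), (forall r, r < 20 -> kr k r = V r) ->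
    r <? 20 = true -> q <? 20 = true -> V q + V r = v ->
    forall r', r' < 20 -> kr (ksem K x (KFor r (incn q 1)) k) r' = if r' =? q then v else V r').
  { intros r q v k V HV Hr Hq <- r' Hr'. apply Nat.ltb_lt in Hr, Hq.
    rewrite for_incn_reg, !HV by auto. destruct (r' =? q); lia. }
  assert (Hinc : forall q j v k (V : nat -> nat), (forall r, r < 20 -> kr k r = V r) ->
    q <? 20 = true -> V q + j = v ->
    forall r', r' < 20 -> kr (ksem K x (incn q j) k) r' = if r' =? q then v else V r').
  { intros q j v k V HV Hq <- r' Hr'. apply Nat.ltb_lt in Hq.
    rewrite incn_reg, !HV by auto. reflexivity. }
  pose proof (Hfor 0 18 n _ _ V6 eq_refl eq_refl eq_refl) as V7. clear V6.
  pose proof (Hfor 8 18 (n + TG) _ _ V7 eq_refl eq_refl eq_refl) as V8. clear V7.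
  pose proof (Hinc 18 2 d _ _ V8 eq_refl eq_refl) as V9. clear V8.
  pose proof (Hfor 4 12 p _ _ V9 eq_refl eq_refl eq_refl) as V10. clear V9.
  pose proof (Hfor 18 12 m _ _ V10 eq_refl eq_refl eq_refl) as V11. clear V10.
  pose proof (Hfor 12 14 m _ _ V11 eq_refl eq_refl eq_refl) as V12. clear V11.
  pose proof (Hinc 14 1 (m + 1) _ _ V12 eq_refl eq_refl) as V13. clear V12.
  pose proof (Hfor 12 16 m _ _ V13 eq_refl eq_refl eq_refl) as V14. clear V13.
  pose proof (Hfor 6 16 (m + TR) _ _ V14 eq_refl eq_refl eq_refl) as V15. clear V14.
  pose proof (Hfor 8 16 W _ _ V15 eq_refl eq_refl eq_refl) as V16. clear V15.
  split; try (rewrite V16 by lia; cbn [Nat.eqb]; reflexivity || lia).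
  exact Hc.
Qed.

Lemma params_ksem c k :
  uses K (fun r => Nat.odd r = true) (fun _ => True) c ->
  params x p TR TG m W d k -> params x p TR TG m W d (ksem K x c k).
Proof.
  intros Hc [P0 P1 P2 P3 P4 P5 P6 P7 P8 P9].
  split; [apply ksem_counted; auto; eapply uses_reserved; eauto|..];
    rewrite (ksem_frame K _ _ x c k _ Hc); auto; discriminate.
Qed.

Lemma inputs_correct N0 c k :
  counted k -> kr k 14 = N0 -> kg k = map GI (seq 0 c) ->
  counted (ksem K x (KFor 14 (KIn 1 0)) k) /\
  kg (ksem K x (KFor 14 (KIn 1 0)) k) = map GI (seq 0 (c + N0)) /\
  forall r, r <> 1 -> kr (ksem K x (KFor 14 (KIn 1 0)) k) r = kr k r.
Proof.
  intros Hc HN Hk.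
  pose proof (for_inv K x (fun j k' => counted k' /\ kg k' = map GI (seq 0 (c + j)) /\
    forall r, r <> 1 -> kr k' r = kr k r) 14 (KIn 1 0) k) as H.
  rewrite HN in H. apply H.
  - rewrite Nat.add_0_r. auto.
  - intros j k' _ (C & E & F). split; [|split].
    + apply ksem_counted; auto. exact Logic.I.
    + destruct C as [C _]. cbn [ksem emit kg]. unfold ref_val. cbn [fst snd].
      rewrite C, E, length_map, length_seq. rewrite Nat.add_succ_r, seq_S, map_app, Nat.add_0_r. reflexivity.
    + intros r Hr. cbn. rewrite kset_other by auto. auto.
Qed.

Lemma kvals_inputs inp l : kvals inp (map GI l) = map (fun i => nth i inp false) l.
Proof.
  induction l as [|i l IH] using rev_ind; auto.
  rewrite !map_app. cbn [map]. rewrite kvals_snoc, IH. reflexivity.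
Qed.

Variables (R : list bool -> bool) (y : list bool).
Hypothesis HR : forall w, length w = p ->
  snd (hrun MR TR (hinit MR (pair_enc x w))) 0%Z = sym_of_bool (R (pair_enc x w)).
Hypothesis Hy : forall i, i < length y ->
  snd (hrun MG TG (hinit MG x)) (Z.of_nat i) = sym_of_bool (nth i y false).
Hypothesis HyB : snd (hrun MG TG (hinit MG x)) (Z.of_nat (length y)) = SB.

Let kmain : kst := ksem K x main (ksem K x setup start).

Lemma pointers_odd o r : Nat.odd o = true -> In r (1 :: pointers o) -> Nat.odd r = true.
Proof.
  intros Ho Hr.
  assert (E : r = 1 \/ exists j, r = o + 2 * j).
  { unfold pointers in Hr. cbn [In] in Hr.
    destruct Hr as [<-|Hr]; [now left|right].
    repeat (destruct Hr as [<-|Hr]; [first [exists 0; lia | exists 1; lia | exists 2; lia | exists 3; lia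
      | exists 4; lia | exists 5; lia | exists 6; lia | exists 7; lia | exists 8; lia | exists 9; lia]|]).
    destruct Hr. }
  destruct E as [->|[j ->]]; [reflexivity|]. now rewrite Nat.odd_add_mul_2.
Qed.

Lemma main_correct :
  exists ks, kg kmain = GI 0 :: ks /\
  forall u v, length u = S m -> length v = S m ->
    nth (length ks) (kvals (u ++ v) (kg kmain)) false =
    eqb (side x p m R y u) (side x p m R y v) &&
    (bval (fun i => nth i u false) (S m) <=? bval (fun i => nth i v false) (S m)).
Proof.
  destruct setup_correct as (HP & Hkg & Hodd).
  set (k0 := ksem K x setup start) in *.
  destruct (inputs_correct (S m) 0 k0) as (C1 & G1 & F1); [apply HP|apply HP|exact Hkg|].
  set (k1 := ksem K x (KFor 14 (KIn 1 0)) k0) in *.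
  destruct (inputs_correct (S m) (0 + S m) k1) as (C2 & G2 & F2); auto.
  { rewrite F1 by lia. apply HP. }
  set (k2 := ksem K x (KFor 14 (KIn 1 0)) k1) in *.
  unfold kmain, main. rewrite !ksem_Seq. fold k1 k2.
  assert (R2 : forall r, r <> 1 -> kr k2 r = kr k0 r) by (intros; rewrite F2, F1; auto).
  assert (P2 : params x p TR TG m W d k2).
  { destruct HP. split; auto; rewrite R2; auto; discriminate. }
  assert (U3 : uses K (fun r => Nat.odd r = true) (fun _ => True) (side_prog MR MG 2 3)).
  { eapply uses_mono; [| |apply (side_prog_uses K MR MG HKR HKG 2 3); lia]; auto.
    intros r. now apply pointers_odd. }
  assert (U4 : uses K (fun r => Nat.odd r = true) (fun _ => True) (side_prog MR MG 14 23)).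
  { eapply uses_mono; [| |apply (side_prog_uses K MR MG HKR HKG 14 23); lia]; auto.
    intros r. now apply pointers_odd. }
  set (k3 := ksem K x (side_prog MR MG 2 3) k2).
  assert (P3 : params x p TR TG m W d k3) by now apply params_ksem.
  assert (F3 : forall r, ~ In r (1 :: pointers 3) -> kr k3 r = kr k2 r).
  { intros r. apply frame. apply side_prog_uses; auto with arith. }
  set (k4 := ksem K x (side_prog MR MG 14 23) k3).
  assert (P4 : params x p TR TG m W d k4) by now apply params_ksem.
  assert (F4 : forall r, ~ In r (1 :: pointers 23) -> kr k4 r = kr k3 r).
  { intros r. apply frame. apply side_prog_uses; auto with arith. }
  unfold pointers in F3, F4. cbn [In Nat.add] in F3, F4.
  set (k5 := ksem K x (KFor 14 (incn 47 1)) k4).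
  assert (E5 : forall r, kr k5 r = if r =? 47 then S m else kr k4 r).
  { intros r. unfold k5. rewrite for_incn_reg, (pa_cn _ _ _ _ _ _ _ _ P4).
    rewrite (F4 47), (F3 47), (R2 47), (Hodd 47) by (reflexivity || lia). destruct (r =? 47); lia. }
  assert (C5 : counted k5) by (apply ksem_counted; [cbn; auto with arith | apply P4]).
  set (k6 := ksem K x (le_prog 43 45 47 14) k5).
  assert (C6 : counted k6).
  { apply ksem_counted; auto. apply (uses_reserved K (fun _ => True) (fun _ => True)).
    apply le_prog_uses; auto; lia. }
  assert (F6 : forall r, ~ In r [1; 43; 45; 47] -> kr k6 r = kr k5 r).
  { intros r. apply frame. apply le_prog_uses; cbn; auto; lia. }
  set (fin := KEmit final_fun [(21, 0); (41, 0); (43, 0)]).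
  assert (Hks : exists ks, kg (ksem K x fin k6) = GI 0 :: ks /\ length ks = kr k6 1).
  { assert (HG : exists l, kg k6 = GI 0 :: l).
    { unfold k6, k5, k4, k3.
      destruct (ksem_ext K x (KSeq (side_prog MR MG 2 3) (KSeq (side_prog MR MG 14 23)
        (KSeq (KFor 14 (incn 47 1)) (le_prog 43 45 47 14)))) k2) as [l El].
      rewrite !ksem_Seq in El. rewrite El, G2. cbn. eauto. }
    destruct HG as [l HG]. destruct C6 as [C6 _]. unfold fin. cbn [ksem emit kg]. rewrite HG. cbn [app].
    eexists. split; [reflexivity|]. rewrite C6, HG, length_app. cbn. lia. }
  destruct Hks as (ks & Eks & Lks). exists ks. split; [exact Eks|].
  intros u v Hu Hv. set (inp := u ++ v).
  assert (B2 : forall i, i < S m + S m -> bit_at k2 inp i (nth i inp false)).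
  { intros i Hi. unfold bit_at. rewrite G2, kvals_inputs, nth_error_map, nth_error_seq.
    now rewrite (proj2 (Nat.ltb_lt i (0 + S m + S m))) by lia. }
  assert (Bu : forall i, i < S m -> bit_at k2 inp i (nth i u false)).
  { intros i Hi. specialize (B2 i ltac:(lia)). unfold inp in B2 at 2. rewrite app_nth1 in B2 by lia. exact B2. }
  assert (Bv : forall i, i < S m -> bit_at k2 inp (S m + i) (nth i v false)).
  { intros i Hi. specialize (B2 (S m + i) ltac:(lia)). unfold inp in B2 at 2.
    rewrite app_nth2 in B2 by lia. now replace (S m + i - length u) with i in B2 by lia. }
  assert (Hm : m = p + d) by reflexivity.
  assert (HW : TR <= W /\ TG + m <= W) by (unfold W; lia).
  assert (S3 : bit_at k3 inp (kr k3 21) (side x p m R y u)).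
  { apply (side_prog_correct K x inp MR MG HKR HKG p TR TG m W d R y Hm HW HR Hy HyB 2 3 u k2); auto; try lia.
    - intros r Hr. rewrite R2, Hodd; auto; [eapply (pointers_odd 3); [reflexivity | now right]|].
      unfold pointers in Hr. cbn in Hr. lia.
    - intros i Hi. rewrite (proj2 (pa_counted _ _ _ _ _ _ _ _ P2)). now apply Bu. }
  assert (S4 : bit_at k4 inp (kr k4 41) (side x p m R y v)).
  { apply (side_prog_correct K x inp MR MG HKR HKG p TR TG m W d R y Hm HW HR Hy HyB 14 23 v k3); auto; try lia.
    - intros r Hr. rewrite F3, R2, Hodd; auto; [eapply (pointers_odd 23); [reflexivity | now right]|..];
        unfold pointers in Hr; cbn in Hr; lia.
    - intros i Hi. rewrite (pa_cn _ _ _ _ _ _ _ _ P3). apply bit_ksem. now apply Bv. }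
  assert (S6 : bit_at k6 inp (kr k6 43)
    (bval (fun i => nth i u false) (S m) <=? bval (fun i => nth i v false) (S m))).
  { apply le_prog_correct with (a := 0) (b := S m); auto; try lia.
    - rewrite E5. cbn [Nat.eqb]. rewrite F4, F3, R2, Hodd by (reflexivity || lia). reflexivity.
    - rewrite E5. cbn [Nat.eqb]. rewrite F4, F3, R2, Hodd by (reflexivity || lia). reflexivity.
    - rewrite E5. cbn [Nat.eqb]. apply P4.
    - intros i Hi. unfold k5, k4, k3. do 3 apply bit_ksem. now apply Bu.
    - intros i Hi. unfold k5, k4, k3. do 3 apply bit_ksem. now apply Bv. }
  assert (Sf : bit_at (ksem K x fin k6) inp (kr k6 1)
    (eqb (side x p m R y u) (side x p m R y v) &&
    (bval (fun i => nth i u false) (S m) <=? bval (fun i => nth i v false) (S m)))).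
  { apply emit_bit_det with (vs := [side x p m R y u; side x p m R y v;
      bval (fun i => nth i u false) (S m) <=? bval (fun i => nth i v false) (S m)]); auto.
    repeat apply bits_cons; try apply bits_nil; rewrite Nat.add_0_r; auto.
    - rewrite F6, E5 by (cbn; lia). cbn [Nat.eqb]. rewrite F4 by lia.
      unfold k6, k5, k4. do 3 apply bit_ksem. exact S3.
    - rewrite F6, E5 by (cbn; lia). cbn [Nat.eqb]. unfold k6, k5. do 2 apply bit_ksem. exact S4. }
  rewrite Lks. now apply nth_error_nth.
Qed.

Lemma sync_out nb st0 k : sync K (unary nb) st0 k -> out st0 = encode_circuit (circuit_of K nb (kg k)).
Proof. intros (_ & _ & _ & _ & H). exact H. Qed.

Lemma sem_Seq c1 c2 st0 : sem x (Seq c1 c2) st0 = sem x c2 (sem x c1 st0).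
Proof. reflexivity. Qed.

Lemma generator_correct :
  out (sem x generator (init_st x)) = encode_circuit (circuit_of K (S m) (kg kmain)) /\
  Forall (arity_ok K) (kg kmain).
Proof.
  destruct setup_correct as (HP & Hkg & _).
  destruct setup_good as (S1 & S2 & _), main_good as (M1 & M2 & _).
  assert (H0 : sync K [] (init_st x) start).
  { split; [reflexivity|]. repeat split. constructor. }
  apply (cmd_of_correct K [] x setup _ _ S1 S2) in H0.
  unfold generator, kmain. rewrite !sem_Seq, pushes_out_unary.
  set (s1 := sem x (cmd_of K setup) (init_st x)) in *. clearbody s1.
  set (k1 := ksem K x setup start) in *. clearbody k1.
  assert (H1 : sync K (unary (S m)) (mk_st (regs s1) (out s1 ++ unary (expr_val (regs s1) (1, 14, 0)))) k1).
  { destruct H0 as (A1 & A2 & A3 & A4 & A5). split; [exact A1|].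
    split; [exact A2|]. split; [exact A3|]. split; [exact A4|].
    cbn [out expr_val]. rewrite A5, Hkg, A1, (pa_cn _ _ _ _ _ _ _ _ HP). cbn [expand_from flat_map app].
    rewrite app_nil_r, Nat.add_0_r, Nat.mul_1_l. reflexivity. }
  apply (cmd_of_correct K (unary (S m)) x main _ _ M1 M2) in H1.
  split; [now apply sync_out | apply H1].
Qed.

(** A further output bit would lie where the tape is still blank after [TG] steps. *)
Lemma length_y : length y <= m.
Proof.
  destruct (Nat.le_gt_cases (length y) (n + 1 + TG)) as [H|H]; [unfold m, d; lia|].
  pose proof (Hy (n + 1 + TG) H) as E. rewrite hrun_blank in E by (unfold n; lia).
  destruct (nth (n + 1 + TG) y false); discriminate.
Qed.

Let C : circuit := circuit_of K (S m) (kg kmain).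
Let s : list bool -> bool := side x p m R y.

Lemma cle_eq u v : length u = S m -> length v = S m ->
  cle C u v = eqb (s u) (s v) && (bin_val u <=? bin_val v).
Proof.
  intros Hu Hv. destruct main_correct as (ks & Eks & H). destruct generator_correct as [_ Har].
  unfold cle, C. rewrite Eks in *. rewrite circuit_of_eval by (now apply Forall_inv_tail in Har).
  rewrite H by auto. now rewrite !(bin_val_bval _ (S m)) by lia.
Qed.

(** Stated additively to avoid truncated subtraction: the strings starting with 0 contribute the
    accepted witnesses, those starting with 1 contribute [2 ^ m - bin_val y]. *)
Lemma count_side : count s (S m) + bin_val y = count (fun w => R (pair_enc x w)) p + 2 ^ m.
Proof.
  rewrite count_S. unfold s. cbn [side].
  pose proof (count_padded (fun w => R (pair_enc x w)) p d) as E. change (p + d) with m in E.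
  rewrite E.
  rewrite (bin_val_bval y m) by apply length_y.
  pose proof (bval_lt (fun i => nth i y false) m) as Hlt.
  rewrite (count_ext (fun w => bval (fun i => nth i y false) m <=? bval (fun i => nth i w false) m)
    (fun w => bval (fun i => nth i y false) m <=? bin_val w)).
  - rewrite count_ge by lia. clearbody m. lia.
  - intros w Hw. now rewrite (bin_val_bval w m) by lia.
Qed.

Lemma reduction_correct :
  exists C, out (sem x generator (init_st x)) = encode_circuit C /\ PromisePO C /\
    (ExistsGame C <-> length (filter (fun w => R (pair_enc x w)) (all_strings p)) <> bin_val y).
Proof.
  exists C. split; [apply generator_correct|].
  assert (Hrefl : forall u, length u = S m -> cle C u u = true).
  { intros u Hu. rewrite cle_eq, eqb_reflx, Nat.leb_refl by auto. reflexivity. }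
  assert (Hanti : forall u v, length u = S m -> length v = S m ->
    cle C u v = true -> cle C v u = true -> u = v).
  { intros u v Hu Hv. rewrite !cle_eq, !andb_true_iff, !Nat.leb_le by auto. intros [_ H1] [_ H2].
    apply bin_val_inj; lia. }
  assert (Htrans : forall u v w, length u = S m -> length v = S m -> length w = S m ->
    cle C u v = true -> cle C v w = true -> cle C u w = true).
  { intros u v w Hu Hv Hw. rewrite !cle_eq, !andb_true_iff, !Nat.leb_le by auto.
    intros [H1 H2] [H3 H4]. apply eqb_prop in H1, H3. rewrite H1, H3, eqb_reflx. split; auto. lia. }
  assert (Htot : forall u v, length u = S m -> length v = S m -> s u = s v ->
    cle C u v = true \/ cle C v u = true).
  { intros u v Hu Hv Hs. rewrite !cle_eq, Hs, eqb_reflx by auto. cbn. rewrite !Nat.leb_le. lia. }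
  assert (Hside : forall u v, length u = S m -> length v = S m -> s u <> s v -> cle C u v = false).
  { intros u v Hu Hv Hs. rewrite cle_eq by auto. destruct (s u), (s v); try congruence; reflexivity. }
  split.
  - split; [exact Hrefl|]. split; [exact Hanti|]. split; [exact Htrans|].
    exists s. intros u v Hu Hv. split; auto.
  - unfold ExistsGame. change (c_n C) with (S m).
    rewrite (win_two_chains _ (cle C) s (fun u => length u = S m)); auto.
    + change (length (on_side _ s true (all_strings (S m))))
        with (count (fun u => eqb (s u) true) (S m)).
      change (length (on_side _ s false (all_strings (S m))))
        with (count (fun u => eqb (s u) false) (S m)).
      rewrite (count_ext _ s) by (intros u _; now destruct (s u)).
      rewrite (count_ext (fun u => eqb (s u) false) (fun u => negb (s u))) by (intros u _; now destruct (s u)).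
      (* The heaps add up to [2 ^ (m + 1)], so they are equal exactly when the red one has [2 ^ m]
         elements, which by [count_side] means that the two numbers agree. *)
      pose proof (count_compl s (S m)) as Hc. pose proof count_side as Hs.
      change (length (filter (fun w => R (pair_enc x w)) (all_strings p)))
        with (count (fun w => R (pair_enc x w)) p).
      rewrite negb_true_iff, Nat.eqb_neq. cbn [Nat.pow] in Hc. lia.
    + apply all_strings_NoDup.
    + apply Forall_forall. intros u Hu. now apply all_strings_spec.
Qed.
End Program.

(* Nim_2(Succinct, PO) is coC=P-hard under polynomial-time many-one
   reductions: every coC=P language L reduces to it, i.e. a poly-time map g
   sends every x to (the encoding of) a circuit satisfying the promise, which
   is an exists-game iff x is in L. *)
Theorem mainTheorem12 :
  forall L : list bool -> Prop,
    coCeqP L ->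
    exists g : list bool -> list bool,
      PolyTimeFun g /\
      forall x, exists C : circuit,
        g x = encode_circuit C /\ PromisePO C /\ (L x <-> ExistsGame C).
Proof.
  intros L (L' & (f & h & (R & cP & kP & (MR & cR & kR & HMR) & Hf) & (y & (MG & cG & kG & HMG) & Hh) & HL') & HL).
  set (K := 8 + tm_n MR + tm_n MG).
  exists (fun x => out (sem x (generator K kP cP kR cR kG cG MR MG) (init_st x))).
  split; [apply polytime_cmd, generator_ok; unfold K; lia|].
  intros x.
  destruct (reduction_correct K kP cP kR cR kG cG MR MG ltac:(unfold K; lia) ltac:(unfold K; lia) x R (y x))
    as (C & HC & HP & HG).
  - intros w Hw. specialize (HMR (pair_enc x w)).
    apply halts_with_hrun with (t' := cR * (2 * length x + 2 + (cP * length x ^ kP + cP)) ^ kR + cR) in HMR.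
    + destruct HMR as [H _]. apply (H 0). cbn. lia.
    (* All encodings of [x] with a witness have the same length, so one time bound serves all of
       them. *)
    + enough (length (pair_enc x w) = 2 * length x + 2 + (cP * length x ^ kP + cP)) as -> by lia.
      unfold pair_enc. rewrite !length_app, Hw. cbn [length].
      enough (length (flat_map (fun b : bool => [b; b]) x) = 2 * length x) by lia.
      clear. induction x; cbn; lia.
  - apply (halts_with_hrun MG x _ _ _ (HMG x) (Nat.le_refl _)).
  - apply (halts_with_hrun MG x _ _ _ (HMG x) (Nat.le_refl _)).
  - exists C. split; [exact HC|]. split; [exact HP|].
    rewrite HG, HL, HL', Hf, Hh. reflexivity.
Qed.
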